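(* Let $0<\gamma\le 1$. Assume that $1\le\alpha<q\le\infty$, $w\in A_1$ and $\mu\in\Delta_2$. Then there is a constant $C>0$ such that for every sequence $\vec f=(f_1,f_2,\ldots)$ of locally integrable functions on $\mathbb R^n$ (with $C$ independent of $\vec f$), $$\bigg\|\bigg(\sum_{j=1}^\infty\big|\mathcal S_\gamma(f_j)\big|^2\bigg)^{1/2}\bigg\|_{(WL^1,L^q)^\alpha(w;\mu)}\le C\,\bigg\|\bigg(\sum_{j=1}^\infty|f_j|^2\bigg)^{1/2}\bigg\|_{(L^1,L^q)^\alpha(w;\mu)}.$$
   Context: **Intrinsic square function.** For $0<\gamma\le1$ let $\mathcal C_\gamma$ be the family of functions $\varphi:\mathbb R^n\to\mathbb R$ with support in $\{x:|x|\le1\}$, $\int_{\mathbb R^n}\varphi(x)\,dx=0$, and $|\varphi(x)-\varphi(x')|\le|x-x'|^\gamma$ for all $x,x'\in\mathbb R^n$. Put $\varphi_t(y)=t^{-n}\varphi(y/t)$ for $t>0$, and $\Gamma(x)=\{(y,t)\in\mathbb R^n\times(0,\infty):|x-y|<t\}$. For $f\in L^1_{loc}(\mathbb R^n)$, $$\mathcal S_\gamma(f)(x)=\left(\iint_{\Gamma(x)}\Big[\sup_{\varphi\in\mathcal C_\gamma}|\varphi_t*f(y)|\Big]^2\frac{dy\,dt}{t^{n+1}}\right)^{1/2}.$$ **Weights.** A weight is a positive, locally integrable, measurable function on $\mathbb R^n$. $B(y,r)$ is the open ball with center $y$ and radius $r$; $|E|$ is Lebesgue measure; $w(E)=\int_E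 w(x)\,dx$; $\chi_E$ is the characteristic function of $E$. $w\in A_1$ means there is $C>0$ with $\frac1{|B|}\int_Bw(x)\,dx\le C\operatorname{ess\,inf}_{x\in B}w(x)$ for every ball $B\subset\mathbb R^n$. A weight $\mu$ belongs to $\Delta_2$ if there is $C>0$ with $\mu(2B)\le C\mu(B)$ for every ball $B$, where $2B$ is the ball with the same center and twice the radius. **Weighted amalgam spaces.** $\|f\|_{L^1_w}=\int_{\mathbb R^n}|f|w\,dx$ and $\|f\|_{WL^1_w}=\sup_{\lambda>0}\lambda\, w(\{x\in\mathbb R^n:|f(x)|>\lambda\})$. For $1\le\alpha\le q\le\infty$ and weights $w,\mu$, $$\|f\|_{(L^1,L^q)^\alpha(w;\mu)}=\sup_{r>0}\left\{\int_{\mathbb R^n}\Big[w(B(y,r))^{1/\alpha-1-1/q}\,\|f\chi_{B(y,r)}\|_{L^1_w}\Big]^q\mu(y)\,dy\right\}^{1/q},$$ $$\|f\|_{(WL^1,L^q)^\alpha(w;\mu)}=\sup_{r>0}\left\{\int_{\mathbb R^n}\Big[w(B(y,r))^{1/\alpha-1-1/q}\,\|f\chi_{B(y,r)}\|_{WL^1_w}\Big]^q\mu(y)\,dy\right\}^{1/q},$$ with the usual modification when $q=\infty$ (essential supremum over $y$, and $1/q=0$). *)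

(* Defs.v *)
From HB Require Import structures.
From mathcomp Require Import all_boot all_order all_algebra.
From mathcomp Require Import all_classical all_reals all_analysis.
From mathcomp Require Import ess_sup_inf.

Set Implicit Arguments.
Unset Strict Implicit.
Unset Printing Implicit Defensive.

Import Order.TTheory GRing.Theory Num.Theory.
Import numFieldNormedType.Exports.

Local Open Scope classical_set_scope.
Local Open Scope ring_scope.

(* The library has no Lebesgue measure in dimension n.  [borelRn R n] carries
   the Borel (= product) sigma-algebra of 'rV[R]_n and [borel_lebesgue] the
   iterated product of the one-dimensional Lebesgue measure; [Rn R n] carries
   its completion, so that measurable means Lebesgue measurable. *)

Definition borelRn (R : realType) (n : nat) : Type := 'rV[R]_n.

Definition borelRn_display : measure_display.
Proof. exact: default_measure_display. Qed.

Section borelRn.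
Variables (R : realType) (n : nat).

Definition borelRn_coord (i : 'I_n) (x : borelRn R n) : measurableTypeR R :=
  (x : 'rV[R]_n) 0 i.

HB.instance Definition _ := Pointed.copy (borelRn R n) 'rV[R]_n.

Let borelRn0 : g_sigma_preimage borelRn_coord set0.
Proof. exact: sigma_algebra0. Qed.

Let borelRnC A :
  g_sigma_preimage borelRn_coord A -> g_sigma_preimage borelRn_coord (~` A).
Proof. exact: sigma_algebraC. Qed.

Let borelRn_bigcup (F : _^nat) : (forall i, g_sigma_preimage borelRn_coord (F i)) ->
  g_sigma_preimage borelRn_coord (\bigcup_i (F i)).
Proof. exact: sigma_algebra_bigcup. Qed.

HB.instance Definition _ := @isMeasurable.Build borelRn_display
  (borelRn R n) (g_sigma_preimage borelRn_coord) borelRn0 borelRnC borelRn_bigcup.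

End borelRn.

Lemma measurable_borelRn_coord (R : realType) n (i : 'I_n) :
  measurable_fun [set: borelRn R n] (borelRn_coord i).
Proof.
move=> _ Y mY; rewrite setTI; apply: sub_sigma_algebra => /=.
rewrite -bigcup_seq/=; exists i => /=; first by rewrite mem_index_enum.
by exists Y => //; rewrite setTI.
Qed.

Lemma measurable_fun_borelRnP (R : realType) d (T : measurableType d) n
    (f : T -> borelRn R n) :
  measurable_fun [set: T] f <->
  forall i, measurable_fun [set: T] (borelRn_coord i \o f).
Proof.
apply: (@iff_trans _ (g_sigma_preimage
    (fun i => @borelRn_coord R n i \o f) `<=` measurable)).
  rewrite (@g_sigma_preimage_comp _ _ _ (borelRn R n)); split=> [mf A [/= C preC <-]|prefS].
    exact: mf.
  by move=> _ A mA; apply: prefS; exists A.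
split=> [tnthfS i|mf].
- move=> _ A mA.
  apply: tnthfS; apply: sub_sigma_algebra.
  rewrite -bigcup_seq/=; exists i => /=; first by rewrite mem_index_enum.
  by exists A.
- apply: smallest_sub; first exact: sigma_algebra_measurable.
  rewrite -bigcup_seq; apply: bigcup_sub => i _ A [B mB <-]; exact: mf.
Qed.

Definition borelRn_snoc (R : realType) (n : nat)
    (p : borelRn R n * measurableTypeR R) : borelRn R n.+1 :=
  \row_(i < n.+1) if unlift ord_max i is Some j then borelRn_coord j p.1 else p.2.

Lemma measurable_borelRn_snoc (R : realType) (n : nat) :
  measurable_fun setT (@borelRn_snoc R n).
Proof.
apply/measurable_fun_borelRnP => i.
rewrite (_ : _ \o _ = fun p : borelRn R n * measurableTypeR R =>
    if unlift ord_max i is Some j then borelRn_coord j p.1 else p.2); last first.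
  by apply/funext => p /=; rewrite /borelRn_coord /borelRn_snoc mxE.
case: (unlift ord_max i) => [j|]; last exact: measurable_snd.
by apply: measurableT_comp; [exact: measurable_borelRn_coord|exact: measurable_fst].
Qed.

Fixpoint borel_lebesgue (R : realType) (n : nat) : set (borelRn R n) -> \bar R :=
  match n with
  | 0 => @dirac _ (borelRn R 0) (0 : 'rV[R]_0) R
  | m.+1 => pushforward (borel_lebesgue (n := m) \x @lebesgue_measure R)%E
              (@borelRn_snoc R m)
  end.

Section borel_lebesgue_measure.
Local Open Scope ereal_scope.
Variable R : realType.

Let borel_lebesgueP n : [/\ @borel_lebesgue R n set0 = 0,
  forall A, 0 <= @borel_lebesgue R n A &
  semi_sigma_additive (@borel_lebesgue R n)].
Proof.
elim: n => [|n [m0 m_ge0 m_sigma]].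
  split; [exact: measure0|move=> A; exact: measure_ge0|].
  exact: measure_semi_sigma_additive.
pose mM := isMeasure.Build _ _ _ (@borel_lebesgue R n) m0 m_ge0 m_sigma.
pose m : {measure set (borelRn R n) -> \bar R} :=
  HB.pack (@borel_lebesgue R n) mM.
have mE : @borel_lebesgue R n.+1 =
    pushforward (m \x @lebesgue_measure R) (@borelRn_snoc R n) by [].
rewrite mE; have ms := @measurable_borelRn_snoc R n.
split.
- by rewrite /pushforward preimage_set0 measure0.
- by move=> A; exact: measure_ge0.
- move=> F mF tF mUF; rewrite /pushforward preimage_bigcup.
  apply: measure_semi_sigma_additive.
  + by move=> k; rewrite -[X in measurable X]setTI; exact: ms.
  + apply/trivIsetP => /= i j _ _ ij; rewrite -preimage_setI.
    by move/trivIsetP : tF => /(_ _ _ _ _ ij) ->//; rewrite preimage_set0.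
  + by rewrite -preimage_bigcup -[X in measurable X]setTI; exact: ms.
Qed.

Let borel_lebesgue0 n : @borel_lebesgue R n set0 = 0.
Proof. by case: (borel_lebesgueP n). Qed.

Let borel_lebesgue_ge0 n A : 0 <= @borel_lebesgue R n A.
Proof. by case: (borel_lebesgueP n). Qed.

Let borel_lebesgue_sigma n : semi_sigma_additive (@borel_lebesgue R n).
Proof. by case: (borel_lebesgueP n). Qed.

HB.instance Definition _ n := isMeasure.Build _ _ _ (@borel_lebesgue R n)
  (@borel_lebesgue0 n) (@borel_lebesgue_ge0 n) (@borel_lebesgue_sigma n).

End borel_lebesgue_measure.

Lemma borelRn_coord_snoc (R : realType) (n : nat)
    (p : borelRn R n * measurableTypeR R) (i : 'I_n.+1) :
  borelRn_coord i (borelRn_snoc p) =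
  if unlift ord_max i is Some j then borelRn_coord j p.1 else p.2.
Proof. by rewrite /borelRn_coord /borelRn_snoc mxE. Qed.

Lemma borel_lebesgue_box (R : realType) (n : nat) (A : 'I_n -> set R) :
  (forall i, measurable (A i)) ->
  borel_lebesgue ([set x | forall i, A i (borelRn_coord i x)] : set (borelRn R n)) =
  (\prod_(i < n) lebesgue_measure (A i))%E.
Proof.
elim: n A => [|n IH] A mA.
  by rewrite big_ord0 /= /dirac indicE mem_set//; case.
rewrite big_ord_recr/= /pushforward.
set S := (X in product_measure1 _ _ X).
have -> : S = [set x : borelRn R n |
    forall i, A (lift ord_max i) (borelRn_coord i x)] `*` A ord_max.
  apply/seteqP; split => [[x y] /= h|[x y] /= [h1 h2] i].
    split => /=.
      by move=> i; have := h (lift ord_max i); rewrite borelRn_coord_snoc liftK.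
    by have := h ord_max; rewrite borelRn_coord_snoc unlift_none.
  by rewrite borelRn_coord_snoc; case: unliftP => [j ->|->].
rewrite product_measure1E//=; last exact: mA.
  have -> := IH (fun i => A (lift ord_max i)) (fun i => mA _).
  congr (_ * _)%E; apply: eq_bigr => i _; congr (lebesgue_measure (A _)).
  by apply/val_inj; rewrite /= /bump leqNgt ltn_ord.
have -> : [set x : borelRn R n | forall i, A (lift ord_max i) (borelRn_coord i x)] =
    \bigcap_(i in [set: 'I_n]) (borelRn_coord i @^-1` A (lift ord_max i)).
  by apply/seteqP; split => x /= h i; [move=> _; exact: (h i)|exact: (h i I)].
apply: fin_bigcap_measurable => // i _; rewrite -[X in measurable X]setTI.
by apply: measurable_borelRn_coord => //; exact: mA.
Qed.

Definition Rn (R : realType) (n : nat) : Type :=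
  caratheodory_type (mu_ext (@borel_lebesgue R n)).

HB.instance Definition _ (R : realType) (n : nat) :=
  Measurable.copy (Rn R n) (caratheodory_type (mu_ext (@borel_lebesgue R n))).
(* The norm inherited here is the sup norm of 'rV[R]_n; it is only used through
   the topology it induces. *)
HB.instance Definition _ (R : realType) (n : nat) :=
  NormedModule.copy (Rn R n) 'rV[R]_n.

Definition leb (R : realType) (n : nat) : set (Rn R n) -> \bar R :=
  @completed_measure_extension _ _ _ (@borel_lebesgue R n).
HB.instance Definition _ (R : realType) (n : nat) := Measure.on (@leb R n).
Arguments leb {R n}.

Lemma leb_borel (R : realType) (n : nat) (A : set (borelRn R n)) : measurable A ->
  measurable (A : set (Rn R n)) /\ leb (A : set (Rn R n)) = borel_lebesgue A.
Proof.
move=> mA; split; first by apply: sub_caratheodory; apply: sub_sigma_algebra.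
by rewrite /leb /completed_measure_extension /= measurable_mu_extE.
Qed.

Definition enorm (R : realType) (n : nat) (x : Rn R n) : R :=
  Num.sqrt (\sum_(i < n) ((x : 'rV[R]_n) 0 i) ^+ 2).

Definition eball (R : realType) (n : nat) (x : Rn R n) (r : R) : set (Rn R n) :=
  [set y | enorm (x - y) < r].

Section definitions.
Local Open Scope ereal_scope.
Variables (R : realType) (n : nat).
Local Notation V := (Rn R n).

Definition loc_integrable (f : V -> R) : Prop :=
  measurable_fun [set: V] f /\
  forall K : set V, compact K -> \int[leb]_(x in K) `|f x|%:E < +oo.

Definition Cgamma (gamma : R) (phi : V -> R) : Prop :=
  [/\ closure [set x | phi x != 0%R] `<=` [set x | enorm x <= 1]%R,
      \int[leb]_x (phi x)%:E = 0 &
      forall x x', (`|phi x - phi x'| <= enorm (x - x') `^ gamma)%R].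

Definition dilate (phi : V -> R) (t : R) (y : V) : R :=
  (t ^- n * phi (t^-1 *: y))%R.

Definition convolution (g f : V -> R) (y : V) : \bar R :=
  \int[leb]_z (g (y - z) * f z)%:E.

Definition cone (x : V) : set (V * measurableTypeR R) :=
  [set p | (0 < p.2)%R /\ (enorm (x - p.1) < p.2)%R].

Definition square_function (gamma : R) (f : V -> R) (x : V) : \bar R :=
  (\int[leb \x @lebesgue_measure R]_(p in cone x)
     (ereal_sup [set `|convolution (dilate phi p.2) f p.1|
                | phi in Cgamma gamma] ^+ 2 * (p.2 ^- n.+1)%:E)) `^ 2^-1.

Definition weight (w : V -> R) : Prop :=
  (forall x, (0 < w x)%R) /\ loc_integrable w.

Definition wmeas (w : V -> R) (E : set V) : \bar R :=
  \int[leb]_(x in E) (w x)%:E.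

(* [ess_inf] of the library relative to the set [B] *)
Definition ess_inf_on (B : set V) (f : V -> \bar R) : \bar R :=
  ereal_sup [set m | \forall x \ae leb, B x -> m <= f x].

Definition A1 (w : V -> R) : Prop :=
  weight w /\ exists2 C : R, (0 < C)%R & forall (x : V) (r : R), (0 < r)%R ->
    (leb (eball x r))^-1 * \int[leb]_(y in eball x r) (w y)%:E <=
    C%:E * ess_inf_on (eball x r) (EFin \o w).

Definition Delta2 (mu : V -> R) : Prop :=
  weight mu /\ exists2 C : R, (0 < C)%R & forall (x : V) (r : R), (0 < r)%R ->
    wmeas mu (eball x (2 * r)) <= C%:E * wmeas mu (eball x r).

Definition L1_norm (w : V -> R) (g : V -> \bar R) : \bar R :=
  \int[leb]_x (`|g x| * (w x)%:E).

Definition weakL1_norm (w : V -> R) (g : V -> \bar R) : \bar R :=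
  ereal_sup [set l%:E * wmeas w [set x | l%:E < `|g x|]
            | l in [set l : R | (0 < l)%R]].

(* [N] is the local norm, [L1_norm w] or [weakL1_norm w]; [s] below is 1/q, so
   0 when q is infinite, and [g \_ B] is g times the indicator of B. *)
Definition amalgam_norm (N : (V -> \bar R) -> \bar R) (alpha : R) (q : \bar R)
    (w mu : V -> R) (g : V -> \bar R) : \bar R :=
  let local_term (s r : R) (y : V) :=
    wmeas w (eball y r) `^ (alpha^-1 - 1 - s) * N (g \_ (eball y r)) in
  ereal_sup [set match q with
    | q'%:E => (\int[leb]_y (local_term q'^-1%R r y `^ q' * (mu y)%:E)) `^ q'^-1
    | +oo => ess_sup leb (local_term 0%R r)
    | -oo => 0
    end | r in [set r : R | (0 < r)%R]].

Definition amalgam_L1 (alpha : R) (q : \bar R) (w mu : V -> R) :=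
  amalgam_norm (L1_norm w) alpha q w mu.

Definition amalgam_weakL1 (alpha : R) (q : \bar R) (w mu : V -> R) :=
  amalgam_norm (weakL1_norm w) alpha q w mu.

Definition l2_norm (g : nat -> V -> \bar R) (x : V) : \bar R :=
  (\sum_(0 <= j <oo) `|g j x| ^+ 2) `^ 2^-1.

End definitions.

(* Main.v *)
(* Fix a ball B(y, r) and let G be the square function of the sequence, F its
   l^2 norm.  At scales t < r a shifted triadic grid puts the support of phi_t in
   one cell Q; expanding f in martingale differences D_m f along the grid, the mean
   zero and the Hoelder condition bound |phi_t * f| on Q by a geometrically weighted
   sum of the averages over Q of |D_m f|.  Stopping the martingale when the averages
   of F exceed lambda, and using that A1 makes the running maximum of the averages of
   w comparable with w, an L^2 energy estimate before the stopping time and an L^1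
   estimate after it give a weak (1,1) bound with respect to w.  At scales
   t ~ 3^l r, |phi_t * f| is at most an average over B(y, 3^(l+2) r).  The
   resulting local bound
     |G 1_B(y,r)|_{WL^1_w} <= A sum_l w(B(y,r)) / w(B(y,3^l r)) |F 1_B(y,3^l r)|_{L^1_w}
   is summable in l, because A1 weights are reverse doubling and
   1/alpha - 1/q > 0, so it passes to the L^q_mu norm in y. *)

From HB Require Import structures.
Require Import Defs.
From mathcomp Require Import all_boot all_order all_algebra.
From mathcomp Require Import all_classical all_reals all_analysis.
From mathcomp Require Import measurable_realfun ess_sup_inf ring lra zify.

Set Implicit Arguments.
Unset Strict Implicit.
Unset Printing Implicit Defensive.

Import Order.TTheory GRing.Theory Num.Theory.
Import numFieldNormedType.Exports.

Local Open Scope classical_set_scope.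
Local Open Scope ring_scope.
Local Open Scope ereal_scope.

(** Neither the square function nor the supremum over kernels is shown to be measurable: an
    integrand is first replaced by a measurable majorant, by monotonicity of the lower integral, and
    only majorants are added, interchanged and integrated. The half-mesh shifts of the grids stay
    nested only for an odd ratio of meshes, whence 3. No bad part of f is constructed: one stopping
    time, read off the averages of F and hence common to all [f j], masks the martingale
    differences. Orthogonality survives the weight because w is replaced by a quantity constant on
    the cells where the difference has mean zero. After stopping only F in L^1 is available; a
    difference of level i + k, seen from level i, then counts only where the stopping level lies in
    ]i, i + k], and the geometric weight in k makes these contributions summable over i. Two square
    roots of that weight are spent on the way, which is why the decay is written as a fourth power.
    Cutting each [f j] off outside B(y, 3r) makes it integrable and lets the filtration start at
    mesh 8r. *)

(* The integral of a non-measurable function is a lower integral, still monotone. *)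
Lemma ge0_le_lower_integral d (T : measurableType d) (R : realType)
    (mu : {measure set T -> \bar R}) (D : set T) (f g : T -> \bar R) :
  (forall x, D x -> 0 <= f x) -> (forall x, D x -> f x <= g x) ->
  \int[mu]_(x in D) f x <= \int[mu]_(x in D) g x.
Proof.
move=> f0 fg.
rewrite (integral_mkcond D f) (integral_mkcond D g).
have F0 x : 0 <= (f \_ D) x.
  by rewrite patchE; case: ifPn => // xD; apply: f0; rewrite inE in xD.
have FG x : (f \_ D) x <= (g \_ D) x.
  by rewrite !patchE; case: ifPn => // xD; apply: fg; rewrite inE in xD.
rewrite ge0_integralTE// ge0_integralTE//; last first.
  by move=> x; exact: le_trans (F0 x) (FG x).
apply: le_ereal_sup => _ [h hf <-]; exists h => // x.
exact: le_trans (hf x) (FG x).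
Qed.

(** * Averages over a countable partition *)

(** A partition is encoded by a map to [nat], its cells being the fibres: countability is built in,
    and a cellwise function is measurable as soon as the fibres are. *)
Definition cell (T : Type) (idx : T -> nat) (x : T) : set T := [set z | idx z = idx x].

Definition cellwise (T : Type) (idx : T -> nat) (U : Type) (g : T -> U) : Prop :=
  forall x z, idx x = idx z -> g x = g z.

Lemma fibre_cell (T : Type) (idx : T -> nat) k :
  idx @^-1` [set k] = set0 \/ exists x, idx @^-1` [set k] = cell idx x.
Proof.
have [->|/set0P [x /= xk]] := eqVneq (idx @^-1` [set k]) set0; [by left|right].
by exists x; rewrite /cell xk.
Qed.

(** One point is chosen in each nonempty fibre. An actual value of [psi], unlike a supremum over the
    cell, inherits every pointwise bound on [psi]. *)
Lemma cell_sampling (T : Type) (idx : T -> nat) (U : Type) (psi : T -> U) :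
  exists2 b : T -> U, cellwise idx b &
  forall x, exists2 z, idx z = idx x & b x = psi z.
Proof.
have [x0|noT] := pselect (exists x : T, True); last first.
  by exists psi => [x|x]; exfalso; apply: noT; exists x.
pose b k := if pselect (exists z, idx z = k) is left e
  then psi (projT1 (cid e)) else psi (projT1 (cid x0)).
exists (b \o idx) => [x z /= ->//|x]; rewrite /= /b.
case: pselect => [e|[]]; last by exists x.
by case: cid => z zx /=; exists z.
Qed.

Section one_partition.
Context d (T : measurableType d) (R : realType).
Variables (mu : {measure set T -> \bar R}) (idx : T -> nat) (v : R).

Local Notation cell := (cell idx).
Local Notation cellwise := (cellwise idx).

(** The common volume of the cells is a real parameter [v], so its inverse is an ordinary real; it
    is tied to the measure by [mu_cell]. *)
Definition avg (g : T -> \bar R) (x : T) : \bar R :=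
  v^-1%:E * \int[mu]_(z in cell x) g z.

Definition cond_exp (f : T -> R) (x : T) : R := fine (avg (EFin \o f) x).

Hypothesis midx : forall k, measurable (idx @^-1` [set k]).
Hypothesis v_gt0 : (0 < v)%R.
Hypothesis mu_cell : forall x, mu (cell x) = v%:E.

Lemma measurable_cell x : measurable (cell x).
Proof. exact: (midx (idx x)). Qed.

Lemma cellwise_measurable d' (U : measurableType d') (g : T -> U) :
  cellwise g -> measurable_fun setT g.
Proof.
move=> gc _ Y mY; rewrite setTI.
rewrite (_ : g @^-1` Y =
  \bigcup_(k in [set k | exists2 z, idx z = k & Y (g z)]) (idx @^-1` [set k])).
  by apply: bigcup_measurable => k _; exact: midx.
apply/seteqP; split => [x Yx|x [k [z zk Yz] /= xk]].
  by exists (idx x) => //; exists x.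
by rewrite /= (gc x z) // xk.
Qed.

Let trivIset_idx (Q : set T) : trivIset setT (fun k => Q `&` (idx @^-1` [set k])).
Proof. by move=> i j _ _ [x [[_ /= <-] [_ /= <-]]]. Qed.

Let bigcup_idx (Q : set T) : Q = \bigcup_k (Q `&` (idx @^-1` [set k])).
Proof. by apply/seteqP; split => [x Qx|x [k _ []]//]; exists (idx x). Qed.

Lemma ge0_integral_fibres (Q : set T) (g : T -> \bar R) : measurable Q ->
  measurable_fun Q g -> (forall x, Q x -> 0 <= g x) ->
  \int[mu]_(x in Q) g x = \sum_(k <oo) \int[mu]_(x in Q `&` (idx @^-1` [set k])) g x.
Proof.
move=> mQ mg g0; rewrite {1}(bigcup_idx Q) ge0_integral_bigcup//.
- by move=> k; exact: measurableI.
- by rewrite -bigcup_idx.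
- by move=> x; rewrite -bigcup_idx; exact: g0.
Qed.

Lemma integral_fibres (Q : set T) (g : T -> \bar R) : measurable Q ->
  mu.-integrable Q g ->
  \int[mu]_(x in Q) g x = \sum_(k <oo) \int[mu]_(x in Q `&` (idx @^-1` [set k])) g x.
Proof.
move=> mQ gi; rewrite {1}(bigcup_idx Q) integral_bigcup//.
- by move=> k; exact: measurableI.
- by rewrite -bigcup_idx.
Qed.

Lemma avg_ge0 g x : (forall z, 0 <= g z) -> 0 <= avg g x.
Proof.
move=> g0; apply: mule_ge0; first by rewrite lee_fin invr_ge0 ltW.
exact: integral_ge0.
Qed.

Lemma cellwise_avg g : cellwise (avg g).
Proof. by move=> x z xz; rewrite /avg /cell xz. Qed.

Lemma cellwise_cond_exp f : cellwise (cond_exp f).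
Proof. by move=> x z xz; rewrite /cond_exp (cellwise_avg _ xz). Qed.

Lemma measurable_avg g : measurable_fun setT (avg g).
Proof. exact/cellwise_measurable/cellwise_avg. Qed.

Lemma measurable_cond_exp f : measurable_fun setT (cond_exp f).
Proof. exact/cellwise_measurable/cellwise_cond_exp. Qed.

Lemma integral_cell g x : \int[mu]_(z in cell x) g z = v%:E * avg g x.
Proof. by rewrite /avg muleA -EFinM mulfV ?gt_eqF// mul1e. Qed.

Lemma avgM u g x : cellwise u -> (forall z, 0 <= u z) -> (forall z, 0 <= g z) ->
  measurable_fun setT g -> avg (fun z => u z * g z) x = u x * avg g x.
Proof.
move=> uc u0 g0 mg; rewrite /avg muleCA; congr (_ * _).
rewrite -ge0_integralZl//; [|exact: measurable_cell|exact: measurable_funTS].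
by apply: eq_integral => z; rewrite inE => /uc ->.
Qed.

Lemma avg_cst c x : 0 <= c -> avg (cst c) x = c.
Proof.
move=> c0; rewrite /avg integral_cst; last exact: measurable_cell.
by rewrite mu_cell muleCA -EFinM mulVf ?gt_eqF// mule1.
Qed.

Lemma avg_cellwise u x : cellwise u -> (forall z, 0 <= u z) -> avg u x = u x.
Proof.
move=> uc u0; have := @avgM u (cst 1) x uc u0 (fun=> lee01) (measurable_cst _).
by rewrite avg_cst// mule1 => <-; congr avg; apply/funext => z; rewrite mule1.
Qed.

Lemma le_avg g h x : (forall z, 0 <= g z) -> (forall z, g z <= h z) ->
  avg g x <= avg h x.
Proof.
move=> g0 gh; apply: lee_wpmul2l; first by rewrite lee_fin invr_ge0 ltW.
exact: ge0_le_lower_integral.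
Qed.

Lemma avgD g h x : (forall z, 0 <= g z) -> (forall z, 0 <= h z) ->
  measurable_fun setT g -> measurable_fun setT h ->
  avg (fun z => g z + h z) x = avg g x + avg h x.
Proof.
move=> g0 h0 mg mh; rewrite /avg ge0_integralD//; first last.
- exact: measurable_funTS.
- exact: measurable_funTS.
- exact: measurable_cell.
by rewrite ge0_muleDr//; exact: integral_ge0.
Qed.

(** Averaging is self-adjoint: on each cell both integrals equal [v] times the product of the two
    averages. This is the tool that moves averages between the weight and the functions
    throughout. *)
Lemma integral_avg_sym g h : (forall z, 0 <= g z) -> (forall z, 0 <= h z) ->
  measurable_fun setT g -> measurable_fun setT h ->
  \int[mu]_x (h x * avg g x) = \int[mu]_x (avg h x * g x).
Proof.
move=> g0 h0 mg mh.
rewrite !ge0_integral_fibres//; first last.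
- by move=> x _; rewrite mule_ge0// avg_ge0.
- by apply: emeasurable_funM => //; exact: measurable_avg.
- by move=> x _; rewrite mule_ge0// avg_ge0.
- by apply: emeasurable_funM => //; exact: measurable_avg.
apply: eq_eseriesr => k _; rewrite !setTI.
have [->|[x ->]] := fibre_cell idx k; first by rewrite !integral_set0.
transitivity (\int[mu]_(z in cell x) (avg g x * h z)).
  by apply: eq_integral => z; rewrite inE => /cellwise_avg ->; rewrite muleC.
transitivity (\int[mu]_(z in cell x) (avg h x * g z)); last first.
  by apply: eq_integral => z; rewrite inE => /(cellwise_avg h) ->.
rewrite !ge0_integralZl//; first last.
- exact: avg_ge0.
- exact: measurable_funTS.
- exact: measurable_cell.
- exact: avg_ge0.
- exact: measurable_funTS.
- exact: measurable_cell.
by rewrite !integral_cell muleCA [RHS]muleCA; congr (_ * _); rewrite muleC.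
Qed.


Definition saturated (Q : set T) : Prop := cellwise (fun x => Q x).

Lemma saturated_fibre Q k : saturated Q ->
  Q `&` (idx @^-1` [set k]) = set0 \/ exists x, Q `&` (idx @^-1` [set k]) = cell x.
Proof.
move=> sQ; have [->|[x xk]] := fibre_cell idx k; first by left; rewrite setI0.
rewrite xk; have [Qx|nQx] := pselect (Q x); [right; exists x|left].
  apply/seteqP; split => [z []//|z zx]; split => //.
  by rewrite (sQ z x).
by rewrite -subset0 => z [Qz zx]; apply: nQx; rewrite (sQ x z)// zx.
Qed.

Lemma integrable_cellS (Q : set T) g : measurable Q ->
  mu.-integrable setT g -> mu.-integrable Q g.
Proof. by move=> mQ; apply: integrableS. Qed.

Lemma avg_fin_num g x : mu.-integrable setT g -> avg g x \is a fin_num.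
Proof.
move=> gi; rewrite fin_numM// integrable_fin_num//; first exact: measurable_cell.
by apply: integrable_cellS => //; exact: measurable_cell.
Qed.

Lemma cond_expE f x : mu.-integrable setT (EFin \o f) ->
  (cond_exp f x)%:E = avg (EFin \o f) x.
Proof. by move=> fi; rewrite fineK// avg_fin_num. Qed.

Lemma integral_cond_exp_cell f x : mu.-integrable setT (EFin \o f) ->
  \int[mu]_(z in cell x) (cond_exp f z)%:E = \int[mu]_(z in cell x) (f z)%:E.
Proof.
move=> fi; rewrite [RHS]integral_cell -cond_expE//.
rewrite (eq_integral (cst (cond_exp f x)%:E)); last first.
  by move=> z; rewrite inE => /(cellwise_cond_exp f) ->.
by rewrite integral_cst ?mu_cell 1?muleC//; exact: measurable_cell.
Qed.

Lemma abse_avg_le g x : measurable_fun setT g -> `|avg g x| <= avg (abse \o g) x.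
Proof.
move=> mg; rewrite /avg abseM gee0_abs; last by rewrite lee_fin invr_ge0 ltW.
apply: lee_wpmul2l; first by rewrite lee_fin invr_ge0 ltW.
by apply: le_abse_integral; [exact: measurable_cell|exact: measurable_funTS].
Qed.

Lemma norm_cond_exp_le f x : mu.-integrable setT (EFin \o f) ->
  `|cond_exp f x|%:E <= avg (fun z => `|f z|%:E) x.
Proof.
move=> fi; rewrite -abse_EFin cond_expE//; apply: abse_avg_le.
exact: measurable_int fi.
Qed.

Lemma integral_avg g : (forall z, 0 <= g z) -> measurable_fun setT g ->
  \int[mu]_x avg g x = \int[mu]_x g x.
Proof.
move=> g0 mg; have := @integral_avg_sym g (cst 1) g0 (fun=> lee01) mg (measurable_cst _).
under eq_integral do rewrite mul1e.
move=> ->; apply: eq_integral => x _; rewrite avg_cst ?mul1e//.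
Qed.

Lemma integrable_cond_exp f : mu.-integrable setT (EFin \o f) ->
  mu.-integrable setT (EFin \o cond_exp f).
Proof.
move=> fi; apply/integrableP; split; first exact/measurable_EFinP/measurable_cond_exp.
have mf : measurable_fun setT (fun x => `|f x|%:E).
  apply/measurable_EFinP; apply: measurableT_comp => //.
  by apply/measurable_EFinP; exact: measurable_int fi.
have /integrableP[_] := fi; apply: le_lt_trans.
rewrite (_ : \int[mu]_x `|(EFin \o f) x| = \int[mu]_x avg (fun z => `|f z|%:E) x).
  apply: ge0_le_lower_integral => x _ //=.
  exact: norm_cond_exp_le.
by rewrite integral_avg.
Qed.

(** On each cell [b] is a constant that leaves the integral, and the integral of [g] that remains
    vanishes; summing over the cells of [Q] uses integrability of the product. *)
Lemma integral_cellwise_mul0 (Q : set T) (b : T -> R) (g : T -> R) :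
  measurable Q -> saturated Q -> cellwise b ->
  mu.-integrable setT (EFin \o g) ->
  mu.-integrable Q (fun x => (b x * g x)%:E) ->
  (forall x, \int[mu]_(z in cell x) (g z)%:E = 0) ->
  \int[mu]_(x in Q) (b x * g x)%:E = 0.
Proof.
move=> mQ sQ bc gi bgi g0; rewrite integral_fibres//.
apply: eseries0 => k _ _.
have [->|[x ->]] := saturated_fibre k sQ; first by rewrite integral_set0.
rewrite (eq_integral (fun z => (b x)%:E * (g z)%:E)); last first.
  by move=> z; rewrite inE => /bc ->; rewrite EFinM.
rewrite integralZl ?g0 ?mule0//; first exact: measurable_cell.
by apply: integrable_cellS => //; exact: measurable_cell.
Qed.

Lemma integral_cond_exp f (Q : set T) : measurable Q -> saturated Q ->
  mu.-integrable setT (EFin \o f) ->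
  \int[mu]_(x in Q) (cond_exp f x)%:E = \int[mu]_(x in Q) (f x)%:E.
Proof.
move=> mQ sQ fi.
rewrite !integral_fibres//; first last.
- by apply: integrable_cellS => //; exact: integrable_cond_exp.
- exact: integrable_cellS.
apply: eq_eseriesr => k _.
have [->|[x ->]] := saturated_fibre k sQ; first by rewrite !integral_set0.
exact: integral_cond_exp_cell.
Qed.

(* Replacing [psi] by a sampled value on each cell costs at most its oscillation,
   and the sampled function is annihilated by [g]. *)
Lemma integral_mul_oscillation (Q : set T) (psi g : T -> R) (om M : R) :
  measurable Q -> saturated Q -> measurable_fun setT psi -> (0 <= om)%R ->
  (forall x, `|psi x| <= M)%R ->
  (forall x z, idx x = idx z -> `|psi x - psi z| <= om)%R ->
  mu.-integrable setT (EFin \o g) ->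
  (forall x, \int[mu]_(z in cell x) (g z)%:E = 0) ->
  `|\int[mu]_(x in Q) (psi x * g x)%:E| <= om%:E * \int[mu]_(x in Q) `|g x|%:E.
Proof.
move=> mQ sQ mpsi om0 psiM psiom gi g0.
have [b bc bE] := cell_sampling idx psi.
have mb := cellwise_measurable bc.
have mg : measurable_fun setT g by apply/measurable_EFinP; exact: measurable_int gi.
have gQ : mu.-integrable Q (EFin \o g) by exact: integrable_cellS.
have bdI (h : T -> R) (K : R) : measurable_fun setT h -> (forall x, `|h x| <= K)%R ->
    mu.-integrable Q (fun x => (h x * g x)%:E).
  move=> mh hK.
  apply: (@le_integrable _ _ _ _ _ mQ _ (fun x => K%:E * (g x)%:E)).
  - by apply/measurable_EFinP/measurable_funTS; exact: measurable_funM.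
  - move=> x _ /=; rewrite lee_fin !normrM ler_wpM2r// (le_trans (hK x))//.
    exact: ler_norm.
  - exact: integrableZl.
have bI : mu.-integrable Q (fun x => (b x * g x)%:E).
  apply: (bdI b M) => // x /=.
  by have [z _ ->] := bE x.
have dI : mu.-integrable Q (fun x => ((psi x - b x) * g x)%:E).
  apply: (bdI (fun x => psi x - b x)%R om); first exact: measurable_funB.
  by move=> x; have [z zx ->] := bE x; apply: psiom.
have -> : \int[mu]_(x in Q) (psi x * g x)%:E =
    \int[mu]_(x in Q) ((psi x - b x) * g x)%:E.
  rewrite -[RHS]adde0 -(integral_cellwise_mul0 mQ sQ bc gi bI g0) -integralD//.
  by apply: eq_integral => x _; rewrite -EFinD -mulrDl subrK.
apply: le_trans (le_abse_integral _ mQ (measurable_int _ dI)) _.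
rewrite -ge0_integralZl//.
- apply: ge0_le_lower_integral => // x _; rewrite lee_fin normrM ler_wpM2r//.
  by have [z zx ->] := bE x; apply: psiom.
- apply/measurable_funTS; apply/measurable_EFinP.
  by apply: measurableT_comp.
Qed.

End one_partition.

(** * Square sums and Minkowski's inequality with extended real values *)

Section l2.
Variable R : realType.
Implicit Types (a b : nat -> \bar R) (s t : R).

Definition l2sum a : \bar R := (\sum_(0 <= j <oo) `|a j| ^+ 2) `^ 2^-1.

Lemma sqr_poweR_half (x : \bar R) : 0 <= x -> (x `^ 2^-1) ^+ 2 = x.
Proof.
case: x => [r r0||//]; last by move=> _; rewrite poweRyr ?invr_neq0// expe2 mulyy.
by rewrite poweR_EFin -EFin_expe -powR_mulrn ?powR_ge0// -powRrM mulVf// powRr1.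
Qed.

Lemma poweR_half_sqr (x : \bar R) : 0 <= x -> (x ^+ 2) `^ 2^-1 = x.
Proof.
case: x => [r r0||//]; last by move=> _; rewrite expe2 mulyy poweRyr ?invr_neq0.
by rewrite -EFin_expe poweR_EFin -powR_mulrn// -powRrM mulfV// powRr1.
Qed.

Lemma le_sqre (x y : \bar R) : 0 <= x -> x <= y -> x ^+ 2 <= y ^+ 2.
Proof.
move=> x0 xy; rewrite !expe2; apply: lee_pmul => //.
Qed.

Lemma le_of_sqre (x y : \bar R) : 0 <= x -> 0 <= y -> x ^+ 2 <= y ^+ 2 -> x <= y.
Proof.
move=> x0 y0 xy; rewrite -(poweR_half_sqr x0) -(poweR_half_sqr y0).
by apply: gt0_ler_poweR => //; rewrite in_itv/= leey andbT; apply: mule_ge0.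
Qed.

Lemma l2sum_ge0 a : 0 <= l2sum a.
Proof. exact: poweR_ge0. Qed.

Lemma sqr_l2sum a : l2sum a ^+ 2 = \sum_(0 <= j <oo) `|a j| ^+ 2.
Proof. by rewrite sqr_poweR_half//; apply: nneseries_ge0 => *; exact: expe_ge0. Qed.

Lemma partial_sum_le_nneseries a n : (forall j, 0 <= a j) ->
  \sum_(0 <= j < n) a j <= \sum_(0 <= j <oo) a j.
Proof. by move=> a0; apply: nneseries_lim_ge. Qed.

Lemma term_le_nneseries a k : (forall j, 0 <= a j) -> a k <= \sum_(0 <= j <oo) a j.
Proof.
move=> a0; apply: le_trans (partial_sum_le_nneseries k.+1 a0).
by rewrite big_nat_recr//= leeDr// sume_ge0.
Qed.

Lemma nneseries_le a (x : \bar R) : (forall j, 0 <= a j) ->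
  (forall n, \sum_(0 <= j < n) a j <= x) -> \sum_(0 <= j <oo) a j <= x.
Proof.
move=> a0 ax; apply: lime_le; first by apply: is_cvg_nneseries => *.
by apply: nearW => n; exact: ax.
Qed.

Lemma abse_le_l2sum a k : `|a k| <= l2sum a.
Proof.
apply: le_of_sqre => //; first exact: l2sum_ge0.
rewrite sqr_l2sum; apply: (@term_le_nneseries (fun j => `|a j| ^+ 2)) => j.
exact: expe_ge0.
Qed.

Lemma cauchy_schwarz_sum n (a b : nat -> R) s t : (0 <= s)%R -> (0 <= t)%R ->
  (\sum_(0 <= j < n) a j ^+ 2 <= s ^+ 2)%R ->
  (\sum_(0 <= j < n) b j ^+ 2 <= t ^+ 2)%R ->
  (\sum_(0 <= j < n) a j * b j <= s * t)%R.
Proof.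
have zero (c : nat -> R) : (\sum_(0 <= j < n) c j ^+ 2 <= 0 ^+ 2)%R ->
    forall j, (j < n)%N -> c j = 0%R.
  rewrite expr0n/= => c0 j jn; apply/eqP; rewrite -sqrf_eq0 eq_le sqr_ge0 andbT.
  apply: le_trans c0; rewrite (bigD1_seq j)//= ?mem_index_iota ?iota_uniq//.
  by rewrite lerDl sumr_ge0// => *; exact: sqr_ge0.
rewrite le_eqVlt => /predU1P[<- t0 /zero a0 _|s0].
  by rewrite mul0r big_nat big1// => j /= jn; rewrite a0// mul0r.
rewrite le_eqVlt => /predU1P[<- _ /zero b0|t0 As Bt].
  by rewrite mulr0 big_nat big1// => j /= jn; rewrite b0// mulr0.
(* Expanding this square and inserting the two bounds gives the claim multiplied by [2 * s * t],
   which is positive once the degenerate cases are gone. *)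
have : (0 <= \sum_(0 <= j < n) (t * a j - s * b j) ^+ 2)%R.
  by apply: sumr_ge0 => *; exact: sqr_ge0.
rewrite (eq_bigr (fun j => t ^+ 2 * a j ^+ 2 + s ^+ 2 * b j ^+ 2 +
  (- (2 * s * t)) * (a j * b j))%R); last by move=> j _; ring.
rewrite !big_split/= -!mulr_sumr => H.
have H2 : (2 * s * t * (\sum_(0 <= j < n) a j * b j) <= 2 * s * t * (s * t))%R.
  have A2 := ler_wpM2l (ltW (exprn_gt0 2 t0)) As.
  have B2 := ler_wpM2l (ltW (exprn_gt0 2 s0)) Bt.
  nra.
by rewrite -(@ler_pM2l _ (2 * s * t)%R)// !mulr_gt0.
Qed.

End l2.

Section minkowski.
Context d (T : measurableType d) (R : realType).
Variable mu : {measure set T -> \bar R}.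

Lemma measurable_sqre (g : T -> \bar R) (D : set T) :
  measurable_fun D g -> measurable_fun D (fun x => g x ^+ 2).
Proof. by move=> mg; under eq_fun do rewrite expe2; exact: emeasurable_funM. Qed.

Lemma measurable_l2sum (g : nat -> T -> \bar R) :
  (forall j, measurable_fun setT (g j)) ->
  measurable_fun setT (fun x => l2sum (g ^~ x)).
Proof.
move=> mg; apply: (measurableT_comp (measurable_poweR _)).
apply: ge0_emeasurable_sum => // [j x _ _|j _]; first exact: expe_ge0.
by apply: measurable_sqre; apply: measurableT_comp.
Qed.

(** Duality: the vector of integrals is paired with itself, the pairing moves under the integral,
    and Cauchy-Schwarz at each point bounds it by [s] times the square sum, where [s] is the norm of
    the vector. Dividing by [s] ends the proof for partial sums. *)
Lemma minkowski_integral (D : set T) (g : nat -> T -> \bar R) : measurable D ->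
  (forall j x, 0 <= g j x) -> (forall j, measurable_fun setT (g j)) ->
  \sum_(0 <= j <oo) (\int[mu]_(x in D) g j x) ^+ 2 <=
  (\int[mu]_(x in D) l2sum (g ^~ x)) ^+ 2.
Proof.
move=> mD g0 mg; set I := \int[mu]_(x in D) l2sum _.
have I0 : 0 <= I by apply: integral_ge0 => x _; exact: l2sum_ge0.
have gI j : \int[mu]_(x in D) g j x <= I.
  apply: ge0_le_lower_integral => // x _.
  by rewrite -[leLHS]gee0_abs//; exact: (abse_le_l2sum (g ^~ x) j).
have [Ioo|Ioo] := eqVneq I +oo; first by rewrite Ioo expe2 mulyy leey.
have Ifin : I \is a fin_num by rewrite ge0_fin_numE// ltey.
pose a j : R := fine (\int[mu]_(x in D) g j x).
have aE j : (a j)%:E = \int[mu]_(x in D) g j x.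
  rewrite fineK// ge0_fin_numE; last exact: integral_ge0.
  by apply: le_lt_trans (gI j) _; rewrite ltey.
have a0 j : (0 <= a j)%R by apply: fine_ge0; exact: integral_ge0.
apply: nneseries_le => [j|n]; first exact/expe_ge0/integral_ge0.
under eq_bigr do rewrite -aE -EFin_expe.
rewrite sumEFin; set S := (\sum_(_ <= j < _) _)%R.
have S0 : (0 <= S)%R by apply: sumr_ge0 => j _; exact: sqr_ge0.
pose s := Num.sqrt S.
have sS : (s ^+ 2 = S)%R by rewrite sqr_sqrtr.
have s0 : (0 <= s)%R by exact: sqrtr_ge0.
have key : S%:E <= s%:E * I.
  have -> : S%:E = \int[mu]_(x in D) (\sum_(0 <= j < n) (a j)%:E * g j x).
    rewrite ge0_integral_sum//; first last.
    - by move=> j x _; rewrite mule_ge0// lee_fin.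
    - by move=> j; apply: measurable_funeM; exact: measurable_funTS.
    rewrite -sumEFin; apply: eq_bigr => j _.
    rewrite ge0_integralZl// ?lee_fin -?aE ?EFin_expe//.
    exact: measurable_funTS.
  rewrite -ge0_integralZl//; first last.
  - by move=> x _; exact: l2sum_ge0.
  - by apply: measurable_funTS; exact: measurable_l2sum.
  apply: ge0_le_lower_integral => x Dx.
    by apply: sume_ge0 => j _; rewrite mule_ge0// lee_fin.
  (* If [s] vanishes the right side is 0 even where the square sum is [+oo], so the left side has to
     vanish term by term. *)
  have [soo|s1] := eqVneq s 0%R.
    rewrite soo mul0e big_nat big1// => j /= jn.
    have S00 : S = 0%R by rewrite -sS soo expr0n.
    suff -> : a j = 0%R by rewrite mul0e.
    apply/eqP; rewrite -sqrf_eq0 eq_le sqr_ge0 andbT.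
    rewrite -S00 /S (bigD1_seq j)//= ?mem_index_iota ?iota_uniq//.
    by rewrite lerDl sumr_ge0// => *; exact: sqr_ge0.
  have [->|Foo] := eqVneq (l2sum (g ^~ x)) +oo.
    by rewrite gt0_muley ?leey// lte_fin lt_neqAle eq_sym s1.
  have Ffin : l2sum (g ^~ x) \is a fin_num.
    by rewrite ge0_fin_numE ?ltey// l2sum_ge0.
  have gE j : (fine (g j x))%:E = g j x.
    rewrite fineK// ge0_fin_numE//; apply: le_lt_trans _ (_ : l2sum (g ^~ x) < _).
      by rewrite -[leLHS]gee0_abs//; exact: (abse_le_l2sum (g ^~ x) j).
    by rewrite ltey.
  under eq_bigr do rewrite -gE -EFinM.
  rewrite sumEFin -(fineK Ffin) -EFinM lee_fin.
  apply: cauchy_schwarz_sum; rewrite ?fine_ge0 ?l2sum_ge0 ?sS//.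
  rewrite -lee_fin -sumEFin EFin_expe fineK// sqr_l2sum.
  under eq_bigr do rewrite EFin_expe gE -[X in X ^+ 2]gee0_abs//.
  by apply: partial_sum_le_nneseries => j; exact: expe_ge0.
have [s00|s1] := eqVneq s 0%R; first by rewrite -sS s00 expr0n expe_ge0.
rewrite -sS EFin_expe; apply: le_sqre; first by rewrite lee_fin.
have sp : (0 < s)%R by rewrite lt_neqAle eq_sym s1.
rewrite -(@lee_pmul2l _ s%:E) ?lte_fin//.
by rewrite -EFinM -expr2 sS.
Qed.

End minkowski.

(** * Martingale differences along nested partitions *)

Section filtration.
Context d (T : measurableType d) (R : realType).
Variables (mu : {measure set T -> \bar R}) (idx : nat -> T -> nat) (v : nat -> R).
Variable (N : R).
Hypothesis midx : forall i k, measurable (idx i @^-1` [set k]).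
Hypothesis v_gt0 : forall i, (0 < v i)%R.
Hypothesis mu_cell : forall i x, mu (cell (idx i) x) = (v i)%:E.
Hypothesis idxS : forall i x z, idx i.+1 x = idx i.+1 z -> idx i x = idx i z.
Hypothesis vS : forall i, v i = (N * v i.+1)%R.

Local Notation A i := (avg mu (idx i) (v i)).
Local Notation E i := (cond_exp mu (idx i) (v i)).

Definition mdiff i (f : T -> R) (x : T) : R := (E i.+1 f x - E i f x)%R.

Lemma idx_le i j x z : (i <= j)%N -> idx j x = idx j z -> idx i x = idx i z.
Proof. by move=> /subnK <-; elim: (j - i)%N => // k IH /idxS. Qed.

Lemma cellwise_le (U : Type) (g : T -> U) i j : (i <= j)%N ->
  cellwise (idx i) g -> cellwise (idx j) g.
Proof. by move=> ij gc x z /(idx_le ij) /gc. Qed.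

Lemma N_gt0 : (0 < N)%R.
Proof. by have := v_gt0 0; rewrite vS pmulr_lgt0. Qed.

Lemma subset_cell_le i j x : (i <= j)%N -> cell (idx j) x `<=` cell (idx i) x.
Proof. by move=> ij z; exact: idx_le. Qed.

Lemma saturated_cell i j x : (i <= j)%N -> saturated (idx j) (cell (idx i) x).
Proof. by move=> ij a b /(idx_le ij) ab; rewrite /cell /= ab. Qed.

(** The indicator of a coarse cell is constant on fine cells, hence fixed by the fine average;
    self-adjointness moves that average from [g] onto the indicator. *)
Lemma avg_tower i j g x : (i <= j)%N -> (forall z, 0 <= g z) ->
  measurable_fun setT g -> A i (A j g) x = A i g x.
Proof.
move=> ij g0 mg; rewrite /avg; congr (_ * _).
have mI : measurable_fun setT (fun z => (\1_(cell (idx i) x) z)%:E : \bar R).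
  by apply/measurable_EFinP; apply: measurable_indic; exact: measurable_cell.
have I0 z : 0 <= (\1_(cell (idx i) x) z)%:E :> \bar R by rewrite lee_fin.
have Ic : cellwise (idx j) (fun z => (\1_(cell (idx i) x) z)%:E : \bar R).
  by move=> a b /(idx_le ij) ab; rewrite !indicE (_ : (a \in _) = (b \in cell (idx i) x))//; apply/idP/idP; rewrite !inE /cell /= ab.
have H := integral_avg_sym mu (midx j) (v_gt0 j) g0 I0 mg mI.
rewrite [LHS]integral_mkcond [RHS]integral_mkcond.
transitivity (\int[mu]_z ((\1_(cell (idx i) x) z)%:E * A j g z)).
  by apply: eq_integral => z _; rewrite patchE indicE; case: ifPn => _; rewrite ?mul1e ?mul0e.
rewrite H; apply: eq_integral => z _.
rewrite (avg_cellwise (midx j) (v_gt0 j) (mu_cell j))//.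
by rewrite patchE indicE; case: ifPn => _; rewrite ?mul1e ?mul0e.
Qed.

(** Regularity of the filtration: a cell has [N] times the volume of a child. It keeps the average
    on a cell where the process has just stopped below [N] times the threshold. *)
Lemma avgS_le i g x : (forall z, 0 <= g z) -> measurable_fun setT g ->
  A i.+1 g x <= N%:E * A i g x.
Proof.
move=> g0 mg; rewrite /avg muleA -EFinM (vS i) invfM mulrA mulfV ?mul1r ?gt_eqF ?N_gt0//.
apply: lee_wpmul2l; first by rewrite lee_fin invr_ge0 ltW.
apply: ge0_subset_integral => //; [exact: measurable_cell|exact: measurable_cell| |].
  exact: measurable_funTS.
exact: subset_cell_le.
Qed.

Lemma measurable_mdiff i f : measurable_fun setT (mdiff i f).
Proof. by apply: measurable_funB; exact: measurable_cond_exp. Qed.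

Lemma cellwise_mdiff i f : cellwise (idx i.+1) (mdiff i f).
Proof.
move=> x z xz; rewrite /mdiff (cellwise_cond_exp mu (v i.+1) f xz).
by rewrite (cellwise_cond_exp mu (v i) f (idxS xz)).
Qed.

Section one_function.
Variable f : T -> R.
Hypothesis fi : mu.-integrable setT (EFin \o f).

Lemma integrable_mdiff i : mu.-integrable setT (EFin \o mdiff i f).
Proof.
rewrite (_ : EFin \o _ = (EFin \o E i.+1 f) \- (EFin \o E i f)); last exact/funext.
by apply: integrableB => //; exact: integrable_cond_exp.
Qed.

Lemma integral_mdiff_cell i x : \int[mu]_(z in cell (idx i) x) (mdiff i f z)%:E = 0.
Proof.
rewrite (_ : (fun z => (mdiff i f z)%:E) = (EFin \o E i.+1 f) \- (EFin \o E i f)) //.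
have mc := measurable_cell (midx i) x.
rewrite integralB//=; first last.
- by apply: integrable_cellS => //; exact: integrable_cond_exp.
- by apply: integrable_cellS => //; exact: integrable_cond_exp.
rewrite (integral_cond_exp (midx i.+1))//; last exact: saturated_cell.
rewrite integral_cond_exp_cell// subee// integrable_fin_num//.
exact: integrable_cellS.
Qed.

(** Because all cells of one level have the same volume, averages of an L^1 function are bounded.
    Squares of differences are then integrable on cells although [f] need not be square
    integrable. *)
Lemma cond_exp_bounded i : exists2 M : R, (0 <= M)%R & forall x, (`|E i f x| <= M)%R.
Proof.
have /integrableP[mf foo] := fi.
have I0 : 0 <= \int[mu]_x `|(f x)%:E| by exact: integral_ge0.
exists ((v i)^-1 * fine (\int[mu]_x `|(f x)%:E|))%R => [|x].
  by rewrite mulr_ge0// ?fine_ge0// invr_ge0 ltW.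
rewrite -lee_fin; apply: le_trans (norm_cond_exp_le (midx i) (v_gt0 i) x fi) _.
rewrite EFinM fineK ?ge0_fin_numE//; apply: lee_wpmul2l.
  by rewrite lee_fin invr_ge0 ltW.
apply: ge0_subset_integral => //; first exact: measurable_cell.
by apply/measurable_EFinP; apply: measurableT_comp => //; exact/measurable_EFinP.
Qed.

Lemma integrable_bounded_mul (Q : set T) (g h : T -> R) M : measurable Q ->
  mu.-integrable setT (EFin \o h) -> measurable_fun setT g ->
  (forall x, `|g x| <= M)%R -> mu.-integrable Q (fun x => (g x * h x)%:E).
Proof.
move=> mQ hi mg gM.
have mh : measurable_fun setT h by apply/measurable_EFinP; exact: measurable_int hi.
apply: (@le_integrable _ _ _ _ _ mQ _ (fun x => M%:E * (h x)%:E)).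
- by apply/measurable_EFinP/measurable_funTS; exact: measurable_funM.
- move=> x _ /=; rewrite lee_fin !normrM ler_wpM2r// (le_trans (gM x))//.
  exact: ler_norm.
- by apply: integrableZl => //; exact: integrable_cellS.
Qed.

(** Pythagoras on a single cell: there [E i f] is the constant [e] and the difference has mean zero,
    so the cross term disappears. *)
Lemma avg_mdiff_sqr i x :
  A i (fun z => ((mdiff i f z) ^+ 2)%:E) x + ((E i f x) ^+ 2)%:E =
  A i (fun z => ((E i.+1 f z) ^+ 2)%:E) x.
Proof.
set e := E i f x.
have mc := measurable_cell (midx i) x.
have [M1 M10 EM1] := cond_exp_bounded i.+1.
have [M0 M00 EM0] := cond_exp_bounded i.
have DI := integrable_mdiff i.
have D2I : mu.-integrable (cell (idx i) x) (fun z => ((mdiff i f z) ^+ 2)%:E).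
  under eq_fun do rewrite expr2.
  apply: (integrable_bounded_mul (M := (M1 + M0)%R)) => //; first exact: measurable_mdiff.
  by move=> z; rewrite (le_trans (ler_normB _ _))// lerD.
have muc : mu (cell (idx i) x) < +oo by rewrite mu_cell ltry.
have cI (c : R) : mu.-integrable (cell (idx i) x) (fun=> c%:E).
  apply/integrableP; split=> //.
  by rewrite integral_cst// mu_cell -EFinM ltry.
rewrite /avg.
rewrite [X in _ = _ * X](eq_integral (fun z => ((mdiff i f z) ^+ 2)%:E +
   ((2 * e)%:E * (mdiff i f z)%:E + (e ^+ 2)%:E))); last first.
  move=> z; rewrite inE => zx.
  have -> : E i.+1 f z = (mdiff i f z + e)%R.
    by rewrite /mdiff (cellwise_cond_exp mu (v i) f zx) subrK.
  by rewrite -EFinM -!EFinD; congr EFin; ring.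
have DcI : mu.-integrable (cell (idx i) x) (fun z => (2 * e)%:E * (mdiff i f z)%:E).
  by apply: integrableZl => //; exact: integrable_cellS.
rewrite integralD//; last by apply: integrableD.
rewrite integralD// integralZl//; last exact: integrable_cellS.
rewrite integral_mdiff_cell mule0 add0e integral_cst//.
have D0 : 0 <= \int[mu]_(z in cell (idx i) x) ((mdiff i f z) ^+ 2)%:E.
  by apply: integral_ge0 => z _; rewrite lee_fin sqr_ge0.
have e0 : 0 <= (e ^+ 2)%:E * (v i)%:E.
  by rewrite -EFinM lee_fin mulr_ge0 ?sqr_ge0// ltW.
rewrite mu_cell (ge0_muleDr _ D0 e0).
by rewrite muleCA -[X in _ = _ + _ * X]EFinM mulVf ?gt_eqF// mule1.
Qed.

End one_function.
End filtration.

(** * Geometrically weighted series *)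

Section nneseries_extra.
Variable R : realType.
Implicit Types (a b : nat -> \bar R).

Lemma geometric_le (z : R) n : (0 < z)%R -> (z < 1)%R ->
  (\sum_(0 <= k < n) z ^+ k <= (1 - z)^-1)%R.
Proof.
move=> z0 z1.
have d0 : (0 < 1 - z)%R by rewrite subr_gt0.
have -> : (\sum_(0 <= k < n) z ^+ k = (1 - z ^+ n) / (1 - z))%R.
  apply: (mulIf (lt0r_neq0 d0)); rewrite mulfVK ?gt_eqF// big_mkord.
  by rewrite -[RHS]opprB subrX1 -mulNr opprB mulrC.
by rewrite ler_pdivrMr// mulVf ?gt_eqF// gerBl exprn_ge0// ltW.
Qed.

(* Half of the geometric weight pays for the sum, the other half stays with [a]. *)
Lemma geometric_sum_le a (z : R) (t : \bar R) : (0 < z)%R -> (z < 1)%R ->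
  (forall k, 0 <= a k) -> 0 <= t -> (forall k, a k <= t) ->
  \sum_(0 <= k <oo) (z ^+ k)%:E * a k <= (1 - z)^-1%:E * t.
Proof.
move=> z0 z1 a0 t0 at_; apply: nneseries_le => [k|n].
  by rewrite mule_ge0// lee_fin exprn_ge0// ltW.
apply: (@le_trans _ _ (\sum_(0 <= k < n) (z ^+ k)%:E * t)).
  by apply: lee_sum => k _; rewrite lee_wpmul2l// lee_fin exprn_ge0// ltW.
rewrite -ge0_sume_distrl; last by move=> k _; rewrite lee_fin exprn_ge0// ltW.
by rewrite sumEFin lee_wpmul2r// lee_fin geometric_le.
Qed.

(** Each [z ^+ k * a k] is at most the square root of the series on the right, and the other factor
    [z ^+ k] sums geometrically. The weight [z ^+ 2] is the same on both sides. *)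
Lemma sqr_geometric_sum_le a (z : R) : (0 < z)%R -> (z < 1)%R ->
  (forall k, 0 <= a k) ->
  (\sum_(0 <= k <oo) ((z ^+ 2) ^+ k)%:E * a k) ^+ 2 <=
  ((1 - z)^-1 ^+ 2)%:E * \sum_(0 <= k <oo) ((z ^+ 2) ^+ k)%:E * a k ^+ 2.
Proof.
move=> z0 z1 a0; set S := \sum_(0 <= k <oo) ((z ^+ 2) ^+ k)%:E * a k ^+ 2.
have z2 k : 0 <= ((z ^+ 2) ^+ k)%:E by rewrite lee_fin !exprn_ge0// ltW.
have S0 : 0 <= S.
  by apply: nneseries_ge0 => k _ _; apply: mule_ge0; rewrite ?z2 ?expe_ge0.
have aS k : (z ^+ k)%:E * a k <= S `^ 2^-1.
  apply: le_of_sqre; rewrite ?poweR_ge0//.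
    by rewrite mule_ge0// lee_fin exprn_ge0// ltW.
  rewrite sqr_poweR_half//.
  have -> : ((z ^+ k)%:E * a k) ^+ 2 = ((z ^+ 2) ^+ k)%:E * a k ^+ 2.
    by rewrite !expe2 muleACA -EFinM -expr2 -!exprM mulnC.
  apply: (@term_le_nneseries _ (fun k => ((z ^+ 2) ^+ k)%:E * a k ^+ 2)) => j.
  by apply: mule_ge0; rewrite ?z2 ?expe_ge0.
have -> : ((1 - z)^-1 ^+ 2)%:E * S = ((1 - z)^-1%:E * S `^ 2^-1) ^+ 2.
  by rewrite -[in LHS](sqr_poweR_half S0) EFin_expe !expe2 muleACA.
apply: le_sqre; first by apply: nneseries_ge0 => k _ _; rewrite mule_ge0.
rewrite (eq_eseriesr (g := fun k => (z ^+ k)%:E * ((z ^+ k)%:E * a k))); last first.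
  by move=> k _; rewrite muleA -EFinM -exprMn -expr2.
apply: geometric_sum_le => // [k|]; last exact: poweR_ge0.
by rewrite mule_ge0// lee_fin exprn_ge0// ltW.
Qed.

Lemma sqreD_le (x y : \bar R) : 0 <= x -> 0 <= y ->
  (x + y) ^+ 2 <= 4%:E * (x ^+ 2 + y ^+ 2).
Proof.
move=> x0 y0; wlog xy : x y x0 y0 / x <= y.
  move=> H; have [xy|/ltW yx] := leP x y; first exact: H.
  by rewrite (addeC x) (addeC (x ^+ 2)); exact: H.
have -> : 4%:E = 2%:E ^+ 2 :> \bar R by rewrite -EFin_expe -natrX.
apply: (@le_trans _ _ ((2%:E * y) ^+ 2)).
  apply: le_sqre; first exact: adde_ge0.
  rewrite (_ : 2%:E = 1 + 1) ?ge0_muleDl ?mul1e ?leeD2r//.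
by rewrite !expe2 muleACA lee_wpmul2l// leeDr// mule_ge0.
Qed.

Lemma sum_sqre_le a : (forall k, 0 <= a k) ->
  \sum_(0 <= k <oo) a k ^+ 2 <= (\sum_(0 <= k <oo) a k) ^+ 2.
Proof.
move=> a0; apply: nneseries_le => [k|n]; first exact: expe_ge0.
apply: (@le_trans _ _ ((\sum_(0 <= k < n) a k) ^+ 2)).
  elim: n => [|n IH]; first by rewrite !big_geq// expe2 mul0e.
  rewrite !big_nat_recr//=; set s := \sum_(0 <= k < n) a k in IH *.
  have s0 : 0 <= s by apply: sume_ge0.
  have an0 := a0 n.
  have -> : (s + a n) * (s + a n) = s * s + a n * s + (s * a n + a n * a n).
    by rewrite ge0_muleDr ?ge0_muleDl ?adde_ge0.
  apply: leeD; first by apply: le_trans IH _; rewrite expe2 leeDl// mule_ge0.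
  by rewrite leeDr// mule_ge0.
apply: le_sqre; first exact: sume_ge0.
exact: partial_sum_le_nneseries.
Qed.

End nneseries_extra.

(** * Weighted weak type bound by a stopping time *)

Definition ind (R : realType) (b : bool) : \bar R := (b%:R)%:E.
Arguments ind {R} b.

Lemma ind_ge0 (R : realType) b : 0 <= ind b :> \bar R.
Proof. by rewrite lee_fin. Qed.
#[local] Hint Resolve ind_ge0 : core.

Ltac ege0 := repeat (first [done | exact: ind_ge0 | apply: avg_ge0 => // ? |
  apply: mule_ge0 | by apply: ltW]).

(** The grid substitute for the supremum over kernels at the scale of level [i]: a kernel oscillates
    by a multiple of [theta ^+ k] on cells of level [i + k], so this is what it can see of the
    difference of that level. *)
Definition oscillation_sum d (T : measurableType d) (R : realType)
    (mu : {measure set T -> \bar R}) (idx : nat -> T -> nat) (v : nat -> R)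
    (theta : R) (f : T -> R) (i : nat) (x : T) : \bar R :=
  \sum_(0 <= k <oo) (theta ^+ k)%:E *
    avg mu (idx i) (v i) (fun z => `|mdiff mu idx v (i + k) f z|%:E) x.

Section weak_type.
Context d (T : measurableType d) (R : realType).
Variables (mu : {measure set T -> \bar R}) (idx : nat -> T -> nat) (v : nat -> R).
Variable (N : R).
Hypothesis midx : forall i k, measurable (idx i @^-1` [set k]).
Hypothesis v_gt0 : forall i, (0 < v i)%R.
Hypothesis mu_cell : forall i x, mu (cell (idx i) x) = (v i)%:E.
Hypothesis idxS : forall i x z, idx i.+1 x = idx i.+1 z -> idx i x = idx i z.
Hypothesis vS : forall i, v i = (N * v i.+1)%R.
Hypothesis N_ge1 : (1 <= N)%R.

Local Notation A i := (avg mu (idx i) (v i)).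
Local Notation E i := (cond_exp mu (idx i) (v i)).
Local Notation D i := (mdiff mu idx v i).

Lemma integral_cellwise_avg i (c g : T -> \bar R) : cellwise (idx i) c ->
  (forall x, 0 <= c x) -> (forall x, 0 <= g x) -> measurable_fun setT g ->
  \int[mu]_x (c x * A i g x) = \int[mu]_x (c x * g x).
Proof.
move=> cc c0 g0 mg; rewrite (integral_avg_sym mu (midx i) (v_gt0 i))//.
  by apply: eq_integral => x _; rewrite (avg_cellwise (midx i) (v_gt0 i) (mu_cell i)).
exact: cellwise_measurable cc.
Qed.

Lemma avg_nneseries i (g : nat -> T -> \bar R) x : (forall j z, 0 <= g j z) ->
  (forall j, measurable_fun setT (g j)) ->
  A i (fun z => \sum_(0 <= j <oo) g j z) x = \sum_(0 <= j <oo) A i (g j) x.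
Proof.
move=> g0 mg; rewrite /avg integral_nneseries//.
- by rewrite nneseriesZl// => j _; exact: integral_ge0.
- exact: measurable_cell.
- by move=> j; exact: measurable_funTS.
Qed.

Variable f : nat -> T -> R.
Hypothesis fi : forall j, mu.-integrable setT (EFin \o f j).

Local Notation F := (fun x => l2sum (fun j => (f j x)%:E)).

Definition sqE i x : \bar R := \sum_(0 <= j <oo) ((E i (f j) x) ^+ 2)%:E.
Definition sqD i x : \bar R := \sum_(0 <= j <oo) ((D i (f j) x) ^+ 2)%:E.

Let F0 x : 0 <= F x. Proof. exact: l2sum_ge0. Qed.

Let mf j : measurable_fun setT (f j).
Proof. by apply/measurable_EFinP; exact: measurable_int (fi j). Qed.

Let mF : measurable_fun setT F.
Proof.
by apply: (measurable_l2sum (g := fun j x => (f j x)%:E)) => j; exact/measurable_EFinP.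
Qed.

Lemma sqE_ge0 i x : 0 <= sqE i x.
Proof. by apply: nneseries_ge0 => j _ _; rewrite lee_fin sqr_ge0. Qed.

Lemma sqD_ge0 i x : 0 <= sqD i x.
Proof. by apply: nneseries_ge0 => j _ _; rewrite lee_fin sqr_ge0. Qed.

Lemma cellwise_sqE i : cellwise (idx i) (sqE i).
Proof.
by move=> x z xz; apply: eq_eseriesr => j _; rewrite (cellwise_cond_exp mu (v i) (f j) xz).
Qed.

Lemma cellwise_sqD i : cellwise (idx i.+1) (sqD i).
Proof.
by move=> x z xz; apply: eq_eseriesr => j _; rewrite (cellwise_mdiff mu v idxS (f j) xz).
Qed.

Lemma avg_sqD i x : A i (sqD i) x + sqE i x = A i (sqE i.+1) x.
Proof.
have sq0 (h : nat -> T -> R) j z : 0 <= ((h j z) ^+ 2)%:E by rewrite lee_fin sqr_ge0.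
have mD j : measurable_fun setT (fun z => ((D i (f j) z) ^+ 2)%:E).
  apply/measurable_EFinP; apply: measurable_funX.
  exact: (measurable_mdiff mu v midx).
have mE j : measurable_fun setT (fun z => ((E i.+1 (f j) z) ^+ 2)%:E).
  apply/measurable_EFinP; apply: measurable_funX.
  exact: (measurable_cond_exp mu (v i.+1) (midx i.+1)).
rewrite /sqD /sqE (avg_nneseries i x (sq0 (fun j => D i (f j))) mD).
rewrite (avg_nneseries i x (sq0 (fun j => E i.+1 (f j))) mE).
rewrite -nneseriesD; first last.
- by move=> j _ _; rewrite lee_fin sqr_ge0.
- move=> j _ _; apply: avg_ge0 => // z; by rewrite lee_fin sqr_ge0.
by apply: eq_eseriesr => j _; apply: (avg_mdiff_sqr midx v_gt0 mu_cell idxS).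
Qed.

(** Minkowski in the index [j]: the vector of averages is no longer than the average [A i F] of the
    lengths, the only quantity the stopping rule controls. *)
Lemma sqE_le i x : sqE i x <= (A i F x) ^+ 2.
Proof.
have v0 : (0 <= (v i)^-1)%R by rewrite invr_ge0 ltW.
have nf0 j z : 0 <= `|f j z|%:E by [].
have mnf j : measurable_fun setT (fun z => `|f j z|%:E).
  by apply/measurable_EFinP; apply: measurableT_comp.
apply: (@le_trans _ _ (\sum_(0 <= j <oo) (A i (fun z => `|f j z|%:E) x) ^+ 2)).
  apply: lee_nneseries => [j _ _|j _]; first by rewrite lee_fin sqr_ge0.
  rewrite -[(E i (f j) x ^+ 2)%R]real_normK ?num_real// EFin_expe; apply: le_sqre => //.
  exact: (norm_cond_exp_le (midx i) (v_gt0 i)).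
have -> : \sum_(0 <= j <oo) (A i (fun z => `|f j z|%:E) x) ^+ 2 =
    ((v i)^-1 ^+ 2)%:E * \sum_(0 <= j <oo) (\int[mu]_(z in cell (idx i) x) `|f j z|%:E) ^+ 2.
  rewrite -nneseriesZl; last by move=> j _; exact/expe_ge0/integral_ge0.
  by apply: eq_eseriesr => j _; rewrite /avg !expe2 muleACA -EFinM -expr2.
have -> : A i F x ^+ 2 =
    ((v i)^-1 ^+ 2)%:E * (\int[mu]_(z in cell (idx i) x) F z) ^+ 2.
  by rewrite /avg !expe2 muleACA -EFinM -expr2.
apply: lee_wpmul2l; first by rewrite lee_fin sqr_ge0.
have := minkowski_integral mu (measurable_cell (midx i) x) nf0 mnf.
congr (_ <= _ ^+ 2); apply: eq_integral => z _; rewrite /l2sum; congr (_ `^ _).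
by apply: eq_eseriesr => j _; rewrite -abse_EFin abse_id.
Qed.

Lemma sqD_le i x : sqD i x <= (2%:E * (A i.+1 F x + A i F x)) ^+ 2.
Proof.
have a0 k : 0 <= A k F x by apply: avg_ge0.
apply: (@le_trans _ _ (2%:E * (sqE i.+1 x + sqE i x))).
  rewrite /sqE -nneseriesD; first last.
  - by move=> j _ _; rewrite lee_fin sqr_ge0.
  - by move=> j _ _; rewrite lee_fin sqr_ge0.
  rewrite -nneseriesZl; last by move=> j _; rewrite -EFinD lee_fin addr_ge0 ?sqr_ge0.
  apply: lee_nneseries => [j _ _|j _]; first by rewrite lee_fin sqr_ge0.
  rewrite -EFinD -EFinM lee_fin /mdiff.
  move: (E i.+1 (f j) x) (E i (f j) x) => a b.
  rewrite -subr_ge0 (_ : _ - _ = (a + b) ^+ 2)%R ?sqr_ge0//; ring.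
have -> : (2%:E * (A i.+1 F x + A i F x)) ^+ 2 =
    2%:E * (2%:E * (A i.+1 F x + A i F x) ^+ 2).
  by rewrite !expe2 muleACA -muleA.
apply: lee_wpmul2l => //.
apply: (@le_trans _ _ (A i.+1 F x ^+ 2 + A i F x ^+ 2)).
  by apply: leeD; exact: sqE_le.
have s0 : 0 <= A i.+1 F x + A i F x by exact: adde_ge0.
rewrite (_ : 2%:E = 1 + 1) ?ge0_muleDl// ?mul1e.
by apply: leeD; apply: le_sqre; rewrite ?leeDl ?leeDr.
Qed.

Variable lam : R.
Hypothesis lam_gt0 : (0 < lam)%R.

(** With [stopped], encodes the stopping time given by the first level whose average of [F] exceeds
    [lam]; it is infinite at points that are alive at all levels. Both predicates of level [i] are
    decided by the cell of level [i]. *)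
Fixpoint alive i x : bool :=
  (if i is i'.+1 then alive i' x else true) && (A i F x <= lam%:E).

Definition stopped i x : bool :=
  (if i is i'.+1 then alive i' x else true) && ~~ (A i F x <= lam%:E).

Lemma alive_avg i x : alive i x -> A i F x <= lam%:E.
Proof. by case: i => [|i] //= /andP[]. Qed.

Lemma alive_le i j x : (i <= j)%N -> alive j x -> alive i x.
Proof. by move=> /subnK <-; elim: (j - i)%N => // k IH /= /andP[/IH]. Qed.

Lemma cellwise_alive i : cellwise (idx i) (alive i).
Proof.
elim: i => [|i IH] x z xz /=; first by rewrite (cellwise_avg mu (v 0) F xz).
by rewrite (cellwise_avg mu (v i.+1) F xz) (IH x z)//; exact: idxS.
Qed.

Lemma cellwise_stopped i : cellwise (idx i) (stopped i).
Proof.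
case: i => [|i] x z xz; rewrite /stopped; first by rewrite (cellwise_avg mu (v 0) F xz).
by rewrite (cellwise_avg mu (v i.+1) F xz) (@cellwise_alive i x z)//; exact: idxS.
Qed.

Lemma ind_alive i x : ind (alive i x) = ind (alive i.+1 x) + ind (stopped i.+1 x) :> \bar R.
Proof. by rewrite /= /stopped; case: alive => /=; case: (A i.+1 F x <= lam%:E); rewrite /= -EFinD ?addr0 ?add0r. Qed.

Lemma sum_stopped n x :
  \sum_(0 <= i < n.+1) ind (stopped i x) + ind (alive n x) = 1 :> \bar R.
Proof.
elim: n => [|n IH].
  by rewrite big_nat1 /stopped /=; case: (_ <= _); rewrite /= -EFinD ?addr0 ?add0r.
by rewrite big_nat_recr//= -addeA (addeC (ind (stopped n.+1 x))) -ind_alive.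
Qed.

Variable w : T -> \bar R.
Hypothesis w0 : forall x, 0 <= w x.
Hypothesis mw : measurable_fun setT w.
Variable C1 : R.
Hypothesis C1_gt0 : (0 < C1)%R.
Hypothesis A1 : forall i, {ae mu, forall x, A i w x <= C1%:E * w x}.

(* Averages of [w] are replaced by their running maximum, nondecreasing in [i] and
   still at most [C1 * w]: this monotonicity lets the energies telescope. *)
Fixpoint wmax i x : \bar R :=
  if i is i'.+1 then maxe (wmax i' x) (A i w x) else A 0%N w x.

Lemma avg_le_wmax i x : A i w x <= wmax i x.
Proof. by case: i => [|i] //=; rewrite le_max lexx orbT. Qed.

Lemma wmax_le i j x : (i <= j)%N -> wmax i x <= wmax j x.
Proof.
move=> /subnK <-; elim: (j - i)%N => // k IH /=.
by rewrite le_max IH.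
Qed.

Lemma wmax_ge0 i x : 0 <= wmax i x.
Proof. by apply: le_trans (avg_le_wmax i x); exact: avg_ge0. Qed.

Lemma cellwise_wmax i : cellwise (idx i) (wmax i).
Proof.
elim: i => [|i IH] x z xz /=; first exact: (cellwise_avg mu (v 0) w xz).
by rewrite (cellwise_avg mu (v i.+1) w xz) (IH x z)//; exact: idxS.
Qed.

Lemma wmax_ae i : {ae mu, forall x, wmax i x <= C1%:E * w x}.
Proof.
elim: i => [|i IH]; first exact: A1.
apply: filterS2 IH (A1 i.+1) => x /=.
by rewrite ge_max => -> ->.
Qed.

Lemma integral_wmax_le i (c : T -> \bar R) : (forall x, 0 <= c x) ->
  measurable_fun setT c ->
  \int[mu]_x (wmax i x * c x) <= C1%:E * \int[mu]_x (w x * c x).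
Proof.
move=> c0 mc.
rewrite -ge0_integralZl//; first last.
- by rewrite lee_fin ltW.
- by move=> x _; exact: mule_ge0.
- exact: emeasurable_funM.
apply: ae_ge0_le_integral => //.
- by move=> x _; rewrite mule_ge0// wmax_ge0.
- apply: emeasurable_funM => //; apply: (cellwise_measurable (midx i)).
  exact: cellwise_wmax.
- by move=> x _; rewrite !mule_ge0// lee_fin ltW.
- by apply: measurable_funeM; exact: emeasurable_funM.
apply: filterS (wmax_ae i) => x wx _.
by rewrite muleA; apply: lee_wpmul2r.
Qed.

Let c0 i : (forall x, 0 <= wmax i x * ind (alive i x)).
Proof. by move=> x; rewrite mule_ge0// wmax_ge0. Qed.

Let cc i : cellwise (idx i) (fun x => wmax i x * ind (alive i x)).
Proof. by move=> x z xz; rewrite (cellwise_wmax xz) (cellwise_alive xz). Qed.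

Let m_alive i : measurable_fun setT (fun x => ind (alive i x) : \bar R).
Proof.
by apply: (cellwise_measurable (midx i)) => x z xz; rewrite (cellwise_alive xz).
Qed.

Let m_stopped i : measurable_fun setT (fun x => ind (stopped i x) : \bar R).
Proof.
by apply: (cellwise_measurable (midx i)) => x z xz; rewrite (cellwise_stopped xz).
Qed.

Let m_sqE i : measurable_fun setT (sqE i).
Proof. exact/(cellwise_measurable (midx i))/cellwise_sqE. Qed.

Let m_sqD i : measurable_fun setT (sqD i).
Proof. exact/(cellwise_measurable (midx i.+1))/cellwise_sqD. Qed.

Let m_wmax i : measurable_fun setT (wmax i).
Proof. exact/(cellwise_measurable (midx i))/cellwise_wmax. Qed.

(** The weight and the indicator are taken at level [i], although [sqD i] lives on cells of level
    [i.+1]: they are predictable, that is, constant on the cells where these differences have mean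
    zero. *)
Definition energyD i := \int[mu]_x (wmax i x * ind (alive i x) * sqD i x).
Definition energyE i := \int[mu]_x (wmax i x * ind (alive i x) * sqE i x).
Definition mass_alive i := \int[mu]_x (w x * (ind (alive i x) * F x)).
Definition mass_stopped i := \int[mu]_x (w x * (ind (stopped i x) * F x)).

Lemma energyE_le i : energyE i <= (N * lam * C1)%:E * mass_alive i.
Proof.
have Zge0 : 0 <= mass_alive i by apply: integral_ge0 => x _; rewrite !mule_ge0.
apply: (@le_trans _ _ (\int[mu]_x (lam%:E * (wmax i x * ind (alive i x) * A i F x)))).
  apply: ge0_le_lower_integral => x _; first by rewrite mule_ge0// sqE_ge0.
  rewrite muleCA; have [al|_] := boolP (alive i x); last by rewrite !mule0 !mul0e.
  apply: lee_wpmul2l; first by rewrite mule_ge0// wmax_ge0.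
  apply: le_trans (sqE_le i x) _; rewrite expe2; apply: lee_wpmul2r.
    exact: avg_ge0.
  exact: alive_avg.
rewrite ge0_integralZl//; first last.
- by rewrite lee_fin ltW.
- by move=> x _; rewrite mule_ge0// avg_ge0.
- apply: emeasurable_funM; last exact: measurable_avg.
  exact: emeasurable_funM.
rewrite integral_cellwise_avg//.
under eq_integral do rewrite -muleA.
apply: (@le_trans _ _ (lam%:E * (C1%:E * mass_alive i))).
  apply: lee_wpmul2l; first by rewrite lee_fin ltW.
  apply: integral_wmax_le => [x|]; first exact: mule_ge0.
  exact: emeasurable_funM.
rewrite muleA -EFinM; apply: lee_wpmul2r => //.
(* The factor [N], at least 1, is put in to match the constant of [energy_step], so that the
   induction in [energy_sum] closes. *)
by rewrite lee_fin -mulrA ler_peMl// mulr_ge0// ltW.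
Qed.

(** Pythagoras merges both energies into that of [sqE i.+1] against the old weight. Where the
    process stays alive, the old weight is below the new one. Where it stops at level [i.+1], the
    parent was alive, so the average there is at most [N * lam] and one factor of the square is
    traded for this constant. *)
Lemma energy_step i :
  energyD i + energyE i <= energyE i.+1 + (N * lam * C1)%:E * mass_stopped i.+1.
Proof.
have sE0 j x : 0 <= sqE j x by exact: sqE_ge0.
have sD0 j x : 0 <= sqD j x by exact: sqD_ge0.
have W0 j x : 0 <= wmax j x by exact: wmax_ge0.
have NL0 : (0 <= N * lam)%R by rewrite mulr_ge0 ?(ltW lam_gt0)// (le_trans ler01).
have NL0e : 0 <= (N * lam)%:E by rewrite lee_fin.
have aF0 j x : 0 <= A j F x by exact: avg_ge0.
have -> : energyD i + energyE i =
    \int[mu]_x (wmax i x * ind (alive i x) * sqE i.+1 x).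
  rewrite /energyD /energyE -(integral_cellwise_avg (@cc i))//.
  rewrite -(integral_cellwise_avg (@cc i) (@c0 i) (sE0 i.+1) (m_sqE i.+1)).
  rewrite -ge0_integralD//; first last.
  - by apply: emeasurable_funM => //; exact: emeasurable_funM.
  - by move=> x _; rewrite mule_ge0.
  - apply: emeasurable_funM; last exact: measurable_avg.
    exact: emeasurable_funM.
  - by move=> x _; rewrite mule_ge0// avg_ge0.
  apply: eq_integral => x _; rewrite -avg_sqD ge0_muleDr//.
  exact: avg_ge0.
apply: (@le_trans _ _ (energyE i.+1 + \int[mu]_x ((N * lam)%:E *
    (wmax i.+1 x * ind (stopped i.+1 x) * A i.+1 F x)))).
  rewrite /energyE -ge0_integralD//; first last.
  - apply: measurable_funeM; apply: emeasurable_funM; last exact: measurable_avg.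
    exact: emeasurable_funM.
  - by move=> x _; ege0.
  - by apply: emeasurable_funM => //; exact: emeasurable_funM.
  - by move=> x _; ege0.
  apply: ge0_le_lower_integral => x _; first by ege0.
  have -> : wmax i x * ind (alive i x) * sqE i.+1 x =
      wmax i x * ind (alive i.+1 x) * sqE i.+1 x +
      wmax i x * ind (stopped i.+1 x) * sqE i.+1 x.
    rewrite ind_alive (ge0_muleDr _ (ind_ge0 _ _) (ind_ge0 _ _)).
    by rewrite ge0_muleDl//; apply: mule_ge0 => //; exact: ind_ge0.
  apply: leeD.
    by rewrite -!muleA; apply: lee_wpmul2r; [ege0|exact: wmax_le].
  rewrite muleCA; have [st|_] := boolP (stopped i.+1 x); last by rewrite !mule0 !mul0e.
  rewrite -!muleA; apply: lee_pmul; rewrite ?mule_ge0//; first exact: wmax_le.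
  rewrite /ind !mul1e.
  apply: le_trans (sqE_le i.+1 x) _; rewrite expe2; apply: lee_wpmul2r.
    exact: avg_ge0.
  apply: le_trans (avgS_le mu midx v_gt0 idxS vS i x F0 mF) _.
  rewrite EFinM; apply: lee_wpmul2l; first by rewrite lee_fin (le_trans ler01).
  by apply: alive_avg; case/andP: st.
apply: leeD2l; rewrite ge0_integralZl//; first last.
- by move=> x _; ege0.
- apply: emeasurable_funM; last exact: measurable_avg.
  exact: emeasurable_funM.
rewrite integral_cellwise_avg//; first last.
- by move=> x; rewrite mule_ge0.
- by move=> x z xz; rewrite (cellwise_wmax xz) (cellwise_stopped xz).
under eq_integral do rewrite -muleA.
rewrite (EFinM (N * lam)) -muleA; apply: lee_wpmul2l => //.
apply: integral_wmax_le => [x|]; first exact: mule_ge0.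
exact: emeasurable_funM.
Qed.

Lemma mass_alive_split i : mass_alive i = mass_alive i.+1 + mass_stopped i.+1.
Proof.
rewrite /mass_alive /mass_stopped -ge0_integralD//; first last.
- by apply: emeasurable_funM => //; exact: emeasurable_funM.
- by move=> x _; ege0.
- by apply: emeasurable_funM => //; exact: emeasurable_funM.
- by move=> x _; ege0.
apply: eq_integral => x _.
rewrite -ge0_muleDr ?mule_ge0 ?ind_ge0//; congr (_ * _).
by rewrite -(ge0_muleDl _ (ind_ge0 _ _) (ind_ge0 _ _)) -ind_alive.
Qed.

(** The first level is peeled off, so [m] varies in the induction. The mass stopped at level [m.+1]
    is exactly the loss from [mass_alive m] to [mass_alive m.+1], so the errors of all steps never
    add up to more than the initial mass. *)
Lemma energy_sum m n :
  \sum_(m <= i < m + n) energyD i + energyE m <= (N * lam * C1)%:E * mass_alive m.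
Proof.
elim: n m => [|n IH] m; first by rewrite addn0 big_geq// add0e; exact: energyE_le.
have Zge0 i : 0 <= mass_alive i by apply: integral_ge0 => x _; rewrite !mule_ge0.
have Yge0 i : 0 <= mass_stopped i by apply: integral_ge0 => x _; rewrite !mule_ge0.
rewrite big_ltn ?addnS ?ltnS ?leq_addr// -addSn.
rewrite addeAC; apply: (le_trans (leeD2r _ (energy_step m))).
rewrite mass_alive_split (ge0_muleDr _ (Zge0 m.+1) (Yge0 m.+1)) addeAC; apply: leeD2r.
by rewrite addeC; exact: IH.
Qed.

Lemma energy_total : \sum_(0 <= i <oo) energyD i <=
  (N * lam * C1)%:E * \int[mu]_x (w x * F x).
Proof.
have D0 i : 0 <= energyD i.
  by apply: integral_ge0 => x _; rewrite mule_ge0 ?sqD_ge0.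
have E0 i : 0 <= energyE i.
  by apply: integral_ge0 => x _; rewrite mule_ge0 ?sqE_ge0.
apply: nneseries_le => // n.
have := energy_sum 0 n; rewrite add0n => H.
apply: le_trans (le_trans H _); first by rewrite leeDl.
apply: lee_wpmul2l.
  by rewrite lee_fin !mulr_ge0 ?(ltW lam_gt0) ?(ltW C1_gt0)// (le_trans ler01).
apply: ge0_le_lower_integral => x _; first by ege0.
by apply: lee_wpmul2l => //; case: alive; rewrite /ind ?mul1e ?mul0e.
Qed.

(** The weighted weak (1,1) bound of the maximal function, one level at a time: on stopped cells
    [lam] is below the average of [F], and self-adjointness turns the product of the averages of [w]
    and [F] into the average of [w] times [F]. *)
Lemma integral_stopped_le i :
  lam%:E * \int[mu]_x (w x * ind (stopped i x)) <= C1%:E * mass_stopped i.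
Proof.
have aw0 x : 0 <= A i w x by exact: avg_ge0.
have sc : cellwise (idx i) (fun x => ind (stopped i x) : \bar R).
  by move=> x z xz; rewrite (cellwise_stopped xz).
have -> : \int[mu]_x (w x * ind (stopped i x)) = \int[mu]_x (A i w x * ind (stopped i x)).
  under eq_integral do rewrite muleC.
  rewrite -(integral_cellwise_avg sc)//.
  by under [RHS]eq_integral do rewrite muleC.
rewrite -ge0_integralZl//; first last.
- by rewrite lee_fin ltW.
- by move=> x _; rewrite mule_ge0// avg_ge0.
- by apply: emeasurable_funM => //; exact: measurable_avg.
apply: (@le_trans _ _ (\int[mu]_x (A i w x * ind (stopped i x) * A i F x))).
  apply: ge0_le_lower_integral => x _.
    by ege0; rewrite lee_fin ltW.
  rewrite muleC; have [st|_] := boolP (stopped i x); last by rewrite !mule0 !mul0e.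
  apply: lee_wpmul2l; first by rewrite mule_ge0// avg_ge0.
  by apply: ltW; rewrite ltNge; move: st; case: (i) => [|k] /andP[].
rewrite integral_cellwise_avg//; first last.
- by move=> x; rewrite mule_ge0// avg_ge0.
- by move=> x z xz; rewrite (cellwise_avg mu (v i) w xz) (sc x z).
apply: (@le_trans _ _ (\int[mu]_x (wmax i x * (ind (stopped i x) * F x)))).
  apply: ge0_le_lower_integral => x _; first by ege0.
  by rewrite -muleA; apply: lee_wpmul2r; [ege0|exact: avg_le_wmax].
apply: integral_wmax_le => [x|]; first exact: mule_ge0.
exact: emeasurable_funM.
Qed.

End weak_type.

Lemma nneseries_shift_le (R : realType) (a : nat -> \bar R) k : (forall j, 0 <= a j) ->
  \sum_(0 <= i <oo) a (i + k)%N <= \sum_(0 <= i <oo) a i.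
Proof.
move=> a0; rewrite nneseries_addn// [leRHS](@nneseries_split _ a 0 k)//.
by rewrite add0n leeDr// sume_ge0.
Qed.

(** The summands stem from the stopped set, from the energy before the stopping time and from the
    L^1 estimate after it; [z] is a fourth root of the decay of the oscillation sums. *)
Definition weak_type_const (R : realType) (N C1 z : R) : R :=
  let c := ((1 - z ^+ 2)^-1 ^+ 2)%R in
  (C1 + 8 * c * (1 - (z ^+ 2) ^+ 2)^-1 * (N * C1) +
    128 * Num.max 1 c * (C1 * (1 - z)^-1 ^+ 2))%R.

Lemma weak_type_const_gt0 (R : realType) (N C1 z : R) :
  (0 < N)%R -> (0 < C1)%R -> (0 < z)%R -> (z < 1)%R -> (0 < weak_type_const N C1 z)%R.
Proof.
move=> N0 C0 z0 z1; rewrite /weak_type_const; set c := (_ ^+ 2)%R.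
have c0 : (0 <= c)%R by exact: sqr_ge0.
have t0 : (0 <= (1 - (z ^+ 2) ^+ 2)^-1)%R.
  by rewrite invr_ge0 subr_ge0 !exprn_ile1// ?exprn_ge0 ?ltW.
have m0 : (0 <= Num.max 1 c)%R by rewrite le_max ler01.
have C0' := ltW C0; have N0' := ltW N0.
have i0 : (0 <= (1 - z)^-1)%R by rewrite invr_ge0 subr_ge0 ltW.
by rewrite -addrA ltr_wpDr// addr_ge0//;
  repeat (first [done | apply: mulr_ge0]).
Qed.

(** * Weak type bound for the oscillation sums *)

Section good_bad.
Context d (T : measurableType d) (R : realType).
Variables (mu : {measure set T -> \bar R}) (idx : nat -> T -> nat) (v : nat -> R).
Variable (N : R).
Hypothesis midx : forall i k, measurable (idx i @^-1` [set k]).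
Hypothesis v_gt0 : forall i, (0 < v i)%R.
Hypothesis mu_cell : forall i x, mu (cell (idx i) x) = (v i)%:E.
Hypothesis idxS : forall i x z, idx i.+1 x = idx i.+1 z -> idx i x = idx i z.
Hypothesis vS : forall i, v i = (N * v i.+1)%R.
Hypothesis N_ge1 : (1 <= N)%R.
Variable f : nat -> T -> R.
Hypothesis fi : forall j, mu.-integrable setT (EFin \o f j).
Variable lam : R.
Hypothesis lam_gt0 : (0 < lam)%R.
Variable w : T -> R.
Hypothesis w_ge0 : forall x, (0 <= w x)%R.
Hypothesis mw : measurable_fun setT w.
Variable C1 : R.
Hypothesis C1_gt0 : (0 < C1)%R.
Hypothesis A1 : forall i, {ae mu, forall x,
  avg mu (idx i) (v i) (EFin \o w) x <= C1%:E * (w x)%:E}.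

Local Notation A i := (avg mu (idx i) (v i)).
Local Notation E i := (cond_exp mu (idx i) (v i)).
Local Notation D i := (mdiff mu idx v i).
Local Notation F := (fun x => l2sum (fun j => (f j x)%:E)).
Local Notation sqD := (sqD mu idx v f).
Local Notation alive := (alive mu idx v f lam).
Local Notation stopped := (stopped mu idx v f lam).
Local Notation wmax := (wmax mu idx v (EFin \o w)).
Local Notation energyDw := (energyD mu idx v f lam (EFin \o w)).

Let F0 x : 0 <= F x. Proof. exact: l2sum_ge0. Qed.

Let mf j : measurable_fun setT (f j).
Proof. by apply/measurable_EFinP; exact: measurable_int (fi j). Qed.

Let mF : measurable_fun setT F.
Proof.
by apply: (measurable_l2sum (g := fun j x => (f j x)%:E)) => j; exact/measurable_EFinP.
Qed.

Let w0 x : 0 <= (w x)%:E. Proof. by rewrite lee_fin. Qed.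

Let mwe : measurable_fun setT (EFin \o w).
Proof. exact/measurable_EFinP. Qed.

Let ind0 b : 0 <= ind b :> \bar R. Proof. exact: ind_ge0. Qed.

Let cellwise_alive i : cellwise (idx i) (alive i).
Proof. exact: cellwise_alive. Qed.

Let m_alive i : measurable_fun setT (fun x => ind (alive i x) : \bar R).
Proof.
by apply: (cellwise_measurable (midx i)) => x z xz; rewrite (cellwise_alive xz).
Qed.

Let m_sqD i : measurable_fun setT (sqD i).
Proof. exact/(cellwise_measurable (midx i.+1))/cellwise_sqD. Qed.

Let sqD_ge0 i x : 0 <= sqD i x. Proof. exact: sqD_ge0. Qed.

(** Jensen for squares: with [a] the average of [g], average the inequality
    [2 * a * g <= g ^+ 2 + a ^+ 2]. *)
Lemma sqr_avg_le i (g : T -> \bar R) x : (forall z, 0 <= g z) ->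
  measurable_fun setT g -> (A i g x) ^+ 2 <= A i (fun z => g z ^+ 2) x.
Proof.
move=> g0 mg.
have mg2 := measurable_sqre mg.
have g20 z : 0 <= g z ^+ 2 by exact: expe_ge0.
have [aoo|afin] := eqVneq (A i g x) +oo.
  suff -> : A i (fun z => g z ^+ 2) x = +oo by exact: leey.
  (* An infinite average cannot serve as [a]; here [g <= 1 + g ^+ 2] shows that the average of the
     square is infinite too. *)
  have : A i g x <= A i (fun z => 1 + g z ^+ 2) x.
    apply: le_avg => // z; have := g0 z; case: (g z) => [r r0||//]; last first.
      by move=> _; rewrite expe2 mulyy leey.
    by rewrite -EFin_expe -EFinD lee_fin; nra.
  rewrite aoo (avgD mu _ (midx i))//.
  rewrite (_ : (fun=> 1) = cst 1)// (avg_cst (midx i) (v_gt0 i) (mu_cell i))//.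
  by rewrite leye_eq; case: (A i _ x).
have a0 : 0 <= A i g x by exact: avg_ge0.
have af : A i g x \is a fin_num by rewrite ge0_fin_numE// ltey.
set a := fine (A i g x); have aE : A i g x = a%:E by rewrite fineK.
have a0' : (0 <= a)%R by rewrite fine_ge0.
have H : A i (fun z => (2 * a)%:E * g z) x <= A i (fun z => g z ^+ 2 + (a ^+ 2)%:E) x.
  apply: le_avg => // z; first by rewrite mule_ge0// lee_fin mulr_ge0.
  have := g0 z; case: (g z) => [r r0||//]; last first.
    by move=> _; rewrite expe2 mulyy addye// leey.
  by rewrite -EFin_expe -EFinM -EFinD lee_fin -subr_ge0
    (_ : _ - _ = (r - a) ^+ 2)%R ?sqr_ge0//; ring.
rewrite (@avgM _ _ _ mu (idx i) (v i) (midx i) (fun=> (2 * a)%:E)) // in H; last first.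
  by move=> z; rewrite lee_fin mulr_ge0.
rewrite (avgD mu _ (midx i))// in H; last by move=> z; rewrite lee_fin sqr_ge0.
rewrite (_ : (fun=> (a ^+ 2)%:E) = cst (a ^+ 2)%:E)// in H.
rewrite (avg_cst (midx i) (v_gt0 i) (mu_cell i)) ?lee_fin ?sqr_ge0// in H.
rewrite aE -EFinM (_ : 2 * a * a = a ^+ 2 + a ^+ 2)%R in H; last by ring.
by rewrite aE -EFin_expe -(@leeD2rE _ (a ^+ 2)%:E)//.
Qed.

Variable zeta : R.
Hypothesis zeta_gt0 : (0 < zeta)%R.
Hypothesis zeta_lt1 : (zeta < 1)%R.
(** The two roots of [theta] are spent separately: [eta] when a [theta]-weighted sum of squares is
    bounded by the square of an [eta]-weighted sum, [zeta] when the sum over starting levels is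
    compared with the stopping level. *)
Let eta := (zeta ^+ 2)%R.
Let theta := (eta ^+ 2)%R.

Let eta_gt0 : (0 < eta)%R. Proof. exact: exprn_gt0. Qed.
Let eta_lt1 : (eta < 1)%R. Proof. by rewrite exprn_ilt1// ltW. Qed.
Let theta_gt0 : (0 < theta)%R. Proof. exact: exprn_gt0. Qed.
Let theta_lt1 : (theta < 1)%R. Proof. by rewrite exprn_ilt1// ltW. Qed.
Let thk_ge0 k : 0 <= (theta ^+ k)%:E. Proof. by rewrite lee_fin exprn_ge0// ltW. Qed.
Let etk_ge0 k : 0 <= (eta ^+ k)%:E. Proof. by rewrite lee_fin exprn_ge0// ltW. Qed.
Let cst2 : R := ((1 - eta)^-1 ^+ 2)%R.
Let cst2_ge0 : 0 <= cst2%:E. Proof. by rewrite lee_fin sqr_ge0. Qed.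

Local Notation H i j := (oscillation_sum mu idx v theta (f j) i).

(* [mask (i + k)] selects where the stopping rule has fired, or has not. *)
Let part (mask : nat -> T -> bool) i j x :=
  \sum_(0 <= k <oo) (theta ^+ k)%:E *
    A i (fun z => ind (mask (i + k)%N z) * `|D (i + k) (f j) z|%:E) x.

Let mD i j : measurable_fun setT (fun z => `|D i (f j) z|%:E).
Proof.
apply/measurable_EFinP; apply: measurableT_comp => //.
exact: (measurable_mdiff mu v midx).
Qed.

Let m_dead i : measurable_fun setT (fun x => ind (~~ alive i x) : \bar R).
Proof.
by apply: (cellwise_measurable (midx i)) => x z xz; rewrite (cellwise_alive xz).
Qed.

Let H_split i j x : H i j x = part alive i j x + part (fun m z => ~~ alive m z) i j x.
Proof.
rewrite -nneseriesD; first last.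
- by move=> k _ _; ege0.
- by move=> k _ _; ege0.
apply: eq_eseriesr => k _; rewrite -ge0_muleDr; [|by ege0|by ege0].
rewrite -avgD//; first last.
- exact: emeasurable_funM.
- exact: emeasurable_funM.
- by move=> z; ege0.
- by move=> z; ege0.
congr (_ * _); congr avg; apply/funext => z.
by case: alive; rewrite /ind /= !mul1e mul0e ?adde0 ?add0e.
Qed.

Let part_ge0 mask i j x : 0 <= part mask i j x.
Proof. by apply: nneseries_ge0 => k _ _; ege0. Qed.

Let sum_sqr_part_le mask i x :
  \sum_(0 <= j <oo) part mask i j x ^+ 2 <=
  cst2%:E * \sum_(0 <= k <oo) (theta ^+ k)%:E * \sum_(0 <= j <oo)
    A i (fun z => ind (mask (i + k)%N z) * `|D (i + k) (f j) z|%:E) x ^+ 2.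
Proof.
have b0 k j : 0 <= A i (fun z => ind (mask (i + k)%N z) * `|D (i + k) (f j) z|%:E) x.
  by apply: avg_ge0 => // z; ege0.
apply: (@le_trans _ _ (\sum_(0 <= j <oo) cst2%:E * \sum_(0 <= k <oo) (theta ^+ k)%:E *
    A i (fun z => ind (mask (i + k)%N z) * `|D (i + k) (f j) z|%:E) x ^+ 2)).
  apply: lee_nneseries => [j _ _|j _]; first exact: expe_ge0.
  exact: (sqr_geometric_sum_le eta_gt0 eta_lt1).
rewrite nneseriesZl; last first.
  by move=> j _; apply: nneseries_ge0 => k _ _; rewrite mule_ge0// expe_ge0.
apply: lee_wpmul2l => //; rewrite nneseries_interchange; last first.
  by move=> j k; rewrite mule_ge0// expe_ge0.
apply: lee_nneseries => [k _ _|k _]; last first.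
  by rewrite nneseriesZl// => j _; exact: expe_ge0.
by apply: nneseries_ge0 => j _ _; rewrite mule_ge0// expe_ge0.
Qed.

(** What level [i] retains of the differences of level [i + k]: their squares on the alive set, but
    only averages of [F] on the dead set, where no bound of the averages by [lam] is left. *)
Let good i k x := A i (fun z => ind (alive (i + k) z) * sqD (i + k) z) x.
Let bad i k x := A i (fun z => ind (~~ alive (i + k) z) * F z) x.

Let good_ge0 i k x : 0 <= good i k x.
Proof. by apply: avg_ge0 => // z; rewrite mule_ge0// sqD_ge0. Qed.

Let bad_ge0 i k x : 0 <= bad i k x.
Proof. by apply: avg_ge0 => // z; rewrite mule_ge0. Qed.

Let m_good i k : measurable_fun setT (good i k).
Proof. exact: measurable_avg. Qed.

Let m_bad i k : measurable_fun setT (bad i k).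
Proof. exact: measurable_avg. Qed.

Let part_alive_le i x : \sum_(0 <= j <oo) part alive i j x ^+ 2 <=
  cst2%:E * \sum_(0 <= k <oo) (theta ^+ k)%:E * good i k x.
Proof.
apply: (le_trans (sum_sqr_part_le alive i x)); apply: lee_wpmul2l => //.
apply: lee_nneseries => [k _ _|k _].
  by rewrite mule_ge0//; apply: nneseries_ge0 => j _ _; apply: expe_ge0; ege0.
apply: lee_wpmul2l => //.
have -> : good i k x = \sum_(0 <= j <oo)
    A i (fun z => (ind (alive (i + k) z) * `|D (i + k) (f j) z|%:E) ^+ 2) x.
  rewrite -(avg_nneseries mu v midx); first last.
  - by move=> j; apply: measurable_sqre; exact: emeasurable_funM.
  - by move=> j z; apply: expe_ge0; ege0.
  congr avg; apply/funext => z; rewrite /sqD -nneseriesZl; last first.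
    by move=> j _; rewrite lee_fin sqr_ge0.
  apply: eq_eseriesr => j _; rewrite expe2 muleACA -!EFinM -!expr2 real_normK ?num_real//.
  by case: alive; rewrite ?expr1n ?expr0n.
apply: lee_nneseries => [j _ _|j _]; first by apply: expe_ge0; ege0.
apply: sqr_avg_le => [z|]; first by ege0.
exact: emeasurable_funM.
Qed.

(** Minkowski in [j] leaves the length of the difference vector, which is at most twice the sum of
    the averages of [F] at levels [m] and [m.+1]. The dead set of level [m] is a union of cells of
    both levels, so by the tower property each average contributes one [bad i k x], whence the
    factor 4. *)
Let part_dead_le i x :
  \sum_(0 <= j <oo) part (fun m z => ~~ alive m z) i j x ^+ 2 <=
  cst2%:E * \sum_(0 <= k <oo) (theta ^+ k)%:E * (4%:E * bad i k x) ^+ 2.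
Proof.
apply: (le_trans (sum_sqr_part_le (fun m z => ~~ alive m z) i x)).
apply: lee_wpmul2l => //.
apply: lee_nneseries => [k _ _|k _].
  by rewrite mule_ge0//; apply: nneseries_ge0 => j _ _; apply: expe_ge0; ege0.
apply: lee_wpmul2l => //; set m := (i + k)%N.
pose g j z := ind (~~ alive m z) * `|D m (f j) z|%:E : \bar R.
have g0 j z : 0 <= g j z by rewrite /g; ege0.
have mg j : measurable_fun setT (g j) by exact: emeasurable_funM.
have v0 : (0 <= (v i)^-1)%R by rewrite invr_ge0 ltW.
apply: (@le_trans _ _ ((A i (fun z => l2sum (g ^~ z)) x) ^+ 2)).
  have -> : \sum_(0 <= j <oo) (A i (g j) x) ^+ 2 = ((v i)^-1 ^+ 2)%:E *
      \sum_(0 <= j <oo) (\int[mu]_(z in cell (idx i) x) g j z) ^+ 2.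
    rewrite -nneseriesZl; last by move=> j _; exact/expe_ge0/integral_ge0.
    by apply: eq_eseriesr => j _; rewrite /avg !expe2 muleACA -EFinM -expr2.
  have -> : A i (fun z => l2sum (g ^~ z)) x ^+ 2 = ((v i)^-1 ^+ 2)%:E *
      (\int[mu]_(z in cell (idx i) x) l2sum (g ^~ z)) ^+ 2.
    by rewrite /avg !expe2 muleACA -EFinM -expr2.
  apply: lee_wpmul2l; first by rewrite lee_fin sqr_ge0.
  exact: (minkowski_integral mu (measurable_cell (midx i) x) g0 mg).
have l0 z : 0 <= l2sum (g ^~ z) by exact: l2sum_ge0.
apply: le_sqre; first exact: avg_ge0.
have aF0 n z : 0 <= A n F z by exact: avg_ge0.
pose h n z := ind (~~ alive m z) * A n F z : \bar R.
have h0 n z : 0 <= h n z by rewrite /h; apply: mule_ge0.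
have mh n : measurable_fun setT (h n).
  by apply: emeasurable_funM => //; exact: measurable_avg.
have im : (i <= m)%N by rewrite leq_addr.
have hE n : (m <= n)%N -> A i (h n) x = bad i k x.
  move=> mn; rewrite /bad -/m.
  rewrite -[RHS](avg_tower midx v_gt0 mu_cell idxS _ (leq_trans im mn))//; first last.
  - exact: emeasurable_funM.
  - by move=> z; ege0.
  congr avg; apply/funext => z; rewrite (avgM mu _ (midx n))//.
  by apply: (cellwise_le idxS mn) => a b ab; rewrite (cellwise_alive ab).
apply: (@le_trans _ _ (A i (fun z => 2%:E * (h m.+1 z + h m z)) x)).
  apply: le_avg => // z; apply: le_of_sqre => //; first by rewrite mule_ge0// adde_ge0.
  rewrite sqr_l2sum.
  have -> : \sum_(0 <= j <oo) `|g j z| ^+ 2 = ind (~~ alive m z) * sqD m z.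
    rewrite /sqD -nneseriesZl; last by move=> j _; rewrite lee_fin sqr_ge0.
    apply: eq_eseriesr => j _; rewrite gee0_abs// /g expe2 muleACA -!EFinM -!expr2.
    by rewrite real_normK ?num_real//; case: alive; rewrite ?expr1n ?expr0n.
  rewrite /h; case: alive; rewrite /ind /= ?mul0e ?mul1e ?expe_ge0//.
    by rewrite adde0 !mule0.
  by rewrite -expe2; exact: sqD_le.
have -> : A i (fun z => 2%:E * (h m.+1 z + h m z)) x =
    2%:E * A i (fun z => h m.+1 z + h m z) x.
  apply: (@avgM _ _ _ mu (idx i) (v i) (midx i) (fun=> 2%:E)) => //.
    by move=> z; exact: adde_ge0.
  exact: emeasurable_funD.
rewrite (avgD mu _ (midx i))// !hE//.
have -> : bad i k x + bad i k x = 2%:E * bad i k x.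
  by rewrite (_ : 2%:E = 1 + 1)// ge0_muleDl// mul1e.
by rewrite muleA -EFinM -natrM.
Qed.

Let goodsum x := \sum_(0 <= i <oo) cst2%:E * \sum_(0 <= k <oo) (theta ^+ k)%:E * good i k x.
(** The indicator equals 1 at the never stopped points where this sum is used. It keeps the integral
    under control: once the average is moved off, the point must be alive at [i] and dead at
    [i + k]. *)
Let badsum x := \sum_(0 <= i <oo) \sum_(0 <= k <oo)
  (eta ^+ k)%:E * (ind (alive i x) * bad i k x).

Let goodsum_ge0 x : 0 <= goodsum x.
Proof.
apply: nneseries_ge0 => i _ _; apply: mule_ge0 => //.
by apply: nneseries_ge0 => k _ _; exact: mule_ge0.
Qed.

Let badsum_ge0 x : 0 <= badsum x.
Proof.
by apply: nneseries_ge0 => i _ _; apply: nneseries_ge0 => k _ _; rewrite mule_ge0// mule_ge0.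
Qed.

Let mass := \int[mu]_x ((w x)%:E * F x).

Let mass_ge0 : 0 <= mass.
Proof. by apply: integral_ge0 => x _; exact: mule_ge0. Qed.

Let m_goodsum : measurable_fun setT goodsum.
Proof.
apply: ge0_emeasurable_sum => [i x _ _|i _].
  apply: mule_ge0 => //.
  by apply: nneseries_ge0 => k _ _; exact: mule_ge0.
apply: measurable_funeM; apply: ge0_emeasurable_sum => [k x _ _|k _].
  exact: mule_ge0.
exact: measurable_funeM.
Qed.

Let m_badsum : measurable_fun setT badsum.
Proof.
apply: ge0_emeasurable_sum => [i x _ _|i _].
  by apply: nneseries_ge0 => k _ _; rewrite mule_ge0// mule_ge0.
apply: ge0_emeasurable_sum => [k x _ _|k _]; first by rewrite mule_ge0// mule_ge0.
by apply: measurable_funeM; exact: emeasurable_funM.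
Qed.

Let energyD_ge0 i : 0 <= energyDw i.
Proof.
apply: integral_ge0 => x _; apply: mule_ge0 => //; apply: mule_ge0 => //.
exact: wmax_ge0.
Qed.

Let wint_sum (g : nat -> T -> \bar R) : (forall k x, 0 <= g k x) ->
  (forall k, measurable_fun setT (g k)) ->
  \int[mu]_x ((w x)%:E * \sum_(0 <= k <oo) g k x) =
  \sum_(0 <= k <oo) \int[mu]_x ((w x)%:E * g k x).
Proof.
move=> g0 mg; rewrite -integral_nneseries//.
- by apply: eq_integral => x _; rewrite nneseriesZl.
- by move=> k; exact: emeasurable_funM.
- by move=> k x _; exact: mule_ge0.
Qed.

Let wint_scale (c : \bar R) (g : T -> \bar R) : 0 <= c -> (forall x, 0 <= g x) ->
  measurable_fun setT g ->
  \int[mu]_x ((w x)%:E * (c * g x)) = c * \int[mu]_x ((w x)%:E * g x).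
Proof.
move=> c0 g0 mg; under eq_integral do rewrite muleCA.
rewrite ge0_integralZl//; first exact: emeasurable_funM.
by move=> x _; exact: mule_ge0.
Qed.

(** Self-adjointness puts the average of level [i] on [w], where it is below [wmax (i + k)]; so each
    term is at most the energy of level [i + k], and summing over [i] for fixed [k] gives at most
    the total energy. *)
Let integral_goodsum : \int[mu]_x ((w x)%:E * goodsum x) <=
  (cst2 * (1 - theta)^-1 * (N * lam * C1))%:E * mass.
Proof.
have I1 i k : \int[mu]_x ((w x)%:E * good i k x) <= energyDw (i + k).
  rewrite /good (integral_avg_sym mu (midx i) (v_gt0 i))//; first last.
  - exact: emeasurable_funM.
  - by move=> x; exact: mule_ge0.
  rewrite /energyD; apply: ge0_le_lower_integral => x _; first by ege0.
  rewrite muleA; apply: lee_wpmul2r => //; apply: lee_wpmul2r => //.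
  apply: (le_trans (avg_le_wmax mu idx v (EFin \o w) i x)).
  by apply: wmax_le; rewrite leq_addr.
have g0 i k x : 0 <= (theta ^+ k)%:E * good i k x by exact: mule_ge0.
have mg i k : measurable_fun setT (fun x => (theta ^+ k)%:E * good i k x).
  exact: measurable_funeM.
have s0 i x : 0 <= \sum_(0 <= k <oo) (theta ^+ k)%:E * good i k x.
  exact: nneseries_ge0.
have ms i : measurable_fun setT (fun x => \sum_(0 <= k <oo) (theta ^+ k)%:E * good i k x).
  by apply: ge0_emeasurable_sum.
rewrite wint_sum; first last.
- by move=> i; exact: measurable_funeM.
- by move=> i x; exact: mule_ge0.
apply: (@le_trans _ _ (\sum_(0 <= i <oo) cst2%:E *
    \sum_(0 <= k <oo) (theta ^+ k)%:E * energyDw (i + k))).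
  apply: lee_nneseries => [i _ _|i _].
    by apply: integral_ge0 => x _; rewrite mule_ge0// mule_ge0.
  rewrite wint_scale//; apply: lee_wpmul2l => //.
  rewrite wint_sum//; apply: lee_nneseries => [k _ _|k _].
    by apply: integral_ge0 => x _; exact: mule_ge0.
  by rewrite wint_scale//; apply: lee_wpmul2l.
rewrite nneseriesZl; last first.
  by move=> i _; apply: nneseries_ge0 => k _ _; exact: mule_ge0.
rewrite -(mulrA cst2) (EFinM cst2) -muleA; apply: lee_wpmul2l => //.
rewrite nneseries_interchange; last by move=> i k; exact: mule_ge0.
rewrite (eq_eseriesr (g := fun k => (theta ^+ k)%:E * \sum_(0 <= i <oo) energyDw (i + k))); last first.
  by move=> k _; rewrite nneseriesZl.
rewrite EFinM -muleA; apply: geometric_sum_le => //.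
- by move=> k; exact: nneseries_ge0.
- rewrite mule_ge0// lee_fin !mulr_ge0 ?(ltW lam_gt0) ?(ltW C1_gt0)//.
  exact: le_trans N_ge1.
move=> k; apply: (@le_trans _ _ (\sum_(0 <= i <oo) energyDw i)); last first.
  exact: (energy_total midx v_gt0 mu_cell idxS vS N_ge1 fi lam_gt0 w0 mwe C1_gt0 A1).
exact: (@nneseries_shift_le _ energyDw).
Qed.

Let stopping_sum n s :
  (\sum_(0 <= i < n) (i < s)%N%:R * zeta ^+ (s - i) <= \sum_(0 <= j < s) zeta ^+ j.+1)%R.
Proof.
have z0 k : (0 <= zeta ^+ k)%R by rewrite exprn_ge0// ltW.
elim: n s => [|n IH] s; first by rewrite big_geq// sumr_ge0.
case: s => [|s]; first by rewrite !big1_seq// => i _; rewrite ltn0 mul0r.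
rewrite big_nat_recl// big_nat_recr//= mul1r subn0 [leLHS]addrC lerD2r.
by under eq_bigr do rewrite ltnS subSS.
Qed.

(** If [s] is the stopping level of [x], a term survives only for [i < s <= i + k]. Then half of the
    weight, [zeta ^+ k], is at most [zeta ^+ (s - i)] and pays for the sum over [i], while the other
    half pays for the sum over [k]. *)
Let stopping_weights x : \sum_(0 <= i <oo) \sum_(0 <= k <oo)
   (eta ^+ k)%:E * (ind (alive i x) * ind (~~ alive (i + k) x)) <=
   ((1 - zeta)^-1 ^+ 2)%:E.
Proof.
have [[m dm]|al] := pselect (exists m, ~~ alive m x); last first.
  have -> : \sum_(0 <= i <oo) \sum_(0 <= k <oo)
      (eta ^+ k)%:E * (ind (alive i x) * ind (~~ alive (i + k) x)) = 0.
    apply: eseries0 => i _ _; apply: eseries0 => k _ _.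
    case: (boolP (alive (i + k) x)) => [_|dm]; first by rewrite /ind !mule0.
    by case: al; exists (i + k)%N.
  by rewrite lee_fin sqr_ge0.
pose s := ex_minn (ex_intro (fun m => ~~ alive m x) m dm).
have [ds smin] : ~~ alive s x /\ forall k, ~~ alive k x -> (s <= k)%N.
  by rewrite /s; case: ex_minnP.
have aliveE i : alive i x = (i < s)%N.
  apply/idP/idP => [ai|]; last by apply: contraTT => /smin; rewrite -leqNgt.
  by rewrite ltnNge; apply: contra ds => /alive_le; apply.
have z0 k : (0 <= zeta ^+ k)%R by rewrite exprn_ge0// ltW.
have d0 : (0 <= (1 - zeta)^-1)%R by rewrite invr_ge0 subr_ge0 ltW.
have inner i : \sum_(0 <= k <oo)
    (eta ^+ k)%:E * (ind (alive i x) * ind (~~ alive (i + k) x)) <=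
    (1 - zeta)^-1%:E * ((i < s)%N%:R * zeta ^+ (s - i))%:E.
  rewrite (eq_eseriesr (g := fun k => (zeta ^+ k)%:E * ((zeta ^+ k)%:E *
     (ind (alive i x) * ind (~~ alive (i + k) x))))); last first.
    move=> k _; have -> : (eta ^+ k)%:E = (zeta ^+ k)%:E * (zeta ^+ k)%:E :> \bar R.
      by rewrite -EFinM -exprMn -expr2.
    by rewrite -muleA.
  apply: geometric_sum_le => //.
  - by move=> k; rewrite mule_ge0// ?lee_fin// mule_ge0.
  - by rewrite lee_fin mulr_ge0.
  - move=> k; rewrite !aliveE -!EFinM lee_fin -leqNgt.
    case: ltnP => is_ /=; last by rewrite mul0r mulr0 mul0r.
    rewrite !mul1r; case: leqP => sk /=; last by rewrite mulr0.
    rewrite mulr1; apply: ler_wiXn2l; [exact: ltW|exact: ltW|].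
    by rewrite leq_subLR.
apply: (@le_trans _ _ (\sum_(0 <= i <oo)
    (1 - zeta)^-1%:E * ((i < s)%N%:R * zeta ^+ (s - i))%:E)).
  apply: lee_nneseries => [i _ _|i _] //.
  by apply: nneseries_ge0 => k _ _; rewrite mule_ge0// mule_ge0.
rewrite nneseriesZl; last by move=> i _; rewrite lee_fin mulr_ge0.
rewrite EFin_expe expe2; apply: lee_wpmul2l; first by rewrite lee_fin.
apply: nneseries_le => [i|n]; first by rewrite lee_fin mulr_ge0.
rewrite sumEFin lee_fin; apply: le_trans (stopping_sum n s) _.
apply: le_trans (geometric_le s zeta_gt0 zeta_lt1).
by apply: ler_sum => j _; rewrite exprS ler_piMl// ltW.
Qed.

Let integral_badsum : \int[mu]_x ((w x)%:E * badsum x) <=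
  (C1 * (1 - zeta)^-1 ^+ 2)%:E * mass.
Proof.
pose g i k x := ind (alive i x) * (ind (~~ alive (i + k) x) * F x) : \bar R.
have g0 i k x : 0 <= g i k x by rewrite /g mule_ge0// mule_ge0.
have mdF m : measurable_fun setT (fun x => ind (~~ alive m x) * F x).
  exact: emeasurable_funM.
have mg i k : measurable_fun setT (g i k) by exact: emeasurable_funM.
have b0 i k x : 0 <= ind (alive i x) * bad i k x by exact: mule_ge0.
have mb i k : measurable_fun setT (fun x => ind (alive i x) * bad i k x).
  exact: emeasurable_funM.
have I1 i k : \int[mu]_x ((w x)%:E * (ind (alive i x) * bad i k x)) <=
    C1%:E * \int[mu]_x ((w x)%:E * g i k x).
  under eq_integral do rewrite muleA.
  have wa0 x : 0 <= (w x)%:E * ind (alive i x) by exact: mule_ge0.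
  have mwa : measurable_fun setT (fun x => (w x)%:E * ind (alive i x)).
    exact: emeasurable_funM.
  have dF0 x : 0 <= ind (~~ alive (i + k) x) * F x by exact: mule_ge0.
  rewrite /bad (integral_avg_sym mu (midx i) (v_gt0 i))//.
  apply: (@le_trans _ _ (\int[mu]_x (wmax i x * g i k x))); last first.
    exact: (integral_wmax_le midx v_gt0 idxS w0 mwe C1_gt0 A1).
  apply: ge0_le_lower_integral => x _; first by ege0.
  have -> : A i (fun x => (w x)%:E * ind (alive i x)) x =
      ind (alive i x) * A i (EFin \o w) x.
    rewrite -(@avgM _ _ _ mu (idx i) (v i) (midx i) (fun x => ind (alive i x)))//.
      by congr avg; apply/funext => z; rewrite muleC.
    by move=> a b ab; rewrite (cellwise_alive ab).
  rewrite /g muleAC muleC muleA -muleA; apply: lee_wpmul2r; first by ege0.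
  exact: avg_le_wmax.
have eg0 i k x : 0 <= (eta ^+ k)%:E * g i k x by exact: mule_ge0.
have meg i k : measurable_fun setT (fun x => (eta ^+ k)%:E * g i k x).
  exact: measurable_funeM.
have seg0 i x : 0 <= \sum_(0 <= k <oo) (eta ^+ k)%:E * g i k x.
  exact: nneseries_ge0.
have mseg i : measurable_fun setT (fun x => \sum_(0 <= k <oo) (eta ^+ k)%:E * g i k x).
  by apply: ge0_emeasurable_sum.
have eb0 i k x : 0 <= (eta ^+ k)%:E * (ind (alive i x) * bad i k x) by exact: mule_ge0.
have meb i k : measurable_fun setT (fun x => (eta ^+ k)%:E * (ind (alive i x) * bad i k x)).
  exact: measurable_funeM.
apply: (@le_trans _ _ (\sum_(0 <= i <oo) \sum_(0 <= k <oo)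
    C1%:E * \int[mu]_x ((w x)%:E * ((eta ^+ k)%:E * g i k x)))).
  rewrite wint_sum; first last.
  - by move=> i; apply: ge0_emeasurable_sum.
  - by move=> i x; exact: nneseries_ge0.
  apply: lee_nneseries => [i _ _|i _].
    by apply: integral_ge0 => x _; apply: mule_ge0 => //; exact: nneseries_ge0.
  rewrite wint_sum//; apply: lee_nneseries => [k _ _|k _].
    by apply: integral_ge0 => x _; exact: mule_ge0.
  by rewrite !wint_scale// muleCA; apply: lee_wpmul2l.
have C10 : 0 <= C1%:E by rewrite lee_fin ltW.
have wi0 (h : T -> \bar R) : (forall x, 0 <= h x) -> 0 <= \int[mu]_x ((w x)%:E * h x).
  by move=> h0; apply: integral_ge0 => x _; exact: mule_ge0.
have -> : \sum_(0 <= i <oo) \sum_(0 <= k <oo)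
    C1%:E * \int[mu]_x ((w x)%:E * ((eta ^+ k)%:E * g i k x)) =
    C1%:E * \int[mu]_x ((w x)%:E * \sum_(0 <= i <oo) \sum_(0 <= k <oo)
      (eta ^+ k)%:E * g i k x).
  rewrite wint_sum// -nneseriesZl; last by move=> i _; exact: wi0.
  apply: eq_eseriesr => i _; rewrite wint_sum// nneseriesZl// => k _; exact: wi0.
rewrite EFinM -muleA; apply: lee_wpmul2l => //.
rewrite -wint_scale ?lee_fin ?sqr_ge0//.
apply: ge0_le_lower_integral => x _.
  by apply: mule_ge0 => //; exact: nneseries_ge0.
apply: lee_wpmul2l => //.
(* An infinite [F x] makes the right side infinite; otherwise it is a real factor, which leaves the
   double series and exposes the stopping weights. *)
have [->|Foo] := eqVneq (F x) +oo.
  by rewrite gt0_muley ?leey// lte_fin exprn_gt0// invr_gt0 subr_gt0.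
have Ffin : F x \is a fin_num by rewrite ge0_fin_numE ?ltey.
have ek0 i k : 0 <= (eta ^+ k)%:E * (ind (alive i x) * ind (~~ alive (i + k) x)).
  by rewrite mule_ge0// mule_ge0.
apply: le_trans (_ : F x * (\sum_(0 <= i <oo) \sum_(0 <= k <oo)
   (eta ^+ k)%:E * (ind (alive i x) * ind (~~ alive (i + k) x))) <= _); last first.
  by rewrite muleC; apply: lee_wpmul2r => //; exact: stopping_weights.
rewrite -(fineK Ffin) -nneseriesZl; last by move=> i _; exact: nneseries_ge0.
apply: lee_nneseries => [i _ _|i _]; first exact: nneseries_ge0.
rewrite -nneseriesZl//.
apply: lee_nneseries => [k _ _|k _] //.
by rewrite (fineK Ffin) /g (muleC (F x)) -!muleA.
Qed.

Let stopsum x := \sum_(0 <= i <oo) ind (stopped i x) : \bar R.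

Let stopsum_le1 x : stopsum x <= 1.
Proof.
apply: nneseries_le => // -[|n]; first by rewrite big_geq.
by rewrite -(sum_stopped mu idx v f lam n x) leeDl.
Qed.

Let m_stopped i : measurable_fun setT (fun x => ind (stopped i x) : \bar R).
Proof.
by apply: (cellwise_measurable (midx i)) => x z xz; rewrite (_ : stopped i x = stopped i z)//;
   exact: cellwise_stopped.
Qed.

Let integral_stopsum : \int[mu]_x ((w x)%:E * stopsum x) <= (C1 / lam)%:E * mass.
Proof.
have wi0 (h : T -> \bar R) : (forall x, 0 <= h x) -> 0 <= \int[mu]_x ((w x)%:E * h x).
  by move=> h0; apply: integral_ge0 => x _; exact: mule_ge0.
have mi : forall i, measurable_fun setT (fun x => ind (stopped i x) * F x).
  by move=> i; exact: emeasurable_funM.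
have Cl0 : 0 <= (C1 / lam)%:E by rewrite lee_fin divr_ge0// ltW.
rewrite wint_sum//.
apply: (@le_trans _ _ (\sum_(0 <= i <oo) (C1 / lam)%:E *
    \int[mu]_x ((w x)%:E * (ind (stopped i x) * F x)))).
  apply: lee_nneseries => [i _ _|i _]; first exact: wi0.
  rewrite mulrC EFinM -muleA lee_pdivlMl//.
  exact: (integral_stopped_le midx v_gt0 mu_cell idxS fi lam_gt0 w0 mwe C1_gt0 A1).
have sF0 i x : 0 <= ind (stopped i x) * F x by exact: mule_ge0.
rewrite nneseriesZl; last by move=> i _; exact: wi0.
apply: lee_wpmul2l => //; rewrite -wint_sum//.
apply: ge0_le_lower_integral => x _.
  by apply: mule_ge0 => //; exact: nneseries_ge0.
apply: lee_wpmul2l => //; apply: nneseries_le => // n.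
rewrite -ge0_sume_distrl// -[leRHS]mul1e; apply: lee_wpmul2r => //.
apply: le_trans (stopsum_le1 x).
exact: (@partial_sum_le_nneseries _ (fun i => ind (stopped i x))).
Qed.

Let Hsum x := \sum_(0 <= i <oo) \sum_(0 <= j <oo) H i j x ^+ 2.

(** [Hsum_le] carries [64 * cst2] in front of the square of [badsum], and half of [lam ^+ 2] is
    allotted to this term. The maximum with 1 makes [kappa ^+ 2] dominate [128 * cst2], so a linear
    condition on [badsum] suffices. *)
Let kappa : R := (128 * Num.max 1 cst2)%R.

(** At a point never stopped the indicators in [badsum] are all 1. The squares over [i] and [k] are
    summed as if in l^1, because only first powers of the bad averages can be integrated against
    [w]. *)
Let Hsum_le x : (forall i, alive i x) ->
  Hsum x <= 4%:E * (goodsum x + 16%:E * (cst2%:E * badsum x ^+ 2)).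
Proof.
move=> al.
have p0 mask i j : 0 <= part mask i j x by exact: part_ge0.
have sp0 mask i : 0 <= \sum_(0 <= j <oo) part mask i j x ^+ 2.
  by apply: nneseries_ge0 => j _ _; exact: expe_ge0.
apply: (@le_trans _ _ (4%:E * (\sum_(0 <= i <oo) \sum_(0 <= j <oo) part alive i j x ^+ 2 +
   \sum_(0 <= i <oo) \sum_(0 <= j <oo) part (fun m z => ~~ alive m z) i j x ^+ 2))).
  rewrite -nneseriesD// -nneseriesZl; last by move=> i _; exact: adde_ge0.
  apply: lee_nneseries => [i _ _|i _].
    apply: nneseries_ge0 => j _ _; apply: expe_ge0.
    by rewrite H_split adde_ge0.
  rewrite -nneseriesD; [|by move=> j _ _; exact: expe_ge0|by move=> j _ _; exact: expe_ge0].
  rewrite -nneseriesZl; last by move=> j _; rewrite adde_ge0// expe_ge0.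
  apply: lee_nneseries => [j _ _|j _].
    by rewrite H_split expe_ge0// adde_ge0.
  by rewrite H_split; apply: sqreD_le.
apply: lee_wpmul2l => //; apply: leeD.
  by apply: lee_nneseries => [i _ _|i _] //; exact: part_alive_le.
have eb0 i k : 0 <= (eta ^+ k)%:E * bad i k x by exact: mule_ge0.
have e2 i k : (theta ^+ k)%:E * (4%:E * bad i k x) ^+ 2 =
    16%:E * ((eta ^+ k)%:E * bad i k x) ^+ 2.
  have -> : (4%:E * bad i k x) ^+ 2 = 16%:E * (bad i k x ^+ 2).
    by rewrite !expe2 muleACA -EFinM -natrM.
  have -> : ((eta ^+ k)%:E * bad i k x) ^+ 2 = (theta ^+ k)%:E * bad i k x ^+ 2.
    by rewrite !expe2 muleACA -EFinM -expr2 /theta -!(exprM eta) mulnC.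
  by rewrite muleCA.
have c16 : 0 <= (16%:E : \bar R) by [].
apply: (@le_trans _ _ (\sum_(0 <= i <oo) 16%:E * (cst2%:E *
    (\sum_(0 <= k <oo) (eta ^+ k)%:E * bad i k x) ^+ 2))).
  apply: lee_nneseries => [i _ _|i _] //.
  apply: le_trans (part_dead_le i x) _; rewrite muleCA; apply: lee_wpmul2l => //.
  rewrite (eq_eseriesr (g := fun k => 16%:E * ((eta ^+ k)%:E * bad i k x) ^+ 2))//.
  rewrite nneseriesZl; last by move=> k _; exact: expe_ge0.
  apply: lee_wpmul2l => //.
  exact: (@sum_sqre_le _ (fun k => (eta ^+ k)%:E * bad i k x)).
have sb0 i : 0 <= \sum_(0 <= k <oo) (eta ^+ k)%:E * bad i k x by exact: nneseries_ge0.
rewrite nneseriesZl; last by move=> i _; rewrite mule_ge0// expe_ge0.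
apply: lee_wpmul2l => //.
rewrite nneseriesZl; last by move=> i _; rewrite expe_ge0.
apply: lee_wpmul2l => //.
apply: le_trans (@sum_sqre_le _ _ sb0) _.
rewrite /badsum; apply: le_sqre; first exact: nneseries_ge0.
apply: lee_nneseries => // i _; apply: lee_nneseries => // k _.
by rewrite al /ind mul1e.
Qed.

(** Chebyshev at each point: a large [Hsum] means that the point is stopped or that one of the two
    sums is large. The good sum is normalised by [lam ^+ 2] and the bad one by [lam], and each of
    them then integrates to a multiple of [mass / lam]. *)
Let majorant x : lam%:E ^+ 2 < Hsum x ->
  1 <= stopsum x + ((8 / lam ^+ 2)%:E * goodsum x + (kappa / lam)%:E * badsum x).
Proof.
move=> lH.
have l2 : (0 < lam ^+ 2)%R by exact: exprn_gt0.
have k1 : (1 <= Num.max 1 cst2)%R by rewrite le_max lexx.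
have kap0 : (0 < kappa)%R by rewrite mulr_gt0// (lt_le_trans ltr01).
have t1 : 0 <= (8 / lam ^+ 2)%:E * goodsum x.
  by rewrite mule_ge0// lee_fin divr_ge0// ltW.
have t2 : 0 <= (kappa / lam)%:E * badsum x.
  by rewrite mule_ge0// lee_fin divr_ge0// ltW.
have t3 : 0 <= stopsum x by exact: nneseries_ge0.
have [al|] := pselect (forall i, alive i x); last first.
  move=> /existsNP[n /negP dn].
  apply: (@le_trans _ _ (stopsum x)); last by rewrite leeDl// adde_ge0.
  rewrite -(sum_stopped mu idx v f lam n x) (negbTE dn) /ind adde0.
  exact: (@partial_sum_le_nneseries _ (fun i => ind (stopped i x))).
have := Hsum_le al.
have [g1 _|g1 Hs] := leP 1 ((8 / lam ^+ 2)%:E * goodsum x).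
  by apply: (le_trans g1); rewrite addeCA leeDl// adde_ge0.
have [b1|b1] := leP 1 ((kappa / lam)%:E * badsum x).
  by apply: (le_trans b1); rewrite addeA leeDr// adde_ge0.
exfalso; move: (lt_le_trans lH Hs); apply/negP; rewrite -leNgt.
have gf : goodsum x \is a fin_num.
  rewrite ge0_fin_numE// ltey; apply: contraTN g1 => /eqP ->.
  by rewrite -leNgt gt0_muley ?leey// lte_fin divr_gt0.
have bf : badsum x \is a fin_num.
  rewrite ge0_fin_numE// ltey; apply: contraTN b1 => /eqP ->.
  by rewrite -leNgt gt0_muley ?leey// lte_fin divr_gt0.
move: g1 b1; rewrite -(fineK gf) -(fineK bf).
have g00 : (0 <= fine (goodsum x))%R by exact: fine_ge0.
have b00 : (0 <= fine (badsum x))%R by exact: fine_ge0.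
move: (fine (goodsum x)) (fine (badsum x)) g00 b00 => g b g00 b00.
rewrite -!EFinM !lte_fin -!EFin_expe => g1 b1.
rewrite lee_fin -(expr2 b).
have c0 : (0 <= cst2)%R by exact: sqr_ge0.
have g2 : (8 * g <= lam ^+ 2)%R.
  by rewrite -(ler_pM2l (_ : 0 < (lam ^+ 2)^-1)%R) ?invr_gt0// mulVf ?gt_eqF//;
     rewrite mulrA (mulrC _ 8%R) ltW.
have b2 : (kappa * b <= lam)%R.
  by rewrite -(ler_pM2l (_ : 0 < lam^-1)%R) ?invr_gt0// mulVf ?gt_eqF//;
     rewrite mulrA (mulrC _ kappa) ltW.
have b3 : (128 * cst2 * b ^+ 2 <= lam ^+ 2)%R.
  apply: (@le_trans _ _ ((kappa * b) ^+ 2)%R); last first.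
    by rewrite ler_sqr ?nnegrE// ?(ltW lam_gt0)// mulr_ge0// ltW.
  rewrite exprMn; apply: ler_wpM2r; first exact: sqr_ge0.
  have m1 : (cst2 <= Num.max 1 cst2)%R by rewrite le_max lexx orbT.
  rewrite /kappa; move: (Num.max _ _) k1 m1 => M M1 cM; nra.
nra.
Qed.

Theorem weak_type_oscillation :
  \int[mu]_(x in [set x | lam%:E ^+ 2 < \sum_(0 <= i <oo) \sum_(0 <= j <oo)
      oscillation_sum mu idx v ((zeta ^+ 2) ^+ 2) (f j) i x ^+ 2]) (w x)%:E <=
  (weak_type_const N C1 zeta / lam)%:E * \int[mu]_x ((w x)%:E * F x).
Proof.
rewrite -/(Hsum _) -/mass.
have l2 : (0 < lam ^+ 2)%R by exact: exprn_gt0.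
have k1 : (1 <= Num.max 1 cst2)%R by rewrite le_max lexx.
have kap0 : (0 < kappa)%R by rewrite mulr_gt0// (lt_le_trans ltr01).
have e0 : 0 <= (8 / lam ^+ 2)%:E by rewrite lee_fin divr_ge0// ltW.
have e1 : 0 <= (kappa / lam)%:E by rewrite lee_fin divr_ge0// ltW.
have s0 x : 0 <= stopsum x by exact: nneseries_ge0.
have ms : measurable_fun setT stopsum by exact: ge0_emeasurable_sum.
have mg1 : measurable_fun setT (fun x => (8 / lam ^+ 2)%:E * goodsum x).
  exact: measurable_funeM.
have mb1 : measurable_fun setT (fun x => (kappa / lam)%:E * badsum x).
  exact: measurable_funeM.
have g1 x : 0 <= (8 / lam ^+ 2)%:E * goodsum x by exact: mule_ge0.
have b1 x : 0 <= (kappa / lam)%:E * badsum x by exact: mule_ge0.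
have gb1 x : 0 <= (8 / lam ^+ 2)%:E * goodsum x + (kappa / lam)%:E * badsum x.
  exact: adde_ge0.
apply: (@le_trans _ _ (\int[mu]_x ((w x)%:E * (stopsum x +
   ((8 / lam ^+ 2)%:E * goodsum x + (kappa / lam)%:E * badsum x))))).
  rewrite integral_mkcond; apply: ge0_le_lower_integral => x _.
    by apply: erestrict_ge0 => // z _.
  rewrite patchE; case: ifPn => [|_]; last by rewrite mule_ge0// adde_ge0.
  by rewrite inE /= => /majorant h; rewrite -[leLHS]mule1; apply: lee_wpmul2l.
under eq_integral do rewrite ge0_muleDr// ge0_muleDr//.
rewrite ge0_integralD//; first last.
- apply: emeasurable_funD; exact: emeasurable_funM.
- by move=> x _; rewrite adde_ge0// mule_ge0.
- exact: emeasurable_funM.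
- by move=> x _; exact: mule_ge0.
rewrite ge0_integralD//; first last.
- exact: emeasurable_funM.
- by move=> x _; exact: mule_ge0.
- exact: emeasurable_funM.
- by move=> x _; exact: mule_ge0.
have N0 : (0 <= N)%R by exact: le_trans N_ge1.
have th0 : (0 <= (1 - theta)^-1)%R by rewrite invr_ge0 subr_ge0 ltW.
have z0 : (0 <= (1 - zeta)^-1 ^+ 2)%R by exact: sqr_ge0.
have li : (0 <= lam^-1)%R by rewrite invr_ge0 ltW.
have c2 : (0 <= cst2)%R by exact: sqr_ge0.
have C10 := ltW C1_gt0.
have p1 : 0 <= (C1 / lam)%:E by rewrite lee_fin mulr_ge0.
have p2 : 0 <= (8 * cst2 * (1 - theta)^-1 * (N * C1) / lam)%:E.
  by rewrite lee_fin; do ![apply: mulr_ge0 => //].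
have p3 : 0 <= (kappa * (C1 * (1 - zeta)^-1 ^+ 2) / lam)%:E.
  rewrite lee_fin mulr_ge0// mulr_ge0//; first exact: ltW.
  exact: mulr_ge0.
rewrite [X in _ <= X * _](_ : _ = (C1 / lam)%:E +
    (8 * cst2 * (1 - theta)^-1 * (N * C1) / lam)%:E +
    (kappa * (C1 * (1 - zeta)^-1 ^+ 2) / lam)%:E); last by rewrite -!EFinD -!mulrDl.
rewrite (ge0_muleDl _ (adde_ge0 p1 p2) p3) (ge0_muleDl _ p1 p2).
rewrite -[leRHS]addeA; apply: leeD; first exact: integral_stopsum.
apply: leeD.
  rewrite wint_scale//.
  apply: le_trans (lee_wpmul2l e0 integral_goodsum) _.
  rewrite muleA -EFinM; apply: lee_wpmul2r => //; rewrite lee_fin le_eqVlt.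
  apply/orP; left; apply/eqP; field.
  by rewrite (gt_eqF lam_gt0)//= subr_eq0 eq_sym lt_eqF.
rewrite wint_scale//.
apply: le_trans (lee_wpmul2l e1 integral_badsum) _.
by rewrite muleA -EFinM mulrAC.
Qed.

End good_bad.

(** * Mean-zero kernels against martingale differences *)

Section oscillation.
Context d (T : measurableType d) (R : realType).
Variables (mu : {measure set T -> \bar R}) (idx : nat -> T -> nat) (v : nat -> R).
Hypothesis midx : forall i k, measurable (idx i @^-1` [set k]).
Hypothesis v_gt0 : forall i, (0 < v i)%R.
Hypothesis mu_cell : forall i x, mu (cell (idx i) x) = (v i)%:E.
Hypothesis idxS : forall i x z, idx i.+1 x = idx i.+1 z -> idx i x = idx i z.

Local Notation A i := (avg mu (idx i) (v i)).
Local Notation E i := (cond_exp mu (idx i) (v i)).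
Local Notation D i := (mdiff mu idx v i).

(** On the cell, [g] is the constant [E i g], killed by the mean of [psi], plus differences of
    levels [i + l] and a remainder. Each of these has mean zero on the cells of its level, so it
    meets only the oscillation of [psi] there. This also sends the remainder to 0, its L^1 norm
    being at most twice that of [g]. *)
Lemma oscillation_bound i x (psi g : T -> R) (M W theta : R) :
  mu.-integrable setT (EFin \o g) -> measurable_fun setT psi ->
  (forall z, `|psi z| <= M)%R -> (0 <= W)%R -> (0 < theta)%R -> (theta < 1)%R ->
  (forall k z z', idx (i + k) z = idx (i + k) z' -> `|psi z - psi z'| <= W * theta ^+ k)%R ->
  \int[mu]_(z in cell (idx i) x) (psi z)%:E = 0 ->
  `|\int[mu]_(z in cell (idx i) x) (psi z * g z)%:E| <=
  (W * v i)%:E * oscillation_sum mu idx v theta g i x.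
Proof.
move=> gi mpsi psiM W0 th0 th1 osc psi0; set Q := cell (idx i) x.
have mQ : measurable Q by exact: measurable_cell.
have sQ k : saturated (idx (i + k)) Q by apply: saturated_cell => //; rewrite leq_addr.
have Wt k : (0 <= W * theta ^+ k)%R by rewrite mulr_ge0// exprn_ge0// ltW.
have mg : measurable_fun setT g by apply/measurable_EFinP; exact: measurable_int gi.
have ai : 0 <= \int[mu]_x `|g x|%:E by exact: integral_ge0.
have gfin : \int[mu]_x `|g x|%:E < +oo by case/integrableP : gi.
pose rem k z := (g z - E (i + k) g z)%R.
have remi k : mu.-integrable setT (EFin \o rem k).
  rewrite (_ : EFin \o _ = (EFin \o g) \- (EFin \o E (i + k) g)); last exact/funext.
  by apply: integrableB => //; exact: integrable_cond_exp.
have rem0 k u : \int[mu]_(z in cell (idx (i + k)) u) (rem k z)%:E = 0.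
  have mc := measurable_cell (midx (i + k)) u.
  have Ei : mu.-integrable setT (EFin \o E (i + k) g) by exact: integrable_cond_exp.
  rewrite (_ : (fun z => (rem k z)%:E) = (EFin \o g) \- (EFin \o E (i + k) g))//.
  rewrite integralB//=; [|exact: integrable_cellS|exact: integrable_cellS].
  rewrite integral_cond_exp_cell// subee// integrable_fin_num//.
  exact: integrable_cellS.
have mulI (h : T -> R) : mu.-integrable setT (EFin \o h) ->
    mu.-integrable Q (fun z => (psi z * h z)%:E).
  by move=> hi; apply: (integrable_bounded_mul (M := M)).
have rem_le k : `|\int[mu]_(z in Q) (psi z * rem k z)%:E| <=
    (W * theta ^+ k)%:E * (2%:E * \int[mu]_x `|g x|%:E).
  apply: (le_trans (integral_mul_oscillation (midx (i + k)) mQ (sQ k) mpsi (Wt k) psiM (osc k) (remi k) (rem0 k))).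
  apply: lee_wpmul2l; first by rewrite lee_fin.
  apply: (@le_trans _ _ (\int[mu]_z (`|g z|%:E + A (i + k) (fun u => `|g u|%:E) z))).
    rewrite integral_mkcond; apply: ge0_le_lower_integral => z _.
      by rewrite patchE; case: ifP.
    rewrite patchE; case: ifP => _; last by rewrite adde_ge0// avg_ge0.
    apply: (@le_trans _ _ (`|g z|%:E + `|E (i + k) g z|%:E)).
      by rewrite -EFinD lee_fin ler_normB.
    by apply: leeD2l; exact: (norm_cond_exp_le (midx (i + k)) (v_gt0 (i + k)) z gi).
  have mng : measurable_fun setT (fun u => `|g u|%:E).
    by apply/measurable_EFinP; apply: measurableT_comp.
  rewrite ge0_integralD//; first last.
  - exact: measurable_avg.
  - by move=> z _; exact: avg_ge0.
  rewrite (integral_avg (midx (i + k)) (v_gt0 (i + k)) (mu_cell (i + k)))//.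
  by rewrite (_ : 2%:E = 1 + 1)// ge0_muleDl// mul1e.
have step k : \int[mu]_(z in Q) (psi z * rem k z)%:E =
    \int[mu]_(z in Q) (psi z * D (i + k) g z)%:E + \int[mu]_(z in Q) (psi z * rem k.+1 z)%:E.
  have Di := integrable_mdiff midx v_gt0 mu_cell gi (i + k).
  rewrite -integralD//; [|exact: mulI|exact: mulI].
  apply: eq_integral => z _; rewrite -EFinD -mulrDr; congr (_ * _)%:E.
  by rewrite /rem /mdiff addnS; ring.
have D_le k : `|\int[mu]_(z in Q) (psi z * D (i + k) g z)%:E| <=
    (W * v i)%:E * ((theta ^+ k)%:E * A i (fun z => `|D (i + k) g z|%:E) x).
  have Di := integrable_mdiff midx v_gt0 mu_cell gi (i + k).
  have D0 := integral_mdiff_cell midx v_gt0 mu_cell idxS gi (i + k).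
  apply: (le_trans (integral_mul_oscillation (midx (i + k)) mQ (sQ k) mpsi (Wt k) psiM (osc k) Di D0)).
  rewrite (@integral_cell _ _ _ mu (idx i) (v i) (v_gt0 i)).
  rewrite !muleA -!EFinM le_eqVlt; apply/orP; left; apply/eqP; congr (_%:E * _); ring.
have D0 k : 0 <= (theta ^+ k)%:E * A i (fun z => `|D (i + k) g z|%:E) x.
  by rewrite mule_ge0 ?avg_ge0// lee_fin exprn_ge0// ltW.
have partial k : `|\int[mu]_(z in Q) (psi z * rem 0%N z)%:E| <=
    (W * v i)%:E * (\sum_(0 <= l < k) (theta ^+ l)%:E * A i (fun z => `|D (i + l) g z|%:E) x)
    + (W * theta ^+ k)%:E * (2%:E * \int[mu]_x `|g x|%:E).
  have Wv : 0 <= (W * v i)%:E by rewrite lee_fin mulr_ge0// ltW.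
  apply: (@le_trans _ _ ((W * v i)%:E *
    (\sum_(0 <= l < k) (theta ^+ l)%:E * A i (fun z => `|D (i + l) g z|%:E) x) +
    `|\int[mu]_(z in Q) (psi z * rem k z)%:E|)); last exact: leeD2l (rem_le k).
  elim: k => [|k IH]; first by rewrite big_geq// mule0 add0e.
  apply: (le_trans IH); rewrite big_nat_recr//= ge0_muleDr//; last exact: sume_ge0.
  rewrite -addeA; apply: leeD2l; rewrite step.
  by apply: (le_trans (lee_abs_add _ _)); apply: leeD2r; exact: D_le.
(* Subtracting the value of [E i g], constant on [Q], changes nothing as [psi] integrates to 0 over
   [Q]. *)
have -> : \int[mu]_(z in Q) (psi z * g z)%:E = \int[mu]_(z in Q) (psi z * rem 0%N z)%:E.
  have ci : mu.-integrable Q (fun z => (psi z * E i g x)%:E).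
    have psiI : mu.-integrable Q (EFin \o psi).
      apply: (@le_integrable _ _ _ mu _ mQ _ (fun=> M%:E)).
      - by apply/measurable_EFinP; exact: measurable_funTS.
      - by move=> z _ /=; rewrite lee_fin (le_trans (psiM z))// ler_norm.
      - apply/integrableP; split=> //.
        by rewrite integral_cst// mu_cell -EFinM ltry.
    have := integrableZl mQ (E i g x) psiI.
    by apply: eq_integrable => // z _ /=; rewrite -EFinM mulrC.
  have -> : \int[mu]_(z in Q) (psi z * g z)%:E =
      \int[mu]_(z in Q) (psi z * rem 0%N z)%:E + \int[mu]_(z in Q) (psi z * E i g x)%:E.
    rewrite -integralD//; last exact: mulI.
    apply: eq_integral => z; rewrite inE => zQ; rewrite -EFinD -mulrDr; congr (_ * _)%:E.
    by rewrite /rem addn0 (cellwise_cond_exp mu (v i) g zQ) subrK.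
  have psiI : mu.-integrable Q (EFin \o psi).
    apply: (@le_integrable _ _ _ mu _ mQ _ (fun=> M%:E)).
    - by apply/measurable_EFinP; exact: measurable_funTS.
    - by move=> z _ /=; rewrite lee_fin (le_trans (psiM z))// ler_norm.
    - apply/integrableP; split=> //.
      by rewrite integral_cst// mu_cell -EFinM ltry.
  rewrite (_ : \int[mu]_(z in Q) (psi z * E i g x)%:E = 0) ?adde0//.
  under eq_integral do rewrite mulrC EFinM.
  by rewrite integralZl//= psi0 mule0.
(* The partial estimate holds for every number of levels; that number is now chosen so that the
   remainder is below [e]. *)
apply/lee_addgt0Pr => e e0.
pose c := fine (\int[mu]_x `|g x|%:E).
have cE : \int[mu]_x `|g x|%:E = c%:E by rewrite fineK// ge0_fin_numE.
have c0 : (0 <= c)%R by rewrite fine_ge0.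
have [k hk] : exists k, (W * theta ^+ k * (2 * c) <= e)%R.
  have := @cvg_expr R theta; rewrite gtr0_norm// => /(_ th1) /cvgrPdist_le.
  have d0 : (0 < e / (W * (2 * c) + 1))%R by rewrite divr_gt0// ltr_wpDl// !mulr_ge0.
  move=> /(_ _ d0) [k _ /(_ k (leqnn k))]; rewrite /= sub0r normrN => hk; exists k.
  rewrite mulrAC; apply: (@le_trans _ _ ((W * (2 * c) + 1) * theta ^+ k)%R).
    by apply: ler_wpM2r; rewrite ?exprn_ge0 ?lerDl// ltW.
  rewrite mulrC -ler_pdivlMr ?ltr_wpDl ?mulr_ge0//.
  by apply: le_trans hk; exact: ler_norm.
apply: (le_trans (partial k)); apply: leeD; last by rewrite cE -!EFinM lee_fin.
apply: lee_wpmul2l; first by rewrite lee_fin mulr_ge0// ltW.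
exact: (@partial_sum_le_nneseries _
  (fun l => (theta ^+ l)%:E * A i (fun z => `|D (i + l) g z|%:E) x)).
Qed.

End oscillation.

(** * Shifted triadic grids *)

Section grid.
Variables (R : realType) (n : nat).

Lemma measurable_borel_box (A : 'I_n -> set R) : (forall j, measurable (A j)) ->
  measurable ([set z | forall j, A j (borelRn_coord j z)] : set (borelRn R n)).
Proof.
move=> mA.
have -> : [set z : borelRn R n | forall i, A i (borelRn_coord i z)] =
    \bigcap_(i in [set: 'I_n]) (@borelRn_coord R n i @^-1` A i).
  by apply/seteqP; split => z /= h i; [move=> _; exact: (h i)|exact: (h i I)].
apply: fin_bigcap_measurable => // i _; rewrite -[X in measurable X]setTI.
by apply: measurable_borelRn_coord => //; exact: mA.
Qed.

(* [tau] shifts the grid of mesh [h] by half a mesh in the selected directions. *)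
Definition grid_floor (tau : {ffun 'I_n -> bool}) (h : R) (z : 'rV[R]_n) (j : 'I_n) : int :=
  Num.floor (h^-1 * z ord0 j - (tau j)%:R / 2)%R.

(** [pickle] numbers the integer vectors, which turns the grid into a partition indexed by [nat]. *)
Definition grid_index tau h z : nat := pickle [ffun j => grid_floor tau h z j].

Lemma grid_indexP tau h z x : grid_index tau h z = grid_index tau h x <->
  forall j, grid_floor tau h z j = grid_floor tau h x j.
Proof.
split=> [|zx]; last by rewrite /grid_index; congr pickle; apply/ffunP => j; rewrite !ffunE.
by move=> /(pcan_inj pickleK) /ffunP zx j; have := zx j; rewrite !ffunE.
Qed.

(** An integer [q] is at most [(u - m) / 3] exactly when the integer [q * 3 + m] is at most [u], and
    integers below [u] are seen by its floor. *)
Lemma floor_shift_div (y y' : R) (m : int) : Num.floor y = Num.floor y' ->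
  Num.floor ((y - m%:~R) / 3)%R = Num.floor ((y' - m%:~R) / 3)%R.
Proof.
move=> yy'.
have key (u u' : R) : Num.floor u = Num.floor u' ->
    (Num.floor ((u - m%:~R) / 3) <= Num.floor ((u' - m%:~R) / 3))%R.
  move=> uu'; rewrite floor_ge_int ler_pdivlMr// lerBrDr.
  set q := Num.floor ((u - m%:~R) / 3)%R.
  have -> : (q%:~R * 3 + m%:~R = (q * 3 + m)%:~R :> R)%R by rewrite rmorphD rmorphM.
  rewrite -floor_ge_int -uu' floor_ge_int rmorphD rmorphM/=.
  by rewrite -lerBrDr -ler_pdivlMr// floor_le.
by apply/eqP; rewrite eq_le !key.
Qed.

Lemma grid_index_refine tau rho i z x : (0 < rho)%R ->
  grid_index tau (rho / 3 ^+ i.+1) z = grid_index tau (rho / 3 ^+ i.+1) x ->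
  grid_index tau (rho / 3 ^+ i) z = grid_index tau (rho / 3 ^+ i) x.
Proof.
move=> rho0 /grid_indexP zx; apply/grid_indexP => j.
(* Three half meshes are one half mesh plus a whole one: the fine shift differs from the tripled
   coarse shift by the integer [tau j]. *)
have e y : ((rho / 3 ^+ i)^-1 * y - (tau j)%:R / 2 =
    ((rho / 3 ^+ i.+1)^-1 * y - (tau j)%:R / 2 - (tau j)%:R%:~R) / 3 :> R)%R.
  have t0 : (3 ^+ i != 0 :> R)%R by rewrite expf_neq0.
  rewrite exprS; case: (tau j) => /=; field; rewrite t0 gt_eqF//.
by rewrite /grid_floor !e; apply: floor_shift_div; exact: zx.
Qed.

Section mesh.
Variables (tau : {ffun 'I_n -> bool}) (h : R).
Hypothesis h0 : (0 < h)%R.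

Let lo (x : 'rV[R]_n) j : R := (h * ((grid_floor tau h x j)%:~R + (tau j)%:R / 2))%R.

Lemma grid_cellE (x : 'rV[R]_n) : cell (grid_index tau h) x =
  [set z | forall j, `[lo x j, (lo x j + h)%R[%classic (z ord0 j)].
Proof.
apply/seteqP; split => z /=.
  move=> /grid_indexP zx j; rewrite in_itv/= /lo -zx.
  have /andP[] := floor_itv (h^-1 * z ord0 j - (tau j)%:R / 2)%R.
  rewrite -/(grid_floor tau h z j) lerBrDr ltrBlDr intrD => l1 l2.
  rewrite mulrC -ler_pdivlMr// (mulrC (z _ _)) l1/=.
  have -> : (((grid_floor tau h z j)%:~R + (tau j)%:R / 2) * h + h =
    ((grid_floor tau h z j)%:~R + 1 + (tau j)%:R / 2) * h :> R)%R by ring.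
  by rewrite -ltr_pdivrMr// mulrC.
move=> zx; apply/grid_indexP => j; have := zx j; rewrite in_itv/= /lo => /andP[l1 l2].
apply: floor_def; rewrite lerBrDr ltrBlDr intrD.
apply/andP; split.
  by rewrite [leRHS]mulrC ler_pdivlMr// mulrC.
rewrite [ltLHS]mulrC ltr_pdivrMr//; apply: lt_le_trans l2 _.
by rewrite le_eqVlt; apply/orP; left; apply/eqP; ring.
Qed.

Lemma measurable_grid_cell x :
  measurable (cell (grid_index tau h) x : set (borelRn R n)).
Proof.
rewrite grid_cellE.
by apply: (@measurable_borel_box (fun j => `[lo x j, (lo x j + h)%R[%classic)).
Qed.

Lemma measurable_grid_fibre k :
  measurable (grid_index tau h @^-1` [set k] : set (borelRn R n)).
Proof.
have [->|[x ->]] := fibre_cell (grid_index tau h : borelRn R n -> nat) k => //.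
exact: measurable_grid_cell.
Qed.

Lemma borel_lebesgue_grid_cell (x : 'rV[R]_n) :
  borel_lebesgue (cell (grid_index tau h) x : set (borelRn R n)) = (h ^+ n)%:E.
Proof.
rewrite grid_cellE.
rewrite (@borel_lebesgue_box R n (fun j => `[lo x j, (lo x j + h)%R[%classic))//.
rewrite (eq_bigr (fun=> h%:E)); last first.
  by move=> j _; rewrite lebesgue_measure_itv/= lte_fin ltrDl h0 -EFinB addrAC subrr add0r.
by rewrite prodEFin prodr_const card_ord.
Qed.

Lemma grid_cell_dist (x z : 'rV[R]_n) j :
  grid_index tau h z = grid_index tau h x -> (`|z ord0 j - x ord0 j| <= h)%R.
Proof.
move=> zx.
have : cell (grid_index tau h) x z by [].
have : cell (grid_index tau h) x x by [].
rewrite grid_cellE /= => /(_ j) + /(_ j); rewrite !in_itv/= => /andP[a1 a2] /andP[b1 b2].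
by rewrite ler_norml; apply/andP; split; lra.
Qed.

End mesh.

(* Of two grids shifted by half a mesh, one has no wall within a quarter mesh. *)
Lemma grid_cover (h : R) (x : 'rV[R]_n) : (0 < h)%R -> exists tau,
  forall z : 'rV[R]_n, (forall j, `|z ord0 j - x ord0 j| < h / 4)%R ->
    grid_index tau h z = grid_index tau h x.
Proof.
move=> h0.
have one (a : R) : exists b : bool, forall u : R, (`|u - a| < 4^-1)%R ->
    Num.floor (u - b%:R / 2)%R = Num.floor (a - b%:R / 2)%R.
  have /andP[k1 k2] := floor_itv a; set k := Num.floor a in k1 k2.
  have in_ (m : int) (b : bool) : (m%:~R + 4^-1 <= a - b%:R / 2 < m%:~R + 3 / 4)%R ->
      forall u : R, (`|u - a| < 4^-1)%R ->
      Num.floor (u - b%:R / 2)%R = Num.floor (a - b%:R / 2)%R.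
    move=> /andP[m1 m2] u; rewrite ltr_norml => /andP[u1 u2].
    rewrite (@floor_def _ _ m) ?(@floor_def _ _ m)// intrD; apply/andP; split; lra.
  rewrite intrD in k2.
  (* In the middle half of the unit cell the unshifted grid is safe; in the outer quarters, shifting
     by one half moves the point to the middle, and in the lower quarter the floor drops to
     [k - 1]. *)
  have [a1|a1] := ltP a (k%:~R + 4^-1)%R.
    exists true; apply: (in_ (k - 1)%R); rewrite intrD /=.
    have -> : ((- 1)%:~R = -1 :> R)%R by [].
    by apply/andP; split; lra.
  have [a2|a2] := ltP a (k%:~R + 3 / 4)%R.
    by exists false; apply: (in_ k) => /=; apply/andP; split; lra.
  by exists true; apply: (in_ k) => /=; apply/andP; split; lra.
pose tau := [ffun j => projT1 (cid (one (h^-1 * x ord0 j)%R))] : {ffun 'I_n -> bool}.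
exists tau => z zx; apply/grid_indexP => j; rewrite /grid_floor ffunE.
case: cid => b /= /(_ (h^-1 * z ord0 j)%R); apply.
rewrite -mulrBr normrM gtr0_norm ?invr_gt0// mulrC ltr_pdivrMr// mulrC.
exact: zx.
Qed.

End grid.

(** * Lebesgue measure under reflection and dilation *)

Section affine.
Variable R : realType.

Definition reflect_dilate1 (y t s : R) : R := (t^-1 * (y - s))%R.

Lemma measurable_reflect_dilate1 (y t : R) :
  measurable_fun setT (reflect_dilate1 y t : measurableTypeR R -> measurableTypeR R).
Proof. by apply: measurable_funM => //; exact: measurable_funB. Qed.

(** The pushforward rescaled by [t^-1] agrees with Lebesgue measure on half-open intervals, and
    uniqueness extends this to Borel sets. *)
Lemma lebesgue_reflect_dilate1 (y t : R) (A : set (measurableTypeR R)) : (0 < t)%R ->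
  measurable A ->
  lebesgue_measure (reflect_dilate1 y t @^-1` A) = (t%:E * lebesgue_measure A).
Proof.
move=> t0 mA.
have mT := measurable_reflect_dilate1 y t.
have ti0 : (0 <= t^-1)%R by rewrite invr_ge0 ltW.
pose m := mscale (NngNum ti0)
  (measure_function_pushforward__canonical__measure_function_Measure (@lebesgue_measure R) mT).
suff -> : lebesgue_measure A = m A.
  by rewrite /m /mscale /= muleA -EFinM mulfV ?gt_eqF// mul1e.
apply: (@lebesgue_measure_unique R m) mA => X [[a b] _ <-] /=.
rewrite [RHS](_ : _ = (t^-1)%:E *
  lebesgue_measure (reflect_dilate1 y t @^-1` `]a, b]%classic))//.
have -> : reflect_dilate1 y t @^-1` `]a, b] = `[(y - t * b)%R, (y - t * a)%R[%classic.
  apply/seteqP; split => s /=; rewrite /reflect_dilate1 !in_itv/= (mulrC t^-1%R) ltr_pdivlMr// ler_pdivrMr//.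
    by move=> /andP[? ?]; apply/andP; split; lra.
  by move=> /andP[? ?]; apply/andP; split; lra.
rewrite !lebesgue_measure_itv/= !lte_fin.
have -> : (y - t * b < y - t * a)%R = (a < b)%R.
  by rewrite ltrD2l ltrN2 ltr_pM2l.
case: ifPn => _; last by rewrite mule0.
rewrite -!EFinB -EFinM; congr EFin.
have -> : (y - t * a - (y - t * b) = t * (b - a))%R by ring.
by rewrite mulrA mulVf ?gt_eqF// mul1r.
Qed.

Definition reflect_dilate n (y : 'rV[R]_n) (t : R) (z : borelRn R n) : borelRn R n :=
  \row_j reflect_dilate1 (y ord0 j) t (borelRn_coord j z).

Lemma measurable_reflect_dilate n (y : 'rV[R]_n) t :
  measurable_fun setT (reflect_dilate y t).
Proof.
apply/measurable_fun_borelRnP => j.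
rewrite (_ : _ \o _ = reflect_dilate1 (y ord0 j) t \o @borelRn_coord R n j); last first.
  by apply/funext => z; rewrite /= /borelRn_coord mxE.
by apply: measurableT_comp; [exact: measurable_reflect_dilate1|exact: measurable_borelRn_coord].
Qed.

(** Induction along the iterated product: sections in the last coordinate give one factor [t], and a
    change of variables by the map of lower dimension gives the remaining [t ^+ n]. *)
Lemma borel_lebesgue_reflect_dilate n (y : 'rV[R]_n) (t : R) (A : set (borelRn R n)) :
  (0 < t)%R -> measurable A ->
  borel_lebesgue (reflect_dilate y t @^-1` A) = (t ^+ n)%:E * borel_lebesgue A.
Proof.
move=> t0; elim: n y A => [|n IH] y A mA.
  rewrite expr0 mul1e /= /dirac; congr (\1__ _)%:E.
  by apply/seteqP; split => z /=; congr (A _); apply/rowP => -[].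
pose y' : 'rV[R]_n := \row_j y ord0 (lift ord_max j).
have mS := @measurable_borelRn_snoc R n.
have mB : measurable (@borelRn_snoc R n @^-1` A) by rewrite -[X in measurable X]setTI; exact: mS.
set B := _ @^-1` A in mB.
have tn0 : (0 <= t ^+ n)%R by rewrite exprn_ge0// ltW.
have -> : borel_lebesgue (reflect_dilate y t @^-1` A) =
    \int[@borel_lebesgue R n]_p (t%:E * lebesgue_measure (xsection B (reflect_dilate y' t p))).
  rewrite /= /pushforward /product_measure1; apply: eq_integral => p _ /=.
  rewrite -(lebesgue_reflect_dilate1 (y ord0 ord_max) t0); last exact: measurable_xsection.
  congr (lebesgue_measure _); apply/seteqP; split => s; rewrite /xsection /= !inE /=;
  congr (A _); apply/rowP => j; rewrite !mxE borelRn_coord_snoc;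
  by case: unliftP => [i ->|->] /=; rewrite ?/borelRn_coord ?mxE.
have mX : measurable_fun setT (fun p => lebesgue_measure (xsection B p)).
  exact: (measurable_fun_xsection (@lebesgue_measure R)).
rewrite ge0_integralZl//; first last.
- by rewrite lee_fin ltW.
- by apply: (measurableT_comp mX); exact: measurable_reflect_dilate.
rewrite exprS EFinM -muleA; congr (_ * _).
pose T : {mfun borelRn R n >-> borelRn R n} :=
  HB.pack (reflect_dilate y' t)
   (isMeasurableFun.Build _ _ _ _ _ (measurable_reflect_dilate y' t)).
transitivity (\int[pushforward (@borel_lebesgue R n) T]_p lebesgue_measure (xsection B p)).
  by rewrite ge0_integral_pushforward.
transitivity (\int[mscale (NngNum tn0) (@borel_lebesgue R n)]_p lebesgue_measure (xsection B p)).
  by apply: eq_measure_integral => X mX' _; exact: (IH y' X mX').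
by rewrite ge0_integral_mscale.
Qed.

End affine.

(** * Euclidean balls and Lebesgue measure *)

Section euclid.
Variables (R : realType) (n : nat).
Implicit Types x y z : Rn R n.

Lemma cauchy_schwarz_ord (a b : 'I_n -> R) :
  (\sum_i a i * b i <= Num.sqrt (\sum_i a i ^+ 2) * Num.sqrt (\sum_i b i ^+ 2))%R.
Proof.
pose e (c : 'I_n -> R) k := if insub k is Some i then c i else 0%R.
have eE (c : 'I_n -> R) (g : R -> R) : (\sum_i g (c i) = \sum_(0 <= k < n) g (e c k))%R.
  by rewrite big_mkord; apply: eq_bigr => i _; rewrite /e valK.
have H := @cauchy_schwarz_sum R n (e a) (e b) _ _
  (sqrtr_ge0 (\sum_i a i ^+ 2)) (sqrtr_ge0 (\sum_i b i ^+ 2)).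
apply: le_trans (H _ _).
- rewrite big_mkord le_eqVlt; apply/orP; left; apply/eqP.
  by apply: eq_bigr => i _; rewrite /e valK.
- rewrite sqr_sqrtr; last by apply: sumr_ge0 => i _; exact: sqr_ge0.
  by rewrite (eE a (fun u => u ^+ 2)%R).
- rewrite sqr_sqrtr; last by apply: sumr_ge0 => i _; exact: sqr_ge0.
  by rewrite (eE b (fun u => u ^+ 2)%R).
Qed.

Lemma enorm_ge0 x : (0 <= enorm x)%R.
Proof. exact: sqrtr_ge0. Qed.

Lemma sqr_enorm x : (enorm x ^+ 2 = \sum_i ((x : 'rV[R]_n) 0%R i) ^+ 2)%R.
Proof. by rewrite sqr_sqrtr//; apply: sumr_ge0 => i _; exact: sqr_ge0. Qed.

Lemma enormD x y : (enorm (x + y) <= enorm x + enorm y)%R.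
Proof.
rewrite -ler_sqr ?nnegrE ?addr_ge0 ?enorm_ge0// sqr_enorm.
rewrite (eq_bigr (fun i => ((x : 'rV[R]_n) 0 i) ^+ 2 + ((y : 'rV[R]_n) 0 i) ^+ 2 +
   2 * ((x : 'rV[R]_n) 0 i * (y : 'rV[R]_n) 0 i))%R); last first.
  by move=> i _; rewrite mxE; ring.
rewrite !big_split/= -mulr_sumr -!sqr_enorm.
have := cauchy_schwarz_ord (fun i => (x : 'rV[R]_n) 0%R i) (fun i => (y : 'rV[R]_n) 0%R i).
rewrite -/(enorm x) -/(enorm y) => H.
rewrite sqrrD -mulr_natl; lra.
Qed.

Lemma enormZ (c : R) x : enorm (c *: x : Rn R n) = (`|c| * enorm x)%R.
Proof.
rewrite /enorm -sqrtr_sqr -sqrtrM ?sqr_ge0// mulr_sumr; congr Num.sqrt.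
by apply: eq_bigr => i _; rewrite mxE exprMn.
Qed.

Lemma enormN x : enorm (- x : Rn R n)%R = enorm x.
Proof. by rewrite -scaleN1r enormZ normrN1 mul1r. Qed.

Lemma enorm_distC x y : (enorm (x - y) = enorm (y - x))%R.
Proof. by rewrite -enormN opprB. Qed.

Lemma enorm_dist_triangle x y z : (enorm (x - z) <= enorm (x - y) + enorm (y - z))%R.
Proof. by rewrite -[(x - z)%R](subrKA y) enormD. Qed.

Lemma coord_le_enorm x j : (`|(x : 'rV[R]_n) ord0 j| <= enorm x)%R.
Proof.
rewrite -ler_sqr ?nnegrE ?enorm_ge0// real_normK ?num_real// sqr_enorm.
by rewrite (bigD1 j)//= lerDl sumr_ge0// => i _; exact: sqr_ge0.
Qed.

Lemma enorm_le_coords x (s : R) : (0 <= s)%R ->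
  (forall j, `|(x : 'rV[R]_n) ord0 j| <= s)%R -> (enorm x <= n%:R * s)%R.
Proof.
move=> s0 xs; rewrite -ler_sqr ?nnegrE ?enorm_ge0 ?mulr_ge0// sqr_enorm.
apply: (@le_trans _ _ (\sum_(i < n) s ^+ 2)%R).
  apply: ler_sum => i _; rewrite -[leLHS]real_normK ?num_real//.
  by rewrite ler_sqr ?nnegrE.
rewrite sumr_const card_ord -[leLHS]mulr_natl exprMn; apply: ler_wpM2r; first exact: sqr_ge0.
by rewrite -natrX ler_nat; case: (n) => // k; rewrite expnS expn1 leq_pmulr.
Qed.

Lemma enorm0_lt x (s : R) : (0 < n)%N -> (0 < s)%R ->
  (forall j, `|(x : 'rV[R]_n) ord0 j| < s)%R -> (enorm x < n%:R * s)%R.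
Proof.
move=> n0 s0 xs; have ns0 : (0 <= n%:R * s)%R by rewrite mulr_ge0// ltW.
rewrite -ltr_sqr ?nnegrE ?enorm_ge0// sqr_enorm.
apply: (@lt_le_trans _ _ (\sum_(i < n) s ^+ 2)%R); last first.
  rewrite sumr_const card_ord -[leLHS]mulr_natl exprMn; apply: ler_wpM2r; first exact: sqr_ge0.
  by rewrite -natrX ler_nat expnS expn1 leq_pmulr.
apply: ltr_sum.
  by apply/hasP; exists (Ordinal n0) => //; rewrite mem_index_enum.
move=> i _; rewrite -[ltLHS]real_normK ?num_real//.
by rewrite ltr_sqr ?nnegrE// ltW.
Qed.

Lemma measurable_borel_enorm (y : Rn R n) :
  measurable_fun setT (fun z : borelRn R n => enorm (y - z : Rn R n)%R).
Proof.
apply: (@measurableT_comp _ _ _ _ _ _ (@Num.sqrt R)) => //.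
  by apply: continuous_measurable_fun; exact: sqrt_continuous.
apply: measurable_sum => j; apply: measurable_funX.
under eq_fun do rewrite !mxE.
by apply: measurable_funB => //; exact: (measurable_borelRn_coord j).
Qed.

Lemma leb_measurable (A : set (borelRn R n)) : measurable A -> measurable (A : set (Rn R n)).
Proof. by move=> /leb_borel []. Qed.

Lemma measurable_of_borel d (U : measurableType d) (f : borelRn R n -> U) :
  measurable_fun setT f -> measurable_fun setT (f : Rn R n -> U).
Proof.
move=> mf _ Y mY; rewrite setTI; apply: leb_measurable.
by rewrite -[X in measurable X]setTI; exact: mf.
Qed.

Lemma eball_borel y (r : R) : measurable (eball y r : set (borelRn R n)).
Proof.
have := measurable_borel_enorm y measurableT (measurable_itv `]-oo, r[).
by rewrite setTI; congr measurable; apply/seteqP; split => z; rewrite /= in_itv.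
Qed.

Lemma measurable_eball y (r : R) : measurable (eball y r).
Proof. by apply: leb_measurable; exact: eball_borel. Qed.

Lemma leb_box (A : 'I_n -> set R) : (forall j, measurable (A j)) ->
  leb ([set z | forall j, A j ((z : 'rV[R]_n) ord0 j)] : set (Rn R n)) =
  \prod_(j < n) lebesgue_measure (A j).
Proof.
move=> mA; have [_ ->] := leb_borel (measurable_borel_box mA).
exact: borel_lebesgue_box.
Qed.

Lemma leb_cube_o y (s : R) : (0 < s)%R ->
  leb ([set z | forall j, `](y : 'rV[R]_n) ord0 j - s, (y : 'rV[R]_n) ord0 j + s[%classic
    ((z : 'rV[R]_n) ord0 j)]%R : set (Rn R n)) = ((2 * s) ^+ n)%:E.
Proof.
move=> s0; rewrite (@leb_box (fun j => `](y : 'rV[R]_n) ord0 j - s,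
  (y : 'rV[R]_n) ord0 j + s[%classic)%R)//.
rewrite (eq_bigr (fun=> (2 * s)%:E)) ?prodEFin ?prodr_const ?card_ord// => j _.
rewrite lebesgue_measure_itv/= lte_fin ifT; last by lra.
by rewrite -EFinB; congr EFin; ring.
Qed.

Lemma leb_eball_le y (r : R) : (0 < r)%R -> leb (eball y r) <= ((2 * r) ^+ n)%:E.
Proof.
move=> r0; rewrite -(leb_cube_o y r0); apply: le_measure; rewrite ?inE.
- exact: measurable_eball.
- apply: leb_measurable.
  exact: (@measurable_borel_box R n (fun j => `](y : 'rV[R]_n) ord0 j - r,
    (y : 'rV[R]_n) ord0 j + r[%classic)%R).
move=> z; rewrite /eball /= => yz j; rewrite in_itv/=.
have := le_lt_trans (coord_le_enorm _ j) yz; rewrite !mxE ltr_norml => /andP[? ?].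
by apply/andP; split; lra.
Qed.

Lemma leb_eball_ge y (r : R) : (0 < n)%N -> (0 < r)%R ->
  ((2 * (r / n%:R)) ^+ n)%:E <= leb (eball y r).
Proof.
move=> n0 r0; have s0 : (0 < r / n%:R)%R by rewrite divr_gt0// ltr0n.
rewrite -(leb_cube_o y s0); apply: le_measure; rewrite ?inE.
- apply: leb_measurable.
  exact: (@measurable_borel_box R n (fun j => `](y : 'rV[R]_n) ord0 j - r / n%:R,
    (y : 'rV[R]_n) ord0 j + r / n%:R[%classic)%R).
- exact: measurable_eball.
move=> z /= yz; rewrite /eball /=.
have -> : r = (n%:R * (r / n%:R))%R by rewrite mulrC divfK// pnatr_eq0 -lt0n.
apply: enorm0_lt => // j; have := yz j; rewrite in_itv/= !mxE ltr_norml => /andP[? ?].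
by apply/andP; split; lra.
Qed.

Lemma leb_eball_gt0 y (r : R) : (0 < n)%N -> (0 < r)%R -> 0 < leb (eball y r).
Proof.
move=> n0 r0; apply: lt_le_trans (leb_eball_ge y n0 r0).
by rewrite lte_fin exprn_gt0// mulr_gt0// divr_gt0// ltr0n.
Qed.

Lemma leb_eball_fin y (r : R) : (0 < r)%R -> leb (eball y r) \is a fin_num.
Proof.
move=> r0; rewrite ge0_fin_numE//; apply: le_lt_trans (leb_eball_le y r0) _.
exact: ltry.
Qed.

Lemma sub_eball x y (r s : R) : (enorm (x - y) + r <= s)%R -> eball y r `<=` eball x s.
Proof.
move=> rs z; rewrite /eball /= => yz.
by apply: le_lt_trans (enorm_dist_triangle x y z) _; lra.
Qed.

(** The Euclidean ball lies in a closed cube, compact as a product of segments. *)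
Lemma loc_integrable_eball (f : Rn R n -> R) y (r : R) : loc_integrable f ->
  \int[leb]_(x in eball y r) `|f x|%:E < +oo.
Proof.
move=> [mf fK].
pose K : set (Rn R n) := [set z | forall j, `[(y : 'rV[R]_n) ord0 j - r,
    (y : 'rV[R]_n) ord0 j + r]%classic ((z : 'rV[R]_n) ord0 j)]%R.
have cK : compact K.
  apply: (@rV_compact R n (fun j => `[(y : 'rV[R]_n) ord0 j - r,
    (y : 'rV[R]_n) ord0 j + r]%classic)%R) => j.
  exact: segment_compact.
apply: le_lt_trans (fK K cK); apply: ge0_subset_integral => //.
- exact: measurable_eball.
- apply: leb_measurable.
  exact: (@measurable_borel_box R n (fun j => `[(y : 'rV[R]_n) ord0 j - r,
    (y : 'rV[R]_n) ord0 j + r]%classic)%R).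
- by apply: measurable_funTS; apply/measurable_EFinP; apply: measurableT_comp.
move=> z yz j; rewrite /= in_itv/=.
have := le_lt_trans (coord_le_enorm _ j) yz; rewrite !mxE ltr_norml => /andP[? ?].
by apply/andP; split; lra.
Qed.

End euclid.

(** * Change of variables and measurability of Hölder functions *)

Section borel_integral.
Variables (R : realType) (n : nat).
Implicit Types x y z : Rn R n.

(** The identity from the completed space to the Borel space is measurable and pushes [leb] to
    [borel_lebesgue]; this brings in the change of variables, established for Borel sets. *)
Lemma integral_leb_borel (f : Rn R n -> \bar R) :
  measurable_fun setT (f : borelRn R n -> \bar R) -> (forall z, 0 <= f z) ->
  \int[leb]_z f z = \int[@borel_lebesgue R n]_z f z.
Proof.
move=> mf f0.
have mid : measurable_fun setT (id : Rn R n -> borelRn R n).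
  by move=> _ Y mY; rewrite setTI; exact: leb_measurable.
transitivity (\int[pushforward (@leb R n) (id : Rn R n -> borelRn R n)]_z f z).
  by rewrite (ge0_integral_pushforward mid).
by apply: eq_measure_integral => X mX _; have [_ e] := leb_borel mX; exact: e.
Qed.

Lemma integral_leb_reflect_dilate (f : Rn R n -> \bar R) y (t : R) : (0 < t)%R ->
  measurable_fun setT (f : borelRn R n -> \bar R) -> (forall z, 0 <= f z) ->
  \int[leb]_z f (t^-1 *: (y - z))%R = (t ^+ n)%:E * \int[leb]_z f z.
Proof.
move=> t0 mf f0.
have tn0 : (0 <= t ^+ n)%R by rewrite exprn_ge0// ltW.
have mT := @measurable_reflect_dilate R n y t.
have TE : (fun z : Rn R n => f (t^-1 *: (y - z))%R) = f \o reflect_dilate (y : 'rV[R]_n) t.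
  apply/funext => z; rewrite /=; congr f; apply/rowP => j.
  by rewrite !mxE /reflect_dilate1 /borelRn_coord.
rewrite TE integral_leb_borel//; last exact: measurableT_comp mf mT.
rewrite -(ge0_integral_pushforward mT (@borel_lebesgue R n) measurableT)//.
rewrite (integral_leb_borel mf f0) -(@ge0_integral_mscale _ _ _ _ _ _ (NngNum tn0))//.
apply: eq_measure_integral => X mX _.
exact: (borel_lebesgue_reflect_dilate (y : 'rV[R]_n) t0 mX).
Qed.

Lemma integral_reflect_dilate_eq0 (phi : Rn R n -> R) y (t : R) : (0 < t)%R ->
  measurable_fun setT (phi : borelRn R n -> R) ->
  \int[leb]_z (phi z)%:E = 0 -> \int[leb]_z (phi (t^-1 *: (y - z))%R)%:E = 0.
Proof.
move=> t0 mphi.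
have mphie : measurable_fun setT ((EFin \o phi) : borelRn R n -> \bar R) by exact/measurable_EFinP.
have e1 : (fun z : Rn R n => (phi (t^-1 *: (y - z))%R)%:E)^\+ =
   (fun z => ((EFin \o phi)^\+ (t^-1 *: (y - z))%R)).
  by apply/funext => z; rewrite ?funeposE ?funenegE.
have e2 : (fun z : Rn R n => (phi (t^-1 *: (y - z))%R)%:E)^\- =
   (fun z => ((EFin \o phi)^\- (t^-1 *: (y - z))%R)).
  by apply/funext => z; rewrite ?funeposE ?funenegE.
rewrite integralE [X in _ -> X = _]integralE e1 e2.
rewrite (@integral_leb_reflect_dilate (EFin \o phi)^\+)//; last exact: measurable_funepos.
rewrite (@integral_leb_reflect_dilate (EFin \o phi)^\-)//; last exact: measurable_funeneg.
rewrite (_ : (fun z => (phi z)%:E) = EFin \o phi)//.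
set a := \int[leb]_z _; set b := \int[leb]_z _ => ab.
have b0 : 0 <= b by exact: integral_ge0.
(* A difference with [+oo] subtracted is [-oo], even from [+oo], so the value 0 forces both parts to
   be finite. *)
have bfin : b \is a fin_num.
  by rewrite ge0_fin_numE// ltey; apply/eqP => boo; move: ab; rewrite boo addeNy.
have afin : a \is a fin_num.
  by rewrite -(subeK a bfin) ab add0e.
by rewrite -muleBr// ?ab ?mule0// fin_num_adde_defl// fin_numN.
Qed.

(** The function is the pointwise limit of its samples on grids of mesh 3^-i, and these are Borel
    because grid cells are. *)
Lemma hoelder_measurable (g : R) (phi : Rn R n -> R) : (0 < g)%R ->
  (forall x z, `|phi x - phi z| <= enorm (x - z) `^ g)%R ->
  measurable_fun setT (phi : borelRn R n -> R).
Proof.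
move=> g0 hphi.
pose tau := [ffun j : 'I_n => false]; pose h i : R := (1 / 3 ^+ i)%R.
have h0 i : (0 < h i)%R by rewrite divr_gt0// exprn_gt0.
have S i := cell_sampling (grid_index tau (h i)) (phi : 'rV[R]_n -> R).
pose b i := projT1 (cid2 (S i)).
have bc i : cellwise (grid_index tau (h i)) (b i) by rewrite /b; case: cid2.
have bE i x : exists2 z, grid_index tau (h i) z = grid_index tau (h i) x & b i x = phi z.
  by rewrite /b; case: cid2.
apply: (@measurable_fun_cvg _ _ _ setT (fun i => b i : borelRn R n -> R)).
  by move=> i; apply: (cellwise_measurable (measurable_grid_fibre tau (h0 i))).
move=> x _; apply/cvgrPdist_le => /= e e0.
pose del := (e `^ g^-1)%R.
have del0 : (0 < del)%R by exact: powR_gt0.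
have delE : (del `^ g = e)%R.
  by rewrite /del -powRrM mulVf ?gt_eqF// powRr1// ltW.
have [M hM] : exists M : nat, (n%:R / del < M%:R)%R.
  by exists (Num.bound (n%:R / del)); apply: archi_boundP; rewrite divr_ge0// ltW.
near=> i.
have [z zx ->] := bE i x.
apply: le_trans (hphi x z) _; rewrite -delE.
apply: ge0_ler_powR; rewrite ?nnegrE ?enorm_ge0 ?(ltW g0) ?(ltW del0)//.
apply: le_trans (enorm_le_coords (ltW (h0 i)) _) _.
  move=> j; rewrite !mxE distrC; exact: (grid_cell_dist (h0 i) j zx).
rewrite /h div1r ler_pdivrMr ?exprn_gt0// mulrC -ler_pdivrMr//.
apply: le_trans (ltW hM) _.
apply: (@le_trans _ _ i%:R).
  by rewrite ler_nat; near: i; exact: nbhs_infty_ge.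
by rewrite -natrX ler_nat ltnW// ltn_expl.
Unshelve. all: by end_near.
Qed.

End borel_integral.

(** * A1 weights *)

Section A1_weights.
Variables (R : realType) (n : nat).
Hypothesis n0 : (0 < n)%N.
Variable w : Rn R n -> R.
Hypothesis ww : weight w.
Implicit Types x y z : Rn R n.

Lemma weight_gt0 x : (0 < w x)%R.
Proof. by case: ww. Qed.

Lemma measurable_weight : measurable_fun setT w.
Proof. by case: ww => _ []. Qed.

Lemma weight_ge0 x : 0 <= (w x)%:E.
Proof. by rewrite lee_fin ltW// weight_gt0. Qed.

Lemma measurable_weightE : measurable_fun setT (EFin \o w).
Proof. by apply/measurable_EFinP; exact: measurable_weight. Qed.

Lemma wmeas_ge0 (E : set (Rn R n)) : 0 <= wmeas w E.
Proof. by apply: integral_ge0 => x _; exact: weight_ge0. Qed.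

Lemma le_wmeas (E F : set (Rn R n)) : E `<=` F -> wmeas w E <= wmeas w F.
Proof.
move=> EF; rewrite /wmeas integral_mkcond [leRHS]integral_mkcond.
apply: ge0_le_lower_integral => x _.
  by rewrite patchE; case: ifPn => // _; exact: weight_ge0.
rewrite !patchE; case: ifPn => [xE|_]; last by case: ifPn => // _; exact: weight_ge0.
by rewrite ifT//; rewrite !inE in xE *; exact: EF.
Qed.

Lemma wmeas_eball_lty y (r : R) : wmeas w (eball y r) < +oo.
Proof.
have [_ wi] := ww; apply: le_lt_trans (loc_integrable_eball y r wi).
apply: ge0_le_lower_integral => x _; first exact: weight_ge0.
by rewrite lee_fin ler_norm.
Qed.

Lemma wmeas_eball_gt0 y (r : R) : (0 < r)%R -> 0 < wmeas w (eball y r).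
Proof.
move=> r0; rewrite lt_neqAle wmeas_ge0 andbT eq_sym; apply/eqP => w0.
have mB := measurable_eball y r.
have : \int[leb]_(x in eball y r) `|(w x)%:E| = 0.
  rewrite -[RHS]w0; apply: eq_integral => x _.
  by rewrite gee0_abs// weight_ge0.
move/(ae_eq_integral_abs leb mB _).1 => H.
have /H [N [mN N0 sN]] : measurable_fun (eball y r) (EFin \o w).
  by apply: measurable_funTS; exact: measurable_weightE.
have : leb (eball y r) <= 0.
  rewrite -N0; apply: le_measure; rewrite ?inE// => x xB; apply: sN => /= /(_ xB) [] wx.
  by have := weight_gt0 x; rewrite wx ltxx.
by apply/negP; rewrite -ltNge; exact: leb_eball_gt0.
Qed.

Definition ball_weight y (r : R) : R := fine (wmeas w (eball y r)).

Lemma ball_weightE y (r : R) : (ball_weight y r)%:E = wmeas w (eball y r).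
Proof. by rewrite fineK// ge0_fin_numE ?wmeas_ge0// wmeas_eball_lty. Qed.

Lemma ball_weight_gt0 y (r : R) : (0 < r)%R -> (0 < ball_weight y r)%R.
Proof. by move=> r0; rewrite -lte_fin ball_weightE wmeas_eball_gt0. Qed.

(* Only these upper bounds by [w z] are used of the [A1] condition. *)
Definition A1_bound (C : R) := forall y (r : R), (0 < r)%R ->
  {ae leb, forall z, eball y r z -> wmeas w (eball y r) <= (C * r ^+ n)%:E * (w z)%:E}.

(** The volume of the ball is at most [(2 * r) ^+ n], which gives [2 ^+ n]; the other factor 2 pays
    for an essential infimum that may not be attained. *)
Lemma A1_boundP : A1 w -> exists2 C : R, (0 < C)%R & A1_bound C.
Proof.
move=> [_ [C C0 HC]]; exists (2 * C * 2 ^+ n)%R.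
  by rewrite !mulr_gt0// exprn_gt0.
move=> y r r0; have := HC y r r0; set a := leb _.
have a0 : 0 < a by exact: leb_eball_gt0.
have afin : a \is a fin_num by exact: leb_eball_fin.
rewrite -/(wmeas w (eball y r)) -ball_weightE; set V := ball_weight y r.
have V0 : (0 < V)%R by exact: ball_weight_gt0.
set S := ess_inf_on _ _.
pose a' := fine a.
have aE : a = a'%:E by rewrite fineK.
have a'0 : (0 < a')%R by rewrite -lte_fin -aE.
have ale : (a' <= (2 * r) ^+ n)%R by rewrite -lee_fin -aE; exact: leb_eball_le.
rewrite aE inver gt_eqF// -EFinM => HS.
(* Half of the bound given by A1, hence strictly below the supremum defining the essential infimum:
   some almost everywhere lower bound of [w] exceeds it. *)
pose m0 := (V / (2 * a' * C))%R.
have m0S : m0%:E < S.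
  have VS : (V / (a' * C))%:E <= S.
    rewrite -(@lee_pmul2l _ C%:E) ?lte_fin//.
    apply: le_trans HS; rewrite -EFinM lee_fin le_eqVlt; apply/orP; left; apply/eqP.
    by field; rewrite !gt_eqF.
  apply: lt_le_trans VS; rewrite lte_fin /m0 ltr_pM2l// ltf_pV2 ?posrE ?mulr_gt0//.
  by rewrite -mulrA ltr_pMl ?mulr_gt0// ltrDl.
have [m mae m0m] := ereal_sup_gt m0S.
apply: filterS mae => z /= mz yz.
have mw : (m0 <= w z)%R by rewrite -lee_fin; apply: le_trans (ltW m0m) (mz yz).
rewrite -EFinM lee_fin.
apply: (@le_trans _ _ (2 * a' * C * w z)%R).
  by rewrite mulrC -ler_pdivrMr// !mulr_gt0.
apply: ler_wpM2r; first by rewrite ltW// weight_gt0.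
have -> : (2 * C * 2 ^+ n * r ^+ n = 2 * ((2 * r) ^+ n) * C)%R by rewrite exprMn; ring.
by rewrite ler_pM2r// ler_pM2l.
Qed.

Section with_bound.
Variable C : R.
Hypothesis C0 : (0 < C)%R.
Hypothesis HC : A1_bound C.

Lemma A1_average y (r : R) (E : set (Rn R n)) (g : Rn R n -> \bar R) : (0 < r)%R ->
  measurable E -> E `<=` eball y r -> measurable_fun setT g -> (forall x, 0 <= g x) ->
  wmeas w (eball y r) * \int[leb]_(x in E) g x <=
  (C * r ^+ n)%:E * \int[leb]_(x in E) (g x * (w x)%:E).
Proof.
move=> r0 mE EB mg g0.
have mw := measurable_weightE.
have K0 : (0 <= C * r ^+ n)%R by rewrite mulr_ge0 ?exprn_ge0// ltW.
have V0 := wmeas_ge0 (eball y r).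
have mgE : measurable_fun E g by exact: measurable_funTS.
have mwE : measurable_fun E (EFin \o w) by exact: measurable_funTS.
have mgw : measurable_fun E (fun x => g x * (w x)%:E) by exact: emeasurable_funM.
have gw0 x : 0 <= g x * (w x)%:E by exact: mule_ge0 (g0 x) (weight_ge0 x).
rewrite -(ge0_integralZl _ mE mgE _ V0); last by move=> x _; exact: g0.
have K0e : 0 <= (C * r ^+ n)%:E by rewrite lee_fin.
rewrite -(ge0_integralZl _ mE mgw _ K0e); last by move=> x _; exact: gw0.
apply: (ae_ge0_le_integral mE).
- by move=> x _; exact: mule_ge0 V0 (g0 x).
- exact: measurable_funeM.
- by move=> x _; exact: mule_ge0 K0e (gw0 x).
- exact: measurable_funeM.
apply: filterS (HC y r0) => z /= Hz /EB /Hz hz.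
by rewrite (muleC (g z)) muleA; apply: lee_wpmul2r.
Qed.

(** The case [g = 1]: a part of a ball carries at least a fixed multiple of its proportional share
    of the weight. Doubling and reverse doubling both follow from it. *)
Lemma A1_subset y (r : R) (E : set (Rn R n)) : (0 < r)%R ->
  measurable E -> E `<=` eball y r ->
  wmeas w (eball y r) * leb E <= (C * r ^+ n)%:E * wmeas w E.
Proof.
move=> r0 mE EB.
have := @A1_average y r E (cst 1) r0 mE EB (measurable_cst _) (fun=> lee01).
rewrite integral_cst// mul1e => /le_trans; apply.
rewrite le_eqVlt; apply/orP; left; apply/eqP; congr (_ * _).
by apply: eq_integral => x _; rewrite mul1e.
Qed.

(** Compare with a cube inscribed in the small ball, of side [2 * (r / n%:R)]; the constant is [C]
    times the n-th power of the ratio of [3 * r] to this side. *)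
Lemma ball_weight_doubling y (r : R) : (0 < r)%R ->
  (ball_weight y (3 * r) <= C * (3 * n%:R / 2) ^+ n * ball_weight y r)%R.
Proof.
move=> r0; have r30 : (0 < 3 * r)%R by rewrite mulr_gt0.
have nn : (0 < n%:R :> R)%R by rewrite ltr0n.
have sub : eball y r `<=` eball y (3 * r).
  by apply: sub_eball; rewrite subrr -(scale0r (0 : Rn R n)) enormZ normr0 mul0r; lra.
have := A1_subset r30 (measurable_eball y r) sub.
rewrite -!ball_weightE => H.
have L := leb_eball_ge y n0 r0.
have : ((ball_weight y (3 * r))%:E * ((2 * (r / n%:R)) ^+ n)%:E <=
    (C * (3 * r) ^+ n)%:E * (ball_weight y r)%:E).
  apply: le_trans H; apply: lee_wpmul2l => //.
  by rewrite lee_fin ltW// ball_weight_gt0.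
rewrite -!EFinM lee_fin.
set e := (2 * (r / n%:R))%R.
have e0 : (0 < e)%R by rewrite mulr_gt0// divr_gt0.
have -> : (3 * r = e * (3 * n%:R / 2))%R.
  by rewrite /e; field; rewrite gt_eqF.
rewrite (exprMn _ e) => H2.
rewrite -(@ler_pM2r _ (e ^+ n)%R) ?exprn_gt0//.
by apply: le_trans H2 _; rewrite le_eqVlt; apply/orP; left; apply/eqP; ring.
Qed.

(** A lower bound for the fraction of the weight of a ball of radius [3 * r] carried by any ball of
    radius [r] inside it: the same cube, compared with [(3 * r) ^+ n], and the A1 constant. *)
Definition annulus_share : R := ((2 / (3 * n%:R)) ^+ n / C)%R.

Lemma annulus_share_gt0 : (0 < annulus_share)%R.
Proof. by rewrite divr_gt0// exprn_gt0// divr_gt0// mulr_gt0// ltr0n. Qed.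

(* A ball of radius [r] fits between the spheres of radii [r] and [3 r]. *)
Lemma ball_weight_reverse_doubling y (r : R) : (0 < r)%R ->
  (ball_weight y r <= (1 - annulus_share) * ball_weight y (3 * r))%R.
Proof.
move=> r0; have r30 : (0 < 3 * r)%R by rewrite mulr_gt0.
have nn : (0 < n%:R :> R)%R by rewrite ltr0n.
pose e : Rn R n := (\row_j (2 * r * (j == Ordinal n0)%:R))%R.
have ee : enorm e = (2 * r)%R.
  rewrite /enorm (bigD1 (Ordinal n0))//= big1; last first.
    by move=> j /negbTE j0; rewrite mxE j0 mulr0 expr0n.
  by rewrite mxE eqxx mulr1 addr0 sqrtr_sqr gtr0_norm// mulr_gt0.
pose x : Rn R n := (y + e)%R.
have yx : enorm (y - x)%R = (2 * r)%R by rewrite /x opprD addrA subrr sub0r enormN.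
have subE : eball x r `<=` eball y (3 * r) by apply: sub_eball; rewrite yx; lra.
have sub : eball y r `<=` eball y (3 * r).
  by apply: sub_eball; rewrite subrr -(scale0r (0 : Rn R n)) enormZ normr0 mul0r; lra.
have dis : [disjoint eball y r & eball x r].
  rewrite disj_set2E; apply/eqP; rewrite -subset0 => z [] /=.
  rewrite /eball /= => yz xz.
  have := enorm_dist_triangle y z x; rewrite yx (enorm_distC z x); lra.
have mw := measurable_weightE.
have H1 : wmeas w (eball y r) + wmeas w (eball x r) <= wmeas w (eball y (3 * r)).
  rewrite /wmeas -ge0_integral_setU//; first last.
  - by move=> z _; exact: weight_ge0.
  - exact: measurable_funTS.
  - exact: measurable_eball.
  - exact: measurable_eball.
  by apply: le_wmeas => z []; [exact: sub|exact: subE].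
have H2 := A1_subset r30 (measurable_eball x r) subE.
have H3 : ((ball_weight y (3 * r))%:E * ((2 * (r / n%:R)) ^+ n)%:E <=
    (C * (3 * r) ^+ n)%:E * (ball_weight x r)%:E).
  rewrite !ball_weightE; apply: le_trans H2; apply: lee_wpmul2l; first exact: wmeas_ge0.
  exact: leb_eball_ge.
move: H1 H3; rewrite -!ball_weightE -EFinD -!EFinM !lee_fin.
have -> : (2 * (r / n%:R) = (3 * r) * (2 / (3 * n%:R)))%R.
  by field; rewrite gt_eqF.
rewrite exprMn => H1 H3.
have H4 : (annulus_share * ball_weight y (3 * r) <= ball_weight x r)%R.
  rewrite /annulus_share mulrAC ler_pdivrMr//.
  rewrite -(@ler_pM2l _ ((3 * r) ^+ n)%R) ?exprn_gt0//.
  by apply: le_trans (le_trans _ H3) _; rewrite le_eqVlt; apply/orP; left; apply/eqP; ring.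
lra.
Qed.

(** Read off reverse doubling for one ball: both weights are positive, so the factor between them
    must be positive. *)
Lemma annulus_share_lt1 : (annulus_share < 1)%R.
Proof.
have := ball_weight_reverse_doubling (0%R : Rn R n) ltr01.
have := ball_weight_gt0 (0%R : Rn R n) ltr01.
have : (0 < ball_weight (0%R : Rn R n) (3 * 1))%R by apply: ball_weight_gt0; lra.
move: (ball_weight _ _) (ball_weight _ _) => a b b0 a0 H.
have : (0 < (1 - annulus_share) * b)%R by exact: lt_le_trans H.
by rewrite pmulr_lgt0// subr_gt0.
Qed.

Lemma ball_weight_pow y (r : R) l : (0 < r)%R ->
  (ball_weight y r <= (1 - annulus_share) ^+ l * ball_weight y (3 ^+ l * r))%R.
Proof.
move=> r0; elim: l => [|l IH]; first by rewrite !expr0 !mul1r.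
apply: le_trans IH _; rewrite exprSr -mulrA; apply: ler_wpM2l.
  by rewrite exprn_ge0// subr_ge0 ltW// annulus_share_lt1.
rewrite exprS -mulrA; apply: ball_weight_reverse_doubling.
by rewrite mulr_gt0// exprn_gt0.
Qed.

(** A cell lies in a ball of radius [2 * n%:R * h] about any of its points. The null set in the A1
    bound depends on the ball, so one centre is fixed in each cell and countably many null sets are
    united. *)
Lemma A1_grid tau (h : R) : (0 < h)%R ->
  {ae leb, forall z, avg leb (grid_index tau h : Rn R n -> nat) (h ^+ n) (EFin \o w) z <=
     (C * (2 * n%:R) ^+ n)%:E * (w z)%:E}.
Proof.
move=> h0; have nn : (0 < n%:R :> R)%R by rewrite ltr0n.
have hn0 : (0 < h ^+ n)%R by exact: exprn_gt0.
pose idx := grid_index tau h : Rn R n -> nat.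
pose P z := avg leb idx (h ^+ n) (EFin \o w) z <= (C * (2 * n%:R) ^+ n)%:E * (w z)%:E.
suff : {ae leb, forall z, forall k, idx z = k -> P z}.
  by apply: filterS => z /(_ _ erefl).
apply: (ae_foralln (P := fun k z => idx z = k -> P z)) => k.
have [k0|[x kx]] := fibre_cell idx k.
  apply: aeW => z zk; exfalso.
  by have : (idx @^-1` [set k]) z by []; rewrite k0.
have r0 : (0 < 2 * n%:R * h)%R by rewrite !mulr_gt0.
apply: filterS (HC x r0) => z Hz zk.
have zx : idx z = idx x by have : (idx @^-1` [set k]) z by []; rewrite kx.
have sub : cell idx z `<=` eball x (2 * n%:R * h).
  move=> u; rewrite /cell /= zx => ux; rewrite /eball /=.
  have := @enorm_le_coords R n (x - u)%R h (ltW h0).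
  move=> H; apply: le_lt_trans (H _) _.
    by move=> j; rewrite !mxE distrC; exact: (grid_cell_dist h0 j ux).
  by rewrite -mulrA ltr_pMl ?mulr_gt0// ltrDl.
have zB : eball x (2 * n%:R * h) z by exact: sub.
rewrite /P /avg lee_pdivrMl//; apply: le_trans (le_wmeas sub) _.
apply: le_trans (Hz zB) _.
have -> : (C * (2 * n%:R * h) ^+ n = h ^+ n * (C * (2 * n%:R) ^+ n))%R.
  by rewrite exprMn; ring.
by rewrite EFinM -muleA.
Qed.

End with_bound.
End A1_weights.

(** * Sigma-finiteness and Tonelli for integrals over moving balls *)

Section leb_sigma_finite.
Variables (R : realType) (n : nat).

Lemma borel_lebesgue_sigma_finite : sigma_finite setT (@borel_lebesgue R n).
Proof.
pose B (k : nat) : set (borelRn R n) :=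
  [set z | forall j, `](- k%:R)%R, k%:R[%classic (borelRn_coord j z)].
exists B => [|k].
  apply/seteqP; split => // z _.
  pose K := (\sum_j `|(z : 'rV[R]_n) ord0 j|)%R.
  have K0 : (0 <= K)%R by apply: sumr_ge0.
  exists (Num.bound K) => // j; rewrite /= in_itv/= -ltr_norml.
  apply: le_lt_trans (archi_boundP K0).
  by rewrite /K (bigD1 j)//= lerDl sumr_ge0.
split.
  exact: (@measurable_borel_box R n (fun=> `](- k%:R)%R, k%:R[%classic)).
rewrite (@borel_lebesgue_box R n (fun=> `](- k%:R)%R, k%:R[%classic))//.
rewrite -ge0_fin_numE; last exact: prode_ge0.
by apply: prode_fin_num => j _; rewrite lebesgue_measure_itv/=; case: ifP.
Qed.

Lemma leb_sigma_finite : sigma_finite setT (@leb R n).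
Proof.
exact: (completed_measure_extension_sigma_finite borel_lebesgue_sigma_finite).
Qed.

HB.instance Definition _ := @Measure_isSigmaFinite.Build _ (Rn R n) R (@leb R n) leb_sigma_finite.

(** Tonelli: the centre enters only through the indicator of a measurable set of pairs. *)
Lemma measurable_ball_integral (h : Rn R n -> \bar R) (r : R) :
  measurable_fun setT h -> (forall z, 0 <= h z) ->
  measurable_fun setT (fun y : Rn R n => \int[leb]_(z in eball y r) h z).
Proof.
move=> mh h0.
pose f (p : Rn R n * Rn R n) := ((\1_[set p | enorm (p.1 - p.2)%R < r]%R p)%:E * h p.2).
have -> : (fun y : Rn R n => \int[leb]_(z in eball y r) h z) = fubini_F (@leb R n) f.
  apply/funext => y; rewrite /fubini_F/= [LHS]integral_mkcond; apply: eq_integral => z _.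
  rewrite patchE /f indicE /=.
  have -> : ((y, z) \in [set p : Rn R n * Rn R n | (enorm (p.1 - p.2)%R < r)%R]) = (z \in eball y r).
    by apply/idP/idP; rewrite !inE.
  by case: ifPn => _; rewrite ?mul1e ?mul0e.
apply: measurable_fun_fubini_tonelli_F.
  apply: emeasurable_funM; last exact: (measurableT_comp mh measurable_snd).
  apply/measurable_EFinP; apply: measurable_indic.
  have mE : measurable_fun setT (fun p : Rn R n * Rn R n => enorm (p.1 - p.2)%R).
    apply: (@measurableT_comp _ _ _ _ _ _ (@Num.sqrt R)) => //.
      by apply: continuous_measurable_fun; exact: sqrt_continuous.
    apply: measurable_sum => j; apply: measurable_funX.
    under eq_fun do rewrite !mxE.
    have mc : measurable_fun setT (fun z : Rn R n => (z : 'rV[R]_n) 0%R j).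
      exact: (measurable_of_borel (measurable_borelRn_coord j)).
    apply: measurable_funB; first exact: (measurableT_comp mc measurable_fst).
    exact: (measurableT_comp mc measurable_snd).
  have := mE measurableT _ (measurable_itv `]-oo, r[).
  by rewrite setTI; congr measurable; apply/seteqP; split => z; rewrite /= in_itv.
by move=> p; apply: mule_ge0 => //; rewrite lee_fin.
Qed.

End leb_sigma_finite.

(** * Pointwise domination of the square function *)

Section kernels.
Variables (R : realType) (n : nat).
Hypothesis n0 : (0 < n)%N.
Variables (gamma : R).
Hypothesis gamma_gt0 : (0 < gamma)%R.
Hypothesis gamma_le1 : (gamma <= 1)%R.
Implicit Types x y z : Rn R n.

Section one_kernel.
Variable phi : Rn R n -> R.
Hypothesis hphi : Cgamma gamma phi.

Lemma Cgamma_supp z : (1 < enorm z)%R -> phi z = 0%R.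
Proof.
move=> z1; apply/eqP; apply: contraTT z1 => phiz; rewrite -leNgt.
by case: hphi => sub _ _; apply: sub; apply: subset_closure.
Qed.

Lemma Cgamma_hoelder x z : (`|phi x - phi z| <= enorm (x - z) `^ gamma)%R.
Proof. by case: hphi. Qed.

Lemma Cgamma_bounded z : (`|phi z| <= 3)%R.
Proof.
have [z1|z1] := ltP 1%R (enorm z); first by rewrite Cgamma_supp// normr0.
pose e : Rn R n := (\row_j (3 * (j == Ordinal n0)%:R))%R.
have ee : enorm e = 3%R.
  rewrite /enorm (bigD1 (Ordinal n0))//= big1; last first.
    by move=> j /negbTE j0; rewrite mxE j0 mulr0 expr0n.
  by rewrite mxE eqxx mulr1 addr0 sqrtr_sqr gtr0_norm.
have ze : phi (z + e)%R = 0%R.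
  apply: Cgamma_supp; have := enormD (z + e)%R (- z)%R; rewrite enormN addrAC subrr add0r ee; lra.
have := Cgamma_hoelder z (z + e)%R; rewrite ze subr0 opprD addrA subrr sub0r enormN ee.
move=> /le_trans; apply; rewrite -[leRHS]powRr1//.
by apply: ler_powR => //; rewrite ler1n.
Qed.

Lemma Cgamma_measurable : measurable_fun setT (phi : borelRn R n -> R).
Proof. exact: (hoelder_measurable gamma_gt0 Cgamma_hoelder). Qed.

Variables (y : Rn R n) (t : R).
Hypothesis t0 : (0 < t)%R.

Let psi z := dilate phi t (y - z)%R.
Let tn0 : (0 < t ^- n)%R. Proof. by rewrite invr_gt0 exprn_gt0. Qed.

Lemma dilate_bounded z : (`|psi z| <= 3 * t ^- n)%R.
Proof.
rewrite /psi /dilate normrM gtr0_norm// mulrC; apply: ler_wpM2r; first exact: ltW.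
exact: Cgamma_bounded.
Qed.

Lemma dilate_supp z : (t < enorm (y - z))%R -> psi z = 0%R.
Proof.
move=> tz; rewrite /psi /dilate Cgamma_supp ?mulr0// enormZ gtr0_norm ?invr_gt0//.
by rewrite mulrC ltr_pdivlMr// mul1r.
Qed.

Lemma dilate_measurable_borel : measurable_fun setT (psi : borelRn R n -> R).
Proof.
apply: measurable_funM => //.
have -> : (fun z : Rn R n => phi (t^-1 *: (y - z))%R) = phi \o reflect_dilate (y : 'rV[R]_n) t.
  apply/funext => z; rewrite /=; congr phi; apply/rowP => j.
  by rewrite !mxE /reflect_dilate1 /borelRn_coord.
exact: (measurableT_comp Cgamma_measurable (measurable_reflect_dilate _ _)).
Qed.

Lemma dilate_measurable : measurable_fun setT psi.
Proof. exact: measurable_of_borel dilate_measurable_borel. Qed.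

Lemma dilate_integral0 : \int[leb]_z (psi z)%:E = 0.
Proof.
have phi0 : \int[leb]_z (phi z)%:E = 0 by case: hphi.
have H : \int[leb]_z (t ^- n * phi z)%:E = 0.
  have [->|phin] := eqVneq phi (cst 0%R).
    by rewrite integral0_eq// => z _; rewrite /= mulr0.
  have fin : leb.-integrable setT (EFin \o phi).
    apply/integrableP; split.
      by apply/measurable_EFinP; exact: measurable_of_borel Cgamma_measurable.
    apply: (@le_lt_trans _ _ (\int[leb]_(z in eball (0%R : Rn R n) 2) 3%:E)).
      rewrite [leRHS]integral_mkcond; apply: ge0_le_lower_integral => z _ //.
      rewrite patchE; case: ifPn => [_|].
        by rewrite /= lee_fin Cgamma_bounded.
      rewrite notin_setE /eball /= sub0r enormN => /negP; rewrite -leNgt => z2.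
      by rewrite Cgamma_supp ?normr0//; lra.
    rewrite integral_cst; last exact: measurable_eball.
    rewrite lte_mul_pinfty ?lee_fin//.
    by rewrite -ge0_fin_numE//; apply: leb_eball_fin.
  under eq_integral do rewrite EFinM.
  by rewrite integralZl// phi0 mule0.
apply: (@integral_reflect_dilate_eq0 R n (fun z => t ^- n * phi z)%R) => //.
by apply: measurable_funM => //; exact: Cgamma_measurable.
Qed.

Lemma dilate_oscillation z z' (s : R) : (0 <= s)%R -> (enorm (z - z')%R <= s)%R ->
  (`|psi z - psi z'| <= t ^- n * (s / t) `^ gamma)%R.
Proof.
move=> s0 zs; rewrite /psi /dilate -mulrBr normrM gtr0_norm//.
apply: ler_wpM2l; first exact: ltW.
apply: le_trans (Cgamma_hoelder _ _) _.
have -> : (t^-1 *: (y - z) - t^-1 *: (y - z') = t^-1 *: (z' - z) :> Rn R n)%R.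
  by rewrite -scalerBr; congr (_ *: _)%R; apply/rowP => j; rewrite !mxE; ring.
apply: ge0_ler_powR; rewrite ?nnegrE ?enorm_ge0 ?(ltW gamma_gt0)//.
  by rewrite divr_ge0// ltW.
rewrite enormZ gtr0_norm ?invr_gt0// mulrC enorm_distC.
by apply: ler_wpM2r => //; rewrite invr_ge0 ltW.
Qed.

End one_kernel.

(* A fourth root of [3 ^ - gamma], the decay per level of the oscillation of a kernel. *)
Definition root_ratio : R := ((3^-1 : R) `^ (gamma / 4))%R.

Lemma root_ratio_gt0 : (0 < root_ratio)%R.
Proof. by rewrite powR_gt0// invr_gt0. Qed.

Lemma root_ratio_lt1 : (root_ratio < 1)%R.
Proof.
have -> : (1 = 1 `^ (gamma / 4) :> R)%R by rewrite powR1.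
apply: gt0_ltr_powR; rewrite ?nnegrE ?divr_gt0//.
by rewrite invf_lt1// ltr1n.
Qed.

Lemma root_ratioX4 : ((root_ratio ^+ 2) ^+ 2 = 3^-1 `^ gamma)%R.
Proof.
rewrite -exprM -powR_mulrn ?powR_ge0// -powRrM; congr (_ `^ _)%R.
by rewrite -mulrA mulVf ?mulr1// pnatr_eq0.
Qed.

Section grid_levels.
Variables (tau : {ffun 'I_n -> bool}) (rho : R).
Hypothesis rho0 : (0 < rho)%R.

Definition level_index (i : nat) : Rn R n -> nat := grid_index tau (rho / 3 ^+ i).
Definition level_volume (i : nat) : R := ((rho / 3 ^+ i) ^+ n)%R.

Lemma mesh_gt0 i : (0 < rho / 3 ^+ i)%R.
Proof. by rewrite divr_gt0// exprn_gt0. Qed.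

Lemma measurable_level i k : measurable (level_index i @^-1` [set k]).
Proof. by apply: leb_measurable; exact: (measurable_grid_fibre tau (mesh_gt0 i)). Qed.

Lemma level_volume_gt0 i : (0 < level_volume i)%R.
Proof. by rewrite exprn_gt0// mesh_gt0. Qed.

Lemma leb_level_cell i x : leb (cell (level_index i) x) = (level_volume i)%:E.
Proof.
have [_ e] := leb_borel (measurable_grid_cell tau (mesh_gt0 i) (x : 'rV[R]_n)).
rewrite -(borel_lebesgue_grid_cell tau (mesh_gt0 i) (x : 'rV[R]_n)); exact: e.
Qed.

Lemma level_indexS i x z : level_index i.+1 x = level_index i.+1 z ->
  level_index i x = level_index i z.
Proof. exact: grid_index_refine. Qed.

Lemma level_volumeS i : level_volume i = (3 ^+ n * level_volume i.+1)%R.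
Proof.
rewrite /level_volume -exprMn; congr (_ ^+ _)%R; rewrite exprS.
by field; rewrite expf_neq0.
Qed.

(** The support of the kernel lies within [2 * t] of [x], at most a quarter mesh, so [cover] places
    it inside the cell of [x]. The upper bound on the mesh makes the oscillation on cells of level
    [i + k] decay from a constant, and turns [t ^- n] times the cell volume into [24 ^+ n]. *)
Lemma convolution_near phi (f : Rn R n -> R) x y (t : R) i : Cgamma gamma phi ->
  leb.-integrable setT (EFin \o f) -> (0 < t)%R -> (enorm (x - y)%R < t)%R ->
  (8 * t <= rho / 3 ^+ i)%R -> (rho / 3 ^+ i <= 24 * t)%R ->
  (forall z, (forall j, `|(z : 'rV[R]_n) ord0 j - (x : 'rV[R]_n) ord0 j|
     < rho / 3 ^+ i / 4)%R -> level_index i z = level_index i x) ->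
  `|convolution (dilate phi t) f y| <= (24 ^+ n * (24 * n%:R))%:E *
    oscillation_sum leb level_index level_volume ((root_ratio ^+ 2) ^+ 2) f i x.
Proof.
move=> hphi fi t0 xy t8 t24 cover.
set h := (rho / 3 ^+ i)%R in t8 t24 cover *.
have h0 : (0 < h)%R by exact: mesh_gt0.
have tn0 : (0 < t ^- n)%R by rewrite invr_gt0 exprn_gt0.
pose psi z := dilate phi t (y - z)%R.
have offQ z : ~ cell (level_index i) x z -> psi z = 0%R.
  move=> nQ; apply: (dilate_supp hphi t0); rewrite ltNge; apply/negP => yz; apply: nQ.
  apply: cover => j; apply: (@lt_le_trans _ _ (2 * t)%R); last by lra.
  have := coord_le_enorm (x - z)%R j; rewrite !mxE distrC => /le_lt_trans; apply.
  apply: le_lt_trans (enorm_dist_triangle x y z) _; lra.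
have psi0 : \int[leb]_(z in cell (level_index i) x) (psi z)%:E = 0.
  rewrite -[RHS](dilate_integral0 hphi y t0) integral_mkcond; apply: eq_integral => z _.
  by rewrite patchE; case: ifPn => //; rewrite notin_setE => /offQ pz; rewrite -/(psi z) pz.
have -> : convolution (dilate phi t) f y =
    \int[leb]_(z in cell (level_index i) x) (psi z * f z)%:E.
  rewrite /convolution [RHS]integral_mkcond; apply: eq_integral => z _.
  by rewrite patchE; case: ifPn => //; rewrite notin_setE => /offQ pz;
     rewrite -/(psi z) pz mul0r.
have th0 : (0 < (root_ratio ^+ 2) ^+ 2)%R by rewrite !exprn_gt0// root_ratio_gt0.
have th1 : ((root_ratio ^+ 2) ^+ 2 < 1)%R.
  have r0 := ltW root_ratio_gt0.
  by rewrite exprn_ilt1 ?exprn_ge0// exprn_ilt1// root_ratio_lt1.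
(* Cells of level [i + k] have diameter at most [24 * n * t / 3 ^+ k]; since [gamma <= 1] and
   [24 * n >= 1], the power of the constant is bounded by the constant itself. *)
pose W := (t ^- n * (24 * n%:R))%R.
have W0 : (0 <= W)%R by rewrite mulr_ge0 ?(ltW tn0)// mulr_ge0.
apply: (@le_trans _ _ ((W * level_volume i)%:E *
   oscillation_sum leb level_index level_volume ((root_ratio ^+ 2) ^+ 2) f i x)).
  apply: (oscillation_bound measurable_level level_volume_gt0 leb_level_cell level_indexS
    fi _ (dilate_bounded hphi y t0) W0 th0 th1 _ psi0).
    exact: (dilate_measurable hphi y t).
  move=> k z z' zz'.
  pose s := (n%:R * (rho / 3 ^+ (i + k)))%R.
  have s0 : (0 <= s)%R by rewrite mulr_ge0// ltW// mesh_gt0.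
  have zs : (enorm (z - z')%R <= s)%R.
    apply: enorm_le_coords; first by rewrite ltW// mesh_gt0.
    by move=> j; rewrite !mxE; exact: (grid_cell_dist (mesh_gt0 (i + k)) j zz').
  apply: le_trans (dilate_oscillation hphi y t0 s0 zs) _.
  rewrite /W -(mulrA (t ^- n)); apply: ler_wpM2l; first exact: ltW.
  have a1 : (1 <= 24 * n%:R :> R)%R by rewrite -natrM ler1n muln_gt0.
  apply: (@le_trans _ _ ((24 * n%:R * 3^-1 ^+ k) `^ gamma)%R).
    have p1 : (0 <= s / t)%R by rewrite divr_ge0// ltW.
    have p2 : (0 <= 24 * n%:R * 3^-1 ^+ k :> R)%R.
      by rewrite mulr_ge0 ?exprn_ge0 ?invr_ge0// mulr_ge0.
    apply: ge0_ler_powR; rewrite ?nnegrE ?(ltW gamma_gt0)//.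
    have -> : (s / t = n%:R * 3^-1 ^+ k * (h / t))%R.
      rewrite /s /h exprD exprVn; field.
      by rewrite !expf_neq0// gt_eqF.
    have -> : (24 * n%:R * 3^-1 ^+ k = n%:R * 3^-1 ^+ k * 24 :> R)%R by ring.
    apply: ler_wpM2l; first by rewrite mulr_ge0// exprn_ge0// invr_ge0.
    by rewrite ler_pdivrMr.
  rewrite powRM ?mulr_ge0// ?exprn_ge0// ?invr_ge0//.
  have -> : ((3^-1 ^+ k) `^ gamma = ((root_ratio ^+ 2) ^+ 2) ^+ k :> R)%R.
    have i3 : (0 <= 3^-1 :> R)%R by rewrite invr_ge0.
    rewrite root_ratioX4 -(powR_mulrn k (powR_ge0 3^-1%R gamma)) -(powR_mulrn k i3).
    by rewrite -!powRrM mulrC.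
  apply: ler_wpM2r; first by rewrite exprn_ge0// ltW.
  rewrite -[leRHS]powRr1; last by rewrite (le_trans ler01).
  exact: ler_powR.
apply: lee_wpmul2r.
  apply: nneseries_ge0 => k _ _; rewrite mule_ge0//.
    by rewrite lee_fin exprn_ge0// ltW.
  by apply: avg_ge0 => //; exact: level_volume_gt0.
rewrite lee_fin /W mulrAC; apply: ler_wpM2r; first by rewrite mulr_ge0.
have p3 : (0 <= t^-1 * h)%R by rewrite mulr_ge0 ?invr_ge0 ?(ltW t0) ?(ltW h0).
rewrite /level_volume -/h -exprVn -exprMn; apply: lerXn2r; rewrite ?nnegrE//.
by rewrite mulrC ler_pdivrMr.
Qed.

End grid_levels.

Lemma convolution_far phi (f : Rn R n -> R) x y (t s : R) : Cgamma gamma phi ->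
  measurable_fun setT f -> (0 < t)%R -> (enorm (x - y)%R + t < s)%R ->
  `|convolution (dilate phi t) f y| <=
  (3 * t ^- n)%:E * \int[leb]_(z in eball x s) `|f z|%:E.
Proof.
move=> hphi mf t0 xys.
have tn0 : (0 < t ^- n)%R by rewrite invr_gt0 exprn_gt0.
have mB := measurable_eball x s.
have mpsi := dilate_measurable hphi y t.
have mfn : measurable_fun setT (fun z => `|f z|%:E : \bar R).
  by apply/measurable_EFinP; apply: measurableT_comp.
have mpf : measurable_fun setT (fun z => (dilate phi t (y - z)%R * f z)%:E).
  by apply/measurable_EFinP; exact: measurable_funM.
apply: (le_trans (le_abse_integral _ measurableT mpf)).
have c0 : 0 <= (3 * t ^- n)%:E by rewrite lee_fin mulr_ge0// ltW.
rewrite -(ge0_integralZl _ mB (measurable_funTS mfn) _ c0)//.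
rewrite [leRHS]integral_mkcond; apply: ge0_le_lower_integral => z _ //.
rewrite patchE; case: ifPn => [_|].
  rewrite /= -EFinM lee_fin normrM; apply: ler_wpM2r => //.
  exact: (dilate_bounded hphi y t0).
rewrite notin_setE /eball /= => /negP; rewrite -leNgt => sz.
rewrite (dilate_supp hphi t0) ?mul0r ?normr0//.
have := enorm_dist_triangle x y z; lra.
Qed.

End kernels.

Section scales.
Variable R : realType.

Lemma scale_below (r t : R) : (0 < r)%R -> (0 < t)%R -> (t <= r)%R ->
  exists i, (r / 3 ^+ i.+1 < t <= r / 3 ^+ i)%R.
Proof.
move=> r0 t0 tr.
have ex : exists i, (r / 3 ^+ i.+1 < t)%R.
  have q0 : (0 <= r / t)%R by rewrite divr_ge0// ltW.
  exists (Num.bound (r / t)); rewrite ltr_pdivrMr ?exprn_gt0// mulrC -ltr_pdivrMr//.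
  apply: lt_le_trans (archi_boundP q0) _; rewrite -natrX ler_nat.
  by apply: ltnW; apply: leq_trans (ltn_expl _ (isT : 1 < 3)%N) _; rewrite leq_exp2l.
have [i hi imin] := ex_minnP ex; exists i; rewrite hi /=.
case: i hi imin => [|i] hi imin; first by rewrite expr0 divr1.
by rewrite leNgt; apply/negP => /imin; rewrite ltnn.
Qed.

Lemma scale_above (r t : R) : (0 < r)%R -> (r < t)%R ->
  exists l, (r * 3 ^+ l < t <= r * 3 ^+ l.+1)%R.
Proof.
move=> r0 rt.
have ex : exists l, (t <= r * 3 ^+ l.+1)%R.
  have q0 : (0 <= t / r)%R by rewrite divr_ge0// ltW// (lt_trans r0).
  exists (Num.bound (t / r)); rewrite mulrC -ler_pdivrMr//.
  apply: le_trans (ltW (archi_boundP q0)) _; rewrite -natrX ler_nat.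
  by apply: ltnW; apply: leq_trans (ltn_expl _ (isT : 1 < 3)%N) _; rewrite leq_exp2l.
have [l hl lmin] := ex_minnP ex; exists l; rewrite hl andbT.
case: l hl lmin => [|l] hl lmin; first by rewrite expr0 mulr1.
by rewrite ltNge; apply/negP => /lmin; rewrite ltnn.
Qed.

End scales.

(** * Discretisation of the cone *)

Section square_function_majorant.
Variables (R : realType) (n : nat) (gamma : R).
Implicit Types x y z : Rn R n.

Lemma Cgamma0 : Cgamma gamma (cst 0%R : Rn R n -> R).
Proof.
split.
- rewrite (_ : [set z : Rn R n | cst 0%R z != 0%R] = set0) ?closure0//.
  by apply/seteqP; split => // z /=; rewrite eqxx.
- by rewrite integral0_eq.
- by move=> x z; rewrite /= subrr normr0 powR_ge0.
Qed.

Let mu2 := (@leb R n \x @lebesgue_measure R).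

(** A cylinder containing the part of the cone at scales between [b / 3] and [b]; there
    [slab_density b] bounds the factor [t ^- n.+1], and the product of density and volume is bounded
    independently of [b]. *)
Definition slab x (b : R) : set (Rn R n * measurableTypeR R) :=
  eball x b `*` `](b / 3)%R, b]%classic.

Definition slab_density (b : R) : R := ((b / 3) ^- n.+1)%R.

Let slab_density_ge0 b : (0 < b)%R -> (0 <= slab_density b)%R.
Proof. by move=> b0; rewrite invr_ge0 exprn_ge0// divr_ge0// ltW. Qed.

Lemma measurable_slab x b : measurable (slab x b).
Proof. by apply: measurableX => //; exact: measurable_eball. Qed.

Lemma slab_mass x b : (0 < b)%R ->
  (slab_density b)%:E * mu2 (slab x b) <= (2 ^+ n * 3 ^+ n.+1)%:E.
Proof.
move=> b0; have e : lebesgue_measure (`](b / 3)%R, b]%classic : set R) = (b - b / 3)%:E.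
  rewrite lebesgue_measure_itv/= lte_fin ifT; first by rewrite EFinB.
  by lra.
have -> : mu2 (slab x b) = leb (eball x b) * (b - b / 3)%:E.
  by rewrite -e; apply: product_measure1E => //; exact: measurable_eball.
apply: (@le_trans _ _ ((slab_density b)%:E * (((2 * b) ^+ n)%:E * b%:E))).
  apply: lee_wpmul2l; first by rewrite lee_fin slab_density_ge0.
  apply: lee_pmul => //.
  - by rewrite lee_fin; lra.
  - exact: leb_eball_le.
  - by rewrite lee_fin; lra.
rewrite -!EFinM lee_fin le_eqVlt; apply/orP; left; apply/eqP.
rewrite /slab_density !exprMn !exprS !invfM exprVn; field.
by rewrite !expf_neq0// gt_eqF.
Qed.

Let weighted_slabs x (b : nat -> R) (a : nat -> \bar R) p : \bar R :=
  \sum_(0 <= i <oo) (a i ^+ 2 * (slab_density (b i))%:E) * (\1_(slab x (b i)) p)%:E.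

Let term_ge0 (a : \bar R) b : (0 < b)%R -> 0 <= a -> 0 <= a ^+ 2 * (slab_density b)%:E.
Proof. by move=> b0 a0; rewrite mule_ge0 ?expe_ge0// lee_fin slab_density_ge0. Qed.

Let m_slab x b : measurable_fun setT (fun p => (\1_(slab x b) p)%:E : \bar R).
Proof. by apply/measurable_EFinP; apply: measurable_indic; exact: measurable_slab. Qed.

Let weighted_slabs_ge0 x b a p : (forall i, 0 < b i)%R -> (forall i, 0 <= a i) ->
  0 <= weighted_slabs x b a p.
Proof.
by move=> b0 a0; apply: nneseries_ge0 => i _ _; apply: mule_ge0 => //; exact: term_ge0.
Qed.

Let m_weighted_slabs x b a : (forall i, 0 < b i)%R -> (forall i, 0 <= a i) ->
  measurable_fun setT (weighted_slabs x b a).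
Proof.
move=> b0 a0; apply: ge0_emeasurable_sum => [i p _ _|i _].
  by apply: mule_ge0 => //; exact: term_ge0.
by apply: emeasurable_funM.
Qed.

Let integral_weighted_slabs x b a : (forall i, 0 < b i)%R -> (forall i, 0 <= a i) ->
  \int[mu2]_p weighted_slabs x b a p <=
  (2 ^+ n * 3 ^+ n.+1)%:E * \sum_(0 <= i <oo) a i ^+ 2.
Proof.
move=> b0 a0.
rewrite /weighted_slabs integral_nneseries//; first last.
- by move=> i p _; apply: mule_ge0 => //; exact: term_ge0.
- by move=> i; apply: emeasurable_funM.
rewrite -nneseriesZl; last by move=> i _; exact: expe_ge0.
apply: lee_nneseries => [i _ _|i _].
  by apply: integral_ge0 => p _; apply: mule_ge0 => //; exact: term_ge0.
rewrite (ge0_integralZl _ measurableT (m_slab x (b i)) _ (term_ge0 (b0 i) (a0 i)))//.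
rewrite integral_indic//; last exact: measurable_slab.
rewrite setIT -muleA [leRHS]muleC; apply: lee_wpmul2l; first exact: expe_ge0.
exact: slab_mass.
Qed.

(** Every point of the cone falls in one triadic range of scales, below or above [r], where the
    supremum over kernels is bounded by a constant. The integrand is thus dominated by a series of
    indicators of slabs, which is measurable. *)
Lemma sqr_square_function_le (f : Rn R n -> R) x (r : R) (a c : nat -> \bar R) :
  (0 < r)%R -> (forall i, 0 <= a i) -> (forall l, 0 <= c l) ->
  (forall i y t phi, (r / 3 ^+ i.+1 < t <= r / 3 ^+ i)%R -> (enorm (x - y)%R < t)%R ->
    Cgamma gamma phi -> `|convolution (dilate phi t) f y| <= a i) ->
  (forall l y t phi, (r * 3 ^+ l < t <= r * 3 ^+ l.+1)%R -> (enorm (x - y)%R < t)%R ->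
    Cgamma gamma phi -> `|convolution (dilate phi t) f y| <= c l) ->
  square_function gamma f x ^+ 2 <=
  (2 ^+ n * 3 ^+ n.+1)%:E *
    (\sum_(0 <= i <oo) a i ^+ 2 + \sum_(0 <= l <oo) c l ^+ 2).
Proof.
move=> r0 a0 c0 Ha Hc; rewrite /square_function.
set I := fun p : Rn R n * measurableTypeR R => _ * _.
pose S (p : Rn R n * measurableTypeR R) :=
  ereal_sup [set `|convolution (dilate phi p.2) f p.1| | phi in Cgamma gamma].
have S0 p : 0 <= S p.
  apply: le_trans (abse_ge0 _) _; last first.
    by apply: ereal_sup_ubound; exists (cst 0%R) => //; exact: Cgamma0.
have I0 p : cone x p -> 0 <= I p.
  move=> [p0 _]; apply: mule_ge0; first by apply: expe_ge0; exact: S0.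
  by rewrite lee_fin invr_ge0 exprn_ge0// ltW.
rewrite sqr_poweR_half; last by apply: integral_ge0 => p; exact: I0.
pose b i : R := (r / 3 ^+ i)%R; pose b' l : R := (r * 3 ^+ l.+1)%R.
have b0 i : (0 < b i)%R by rewrite divr_gt0// exprn_gt0.
have b'0 l : (0 < b' l)%R by rewrite mulr_gt0// exprn_gt0.
have key (e : nat -> \bar R) (bb : nat -> R) i p : (forall i, 0 < bb i)%R ->
    (forall i, 0 <= e i) -> cone x p -> (bb i / 3 < p.2 <= bb i)%R ->
    S p <= e i -> I p <= weighted_slabs x bb e p.
  move=> bb0 e0 [p0 xp] /andP[p1 p2] Se.
  have in_ : p \in slab x (bb i).
    rewrite inE; split => /=; last by rewrite in_itv/= p1.
    by rewrite /eball /=; exact: lt_le_trans xp p2.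
  apply: (@le_trans _ _ ((e i ^+ 2 * (slab_density (bb i))%:E) * (\1_(slab x (bb i)) p)%:E)).
    rewrite indicE in_ mule1; apply: lee_pmul.
    - by apply: expe_ge0; exact: S0.
    - by rewrite lee_fin invr_ge0 exprn_ge0// ltW.
    - by apply: le_sqre => //; exact: S0.
    - rewrite lee_fin /slab_density lef_pV2 ?posrE ?exprn_gt0// ?divr_gt0//.
      by apply: lerXn2r; rewrite ?nnegrE ?divr_ge0// ltW.
  apply: (@term_le_nneseries _ (fun i => e i ^+ 2 * (slab_density (bb i))%:E *
    (\1_(slab x (bb i)) p)%:E) i) => j.
  by apply: mule_ge0 => //; exact: term_ge0.
apply: (@le_trans _ _ (\int[mu2]_p (weighted_slabs x b a p + weighted_slabs x b' c p))).
  rewrite integral_mkcond; apply: ge0_le_lower_integral => p _.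
    by rewrite patchE; case: ifPn => //; rewrite inE; exact: I0.
  rewrite patchE; case: ifPn => [|_]; last by rewrite adde_ge0// weighted_slabs_ge0.
  rewrite inE => pc; have [p0 xp] := pc.
  have [pr|pr] := leP p.2 r.
    have [i /andP[i1 i2]] := scale_below r0 p0 pr.
    apply: le_trans (leeDl _ (weighted_slabs_ge0 x p b'0 c0)).
    apply: (key a b i p b0 a0 pc).
      rewrite i2 andbT; apply: le_lt_trans i1; rewrite /b exprS le_eqVlt.
      by apply/orP; left; apply/eqP; field; rewrite expf_neq0.
    apply: ge_ereal_sup => _ [phi hphi <-]; apply: Ha => //.
    by rewrite i1.
  have [l /andP[l1 l2]] := scale_above r0 pr.
  apply: le_trans (leeDr _ (weighted_slabs_ge0 x p b0 a0)).
  apply: (key c b' l p b'0 c0 pc).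
    rewrite l2 andbT; apply: le_lt_trans l1; rewrite /b' exprS le_eqVlt.
    by apply/orP; left; apply/eqP; field.
  apply: ge_ereal_sup => _ [phi hphi <-]; apply: Hc => //.
  by rewrite l1.
rewrite ge0_integralD//; first last.
- exact: m_weighted_slabs.
- by move=> p _; exact: weighted_slabs_ge0.
- exact: m_weighted_slabs.
- by move=> p _; exact: weighted_slabs_ge0.
rewrite ge0_muleDr.
- by apply: leeD; exact: integral_weighted_slabs.
- by apply: nneseries_ge0 => i _ _; exact: expe_ge0.
- by apply: nneseries_ge0 => i _ _; exact: expe_ge0.
Qed.

End square_function_majorant.

Lemma term_le_sum (R : realType) (I : finType) (a : I -> \bar R) k :
  (forall i, 0 <= a i) -> a k <= \sum_i a i.
Proof. by move=> a0; rewrite (bigD1 k)//= leeDl// sume_ge0. Qed.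

Lemma sqreMl (R : realType) (c : R) (x : \bar R) : (c%:E * x) ^+ 2 = (c ^+ 2)%:E * x ^+ 2.
Proof. by rewrite !expe2 muleACA -EFinM -expr2. Qed.

(** * The local weak type estimate *)

Section local_constants.
Variables (R : realType) (n : nat).

Definition grid_count : R := #|{: {ffun 'I_n -> bool}}|%:R.
Definition cone_factor : R := (2 ^+ n * 3 ^+ n.+1)%R.
Definition oscillation_factor : R := (24 ^+ n * (24 * n%:R))%R.
(** If the square sum of every grid is at most [(lam / near_level) ^+ 2], then all grids together
    account for at most half of [lam ^+ 2]; [far_const] plays the same role for the large scales. *)
Definition near_level : R := (2 * cone_factor * oscillation_factor ^+ 2 * grid_count)%R.
Definition far_const : R := (2 * cone_factor)%R.
Definition near_const (gamma C : R) : R := (grid_count * (near_level *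
  weak_type_const (3 ^+ n) (C * (2 * n%:R) ^+ n) (root_ratio gamma)))%R.

End local_constants.

Section local_estimate.
Variables (R : realType) (n : nat).
Hypothesis n0 : (0 < n)%N.
Variables (gamma : R).
Hypothesis gamma_gt0 : (0 < gamma)%R.
Hypothesis gamma_le1 : (gamma <= 1)%R.
Variable w : Rn R n -> R.
Hypothesis ww : weight w.
Variable C : R.
Hypothesis C0 : (0 < C)%R.
Hypothesis HC : A1_bound w C.
Variable f : nat -> Rn R n -> R.
Hypothesis fl : forall j, loc_integrable (f j).
Variables (y0 : Rn R n) (r : R).
Hypothesis r0 : (0 < r)%R.
Implicit Types x y z : Rn R n.

Let F x := l2sum (fun j => (f j x)%:E).
Let B l := eball y0 (3 ^+ l * r)%R.
(** For [x] within [r] of [y0] and [t <= r], the kernel vanishes outside this ball of radius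
    [3 * r]. The base mesh [8 * r] below puts the mesh of level [i] between [8 * t] and [24 * t] for
    [t] in the i-th triadic range. *)
Let g j x := (f j x * \1_(eball y0 (3 * r)) x)%R.
Let rho := (8 * r)%R.
Let rho0 : (0 < rho)%R. Proof. by rewrite mulr_gt0. Qed.
Let theta := ((root_ratio gamma ^+ 2) ^+ 2)%R.
Let osc tau j i x :=
  oscillation_sum leb (level_index tau rho) (level_volume n rho) theta (g j) i x.

Let mf j : measurable_fun setT (f j). Proof. by case: (fl j). Qed.

Let mg j : measurable_fun setT (g j).
Proof.
have mI : measurable_fun setT (\1_(eball y0 (3 * r)%R) : Rn R n -> R).
  exact: (measurable_indic (measurable_eball y0 (3 * r)%R)).
exact: (measurable_funM (mf j) mI).
Qed.

Let gi j : leb.-integrable setT (EFin \o g j).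
Proof.
apply/integrableP; split; first exact/measurable_EFinP.
apply: le_lt_trans (loc_integrable_eball y0 (3 * r)%R (fl j)).
rewrite [leRHS]integral_mkcond; apply: ge0_le_lower_integral => x _ //.
rewrite patchE /= /g indicE; case: (x \in _); first by rewrite mulr1.
by rewrite mulr0 normr0.
Qed.

Let F_ge0 x : 0 <= F x. Proof. exact: l2sum_ge0. Qed.

Let theta_gt0 : (0 < theta)%R.
Proof. by rewrite !exprn_gt0// root_ratio_gt0. Qed.

Let osc_ge0 tau j i x : 0 <= osc tau j i x.
Proof.
apply: nneseries_ge0 => k _ _; apply: mule_ge0.
  by rewrite lee_fin exprn_ge0// ltW.
by apply: avg_ge0 => //; exact: level_volume_gt0.
Qed.

Let K : R := oscillation_factor R n.
Let Kn : R := cone_factor R n.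

Let K_ge0 : (0 <= K)%R. Proof. by rewrite /K /oscillation_factor !mulr_ge0// exprn_ge0. Qed.
Let Kn_gt0 : (0 < Kn)%R. Proof. by rewrite /Kn /cone_factor; rewrite mulr_gt0// exprn_gt0. Qed.

Let far_coef l : R := (3 * (r * 3 ^+ l) ^- n)%R.

Let far_coef_ge0 l : (0 <= far_coef l)%R.
Proof. by rewrite mulr_ge0// invr_ge0 exprn_ge0// mulr_ge0 ?exprn_ge0// ltW. Qed.

Let far j l := (far_coef l)%:E * \int[leb]_(z in B l.+2) `|f j z|%:E.
Let farF l := (far_coef l)%:E * \int[leb]_(z in B l.+2) F z.

Let far_ge0 j l : 0 <= far j l.
Proof. by apply: mule_ge0; [rewrite lee_fin|exact: integral_ge0]. Qed.

Let farF_ge0 l : 0 <= farF l.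
Proof. by apply: mule_ge0; [rewrite lee_fin|exact: integral_ge0]. Qed.

(** The suitable shift depends on [x] and on the level. Summing over all shifts removes this
    dependence and leaves finitely many fixed filtrations, to each of which the weak type bound
    applies. *)
Let sqr_square_function_osc j x : eball y0 r x ->
  square_function gamma (f j) x ^+ 2 <= Kn%:E *
   ((K ^+ 2)%:E * (\sum_(0 <= i <oo) \sum_(tau : {ffun 'I_n -> bool}) osc tau j i x ^+ 2) +
    \sum_(0 <= l <oo) far j l ^+ 2).
Proof.
rewrite /eball /= => xB.
pose tau i := projT1 (cid (grid_cover (x : 'rV[R]_n) (mesh_gt0 rho0 i))).
have tauP i : forall z, (forall k, `|(z : 'rV[R]_n) ord0 k - (x : 'rV[R]_n) ord0 k|
     < rho / 3 ^+ i / 4)%R -> level_index (tau i) rho i z = level_index (tau i) rho i x.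
  by rewrite /tau; case: cid.
pose a i := K%:E * osc (tau i) j i x.
have a0 i : 0 <= a i by apply: mule_ge0 => //; rewrite lee_fin.
apply: (@le_trans _ _ (Kn%:E * (\sum_(0 <= i <oo) a i ^+ 2 + \sum_(0 <= l <oo) far j l ^+ 2))).
  apply: (sqr_square_function_le r0 a0 (far_ge0 j)).
    move=> i y t phi /andP[t1 t2] xy hphi.
    have t0 : (0 < t)%R by apply: lt_trans t1; rewrite divr_gt0// exprn_gt0.
    have tr : (t <= r)%R.
      apply: le_trans t2 _; rewrite ler_pdivrMr ?exprn_gt0// (ler_peMr (ltW r0))//.
      by rewrite exprn_ege1// ler1n.
    have -> : convolution (dilate phi t) (f j) y = convolution (dilate phi t) (g j) y.
      apply: eq_integral => z _; rewrite /g indicE.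
      have [_|] := boolP (z \in _); first by rewrite mulr1.
      rewrite notin_setE /eball /= => /negP; rewrite -leNgt => z3.
      rewrite (dilate_supp hphi t0) ?mul0r//.
      have := enorm_dist_triangle y0 x z; have := enorm_dist_triangle x y z; lra.
    apply: (convolution_near n0 gamma_gt0 gamma_le1 rho0 hphi (gi j) t0 xy _ _ (tauP i)).
      by rewrite /rho -mulrA ler_pM2l.
    rewrite /rho; move: t1; rewrite exprS invfM mulrCA => t1; lra.
  move=> l y t phi /andP[t1 t2] xy hphi.
  have l3 : (0 < r * 3 ^+ l)%R by rewrite mulr_gt0// exprn_gt0.
  have t0 : (0 < t)%R by exact: lt_trans t1.
  apply: le_trans (convolution_far n0 gamma_gt0 gamma_le1 (x := y0) (s := (3 ^+ l.+2 * r)%R)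
     hphi (mf j) t0 _) _.
    have := enorm_dist_triangle y0 x y; rewrite !exprS in t2 *.
    have : (r <= r * 3 ^+ l)%R by rewrite (ler_peMr (ltW r0))// exprn_ege1// ler1n.
    move: (3 ^+ l)%R l3 t1 t2 => q l3 t1 t2 qr H; lra.
  apply: lee_wpmul2r; first exact: integral_ge0.
  rewrite lee_fin /far_coef; apply: ler_wpM2l => //.
  rewrite lef_pV2 ?posrE ?exprn_gt0//.
  by apply: lerXn2r; rewrite ?nnegrE ltW.
apply: lee_wpmul2l; first by rewrite lee_fin ltW.
apply: leeD2r.
have s0 i : 0 <= \sum_(tau : {ffun 'I_n -> bool}) osc tau j i x ^+ 2.
  by apply: sume_ge0 => tau' _; exact: expe_ge0.
rewrite -nneseriesZl; last by move=> *; exact: s0.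
apply: lee_nneseries => [i _ _|i _]; first exact: expe_ge0.
rewrite /a sqreMl; apply: lee_wpmul2l; first by rewrite lee_fin sqr_ge0.
exact: (term_le_sum (a := fun t => osc t j i x ^+ 2) (tau i) (fun t => expe_ge0 2 (osc_ge0 t j i x))).
Qed.

Let Q tau x := \sum_(0 <= i <oo) \sum_(0 <= j <oo) osc tau j i x ^+ 2.

Let mQ tau : measurable_fun setT (Q tau).
Proof.
apply: ge0_emeasurable_sum => [i x _ _|i _].
  by apply: nneseries_ge0 => j _ _; exact: expe_ge0.
apply: ge0_emeasurable_sum => [j x _ _|j _]; first exact: expe_ge0.
apply: measurable_sqre; apply: ge0_emeasurable_sum => [k x _ _|k _].
  apply: mule_ge0; first by rewrite lee_fin exprn_ge0// ltW.
  by apply: avg_ge0 => //; exact: level_volume_gt0.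
by apply: measurable_funeM; apply: measurable_avg; exact: measurable_level.
Qed.

Let P := \sum_(0 <= l <oo) farF l.

Let P_ge0 : 0 <= P. Proof. exact: nneseries_ge0. Qed.

(** Minkowski moves the sum over [j] inside the integrals, producing [F]; the sum over scales is
    then the passage from l^1 to l^2. *)
Let sum_far : \sum_(0 <= j <oo) \sum_(0 <= l <oo) far j l ^+ 2 <= P ^+ 2.
Proof.
rewrite nneseries_interchange; last by move=> j l; exact: expe_ge0.
apply: le_trans (sum_sqre_le farF_ge0).
apply: lee_nneseries => [l _ _|l _].
  by apply: nneseries_ge0 => j _ _; exact: expe_ge0.
rewrite (eq_eseriesr (g := fun j => ((far_coef l) ^+ 2)%:E *
  (\int[leb]_(z in B l.+2) `|f j z|%:E) ^+ 2)); last by move=> j _; exact: sqreMl.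
rewrite nneseriesZl; last by move=> j _; apply: expe_ge0; exact: integral_ge0.
rewrite /farF sqreMl; apply: lee_wpmul2l; first by rewrite lee_fin sqr_ge0.
have nf0 j z : 0 <= `|f j z|%:E by [].
have mnf j : measurable_fun setT (fun z => `|f j z|%:E).
  by apply/measurable_EFinP; apply: measurableT_comp.
have := minkowski_integral leb (measurable_eball y0 (3 ^+ l.+2 * r)%R) nf0 mnf.
congr (_ <= _ ^+ 2); apply: eq_integral => z _; rewrite /F /l2sum; congr (_ `^ _).
by apply: eq_eseriesr => j _; rewrite -abse_EFin abse_id.
Qed.

Let G x := l2_norm (fun j => square_function gamma (f j)) x.

Let G_ge0 x : 0 <= G x. Proof. exact: poweR_ge0. Qed.

Let sqr_G x : eball y0 r x -> G x ^+ 2 <=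
  Kn%:E * ((K ^+ 2)%:E * (\sum_(tau : {ffun 'I_n -> bool}) Q tau x) + P ^+ 2).
Proof.
move=> xB; rewrite /G -[l2_norm _ x]/(l2sum (fun j => square_function gamma (f j) x)) sqr_l2sum.
have o0 tau j i : 0 <= osc tau j i x ^+ 2 by exact: expe_ge0.
have so0 j i : 0 <= \sum_(tau : {ffun 'I_n -> bool}) osc tau j i x ^+ 2.
  exact: sume_ge0.
have sso0 j : 0 <= \sum_(0 <= i <oo) \sum_(tau : {ffun 'I_n -> bool}) osc tau j i x ^+ 2.
  exact: nneseries_ge0.
have f20 j l : 0 <= far j l ^+ 2 by exact: expe_ge0.
have sf0 j : 0 <= \sum_(0 <= l <oo) far j l ^+ 2 by exact: nneseries_ge0.
have K20 : 0 <= (K ^+ 2)%:E by rewrite lee_fin sqr_ge0.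
have Kso0 j : 0 <= (K ^+ 2)%:E *
    \sum_(0 <= i <oo) \sum_(tau : {ffun 'I_n -> bool}) osc tau j i x ^+ 2 by exact: mule_ge0.
apply: (@le_trans _ _ (\sum_(0 <= j <oo) Kn%:E * ((K ^+ 2)%:E *
  (\sum_(0 <= i <oo) \sum_(tau : {ffun 'I_n -> bool}) osc tau j i x ^+ 2) +
    \sum_(0 <= l <oo) far j l ^+ 2))).
  apply: lee_nneseries => [j _ _|j _]; first exact: expe_ge0.
  rewrite gee0_abs; last exact: poweR_ge0.
  exact: sqr_square_function_osc.
rewrite nneseriesZl; last by move=> j _; exact: adde_ge0.
apply: lee_wpmul2l; first by rewrite lee_fin ltW.
rewrite nneseriesD//; apply: leeD; last exact: sum_far.
rewrite nneseriesZl//; apply: lee_wpmul2l => //.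
rewrite le_eqVlt; apply/orP; left; apply/eqP.
under eq_eseriesr do rewrite nneseries_sum//.
rewrite nneseries_sum; last by move=> *; exact: nneseries_ge0.
by apply: eq_bigr => tau _; rewrite nneseries_interchange.
Qed.

Let T : R := grid_count R n.
Let c1 : R := near_level R n.
Let c2 : R := far_const R n.

Let T_ge1 : (1 <= T)%R.
Proof. by rewrite /T /grid_count ler1n; apply/card_gt0P; exists [ffun=> false]. Qed.

Let K_ge1 : (1 <= K)%R.
Proof.
have n1 : (1 <= n%:R :> R)%R by rewrite ler1n.
have e1 : (1 <= 24 ^+ n :> R)%R by rewrite exprn_ege1// ler1n.
rewrite /K /oscillation_factor; apply: mulr_ege1 => //; lra.
Qed.

Let Kn_ge1 : (1 <= Kn)%R.
Proof. by rewrite /Kn /cone_factor mulr_ege1// exprn_ege1// ler1n. Qed.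

Let c2_ge1 : (1 <= c2)%R. Proof.
have := Kn_ge1; rewrite /c2 /far_const -/Kn; lra.
Qed.
Let c1_ge1 : (1 <= c1)%R.
Proof. by rewrite /c1 /near_level -/Kn -/K -/T !mulr_ege1// ?exprn_ege1// ler1n. Qed.

Let large_G (lam : R) x : (0 < lam)%R -> eball y0 r x -> lam%:E < G x ->
  (exists tau, (lam / c1)%:E ^+ 2 < Q tau x) \/ lam%:E < c2%:E * P.
Proof.
move=> lam0 xB lG.
have [|Pl] := ltP lam%:E (c2%:E * P); [by right|left].
apply: contrapT => /forallNP Qsmall.
have Ql tau : Q tau x <= ((lam / c1) ^+ 2)%:E.
  by rewrite EFin_expe leNgt; apply/negP; exact: Qsmall.
have c10 : (0 < c1)%R by exact: lt_le_trans c1_ge1.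
have c20 : (0 < c2)%R by exact: lt_le_trans c2_ge1.
have lG2 : (lam%:E) ^+ 2 < G x ^+ 2.
  have l0 : 0 <= lam%:E by rewrite lee_fin ltW.
  rewrite ltNge; apply/negP => /(le_of_sqre (G_ge0 x) l0).
  by apply/negP; rewrite -ltNge.
have := lt_le_trans lG2 (sqr_G xB); apply/negP; rewrite -leNgt.
have Ple : P ^+ 2 <= ((lam / c2) ^+ 2)%:E.
  rewrite EFin_expe; apply: le_sqre => //.
  rewrite -(@lee_pmul2l _ c2%:E) ?lte_fin//; apply: le_trans Pl _.
  by rewrite -EFinM lee_fin mulrC divfK// gt_eqF.
have Qle : \sum_(tau : {ffun 'I_n -> bool}) Q tau x <= (T * (lam / c1) ^+ 2)%:E.
  apply: (@le_trans _ _ (\sum_(tau : {ffun 'I_n -> bool}) ((lam / c1) ^+ 2)%:E)).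
    exact: lee_sum.
  by rewrite sumEFin sumr_const /T /grid_count lee_fin [leRHS]mulr_natl.
apply: (@le_trans _ _ (Kn%:E * ((K ^+ 2)%:E * (T * (lam / c1) ^+ 2)%:E +
    ((lam / c2) ^+ 2)%:E))).
  apply: lee_wpmul2l; first by rewrite lee_fin ltW.
  by apply: leeD => //; apply: lee_wpmul2l => //; rewrite lee_fin sqr_ge0.
rewrite -(EFinM (K ^+ 2)%R) -EFinD -EFinM -EFin_expe lee_fin.
have T0 : (0 < T)%R by exact: lt_le_trans T_ge1.
have K0 : (0 < K)%R by exact: lt_le_trans K_ge1.
have -> : (Kn * (K ^+ 2 * (T * (lam / c1) ^+ 2) + (lam / c2) ^+ 2) =
  lam ^+ 2 * (2^-1 / c1 + 2^-1 / c2))%R.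
  rewrite /c1 /c2 /near_level /far_const -/Kn -/K -/T; field; rewrite !gt_eqF//.
rewrite ler_piMr ?sqr_ge0//.
have i1 : (c1^-1 <= 1)%R by rewrite invf_le1.
have i2 : (c2^-1 <= 1)%R by rewrite invf_le1.
lra.
Qed.

Let wt0 : (0 < weak_type_const (3 ^+ n) (C * (2 * n%:R) ^+ n) (root_ratio gamma))%R.
Proof.
apply: weak_type_const_gt0; rewrite ?root_ratio_gt0 ?root_ratio_lt1// ?exprn_gt0//.
by rewrite mulr_gt0// exprn_gt0// mulr_gt0// ltr0n.
Qed.

Let W := (fun x => (w x)%:E).

Let weak_Q (lam : R) tau : (0 < lam)%R ->
  lam%:E * \int[leb]_(x in [set x | (lam / c1)%:E ^+ 2 < Q tau x]) (w x)%:E <=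
  (c1 * weak_type_const (3 ^+ n) (C * (2 * n%:R) ^+ n) (root_ratio gamma))%:E *
  \int[leb]_(x in B 1) (F x * (w x)%:E).
Proof.
move=> lam0.
have c10 : (0 < c1)%R by exact: lt_le_trans c1_ge1.
have lc0 : (0 < lam / c1)%R by rewrite divr_gt0.
have N1 : (1 <= 3 ^+ n :> R)%R by rewrite exprn_ege1// ler1n.
have Cn0 : (0 < C * (2 * n%:R) ^+ n)%R by rewrite mulr_gt0// exprn_gt0// mulr_gt0// ltr0n.
have H := @weak_type_oscillation _ (Rn R n) R leb (level_index tau rho) (level_volume n rho)
  (3 ^+ n)%R (measurable_level tau rho0) (level_volume_gt0 n rho0)
  (leb_level_cell tau rho0) (level_indexS rho0) (level_volumeS n rho)
  N1 g gi _ lc0 w (fun x => ltW (weight_gt0 ww x)) (measurable_weight ww) _ Cn0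
  (fun i => A1_grid n0 ww HC tau (mesh_gt0 rho0 i)) _
  (root_ratio_gt0 gamma) (root_ratio_lt1 gamma_gt0).
apply: (le_trans (lee_wpmul2l _ H)); first by rewrite lee_fin ltW.
rewrite muleA -EFinM.
have -> : (lam * (weak_type_const (3 ^+ n) (C * (2 * n%:R) ^+ n) (root_ratio gamma)
    / (lam / c1)) =
   c1 * weak_type_const (3 ^+ n) (C * (2 * n%:R) ^+ n) (root_ratio gamma))%R.
  by field; rewrite !gt_eqF.
apply: lee_wpmul2l.
  by rewrite lee_fin ltW// mulr_gt0.
rewrite [leRHS]integral_mkcond; apply: ge0_le_lower_integral => x _.
  by apply: mule_ge0; [exact: weight_ge0|exact: l2sum_ge0].
rewrite patchE /B expr1 /g.
case: ifPn => [xB|xB].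
  rewrite muleC le_eqVlt; apply/orP; left; apply/eqP; congr (_ * _).
  rewrite /F /l2sum; congr (_ `^ _); apply: eq_eseriesr => j _.
  by rewrite indicE xB mulr1.
rewrite [X in _ * X](_ : _ = 0) ?mule0//.
rewrite /l2sum eseries0 ?poweR0r ?invr_neq0// => j _ _.
by rewrite indicE (negbTE xB) mulr0 abse0 expe2 mule0.
Qed.

(** The near part is controlled by the superlevel sets of the grids. The far part [P] is the same
    number for all points of the ball, so it puts either the whole ball or nothing into the
    superlevel set. *)
Let weak_local0 (lam : R) : (0 < lam)%R ->
  lam%:E * wmeas w [set x | eball y0 r x /\ lam%:E < G x] <=
  (T * (c1 * weak_type_const (3 ^+ n) (C * (2 * n%:R) ^+ n) (root_ratio gamma)))%:E *
    \int[leb]_(x in B 1) (F x * (w x)%:E) +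
  wmeas w (eball y0 r) * (c2%:E * P).
Proof.
move=> lam0.
have w0 := weight_ge0 ww.
have c20 : (0 < c2)%R by exact: lt_le_trans c2_ge1.
pose S tau := [set x | (lam / c1)%:E ^+ 2 < Q tau x].
have mS tau : measurable (S tau).
  have := emeasurable_fun_o_infty measurableT (mQ tau) ((lam / c1)%:E ^+ 2).
  by rewrite setTI.
have mW := measurable_weightE ww.
pose k := ind (lam%:E < c2%:E * P) : \bar R.
have k0 : 0 <= k by exact: ind_ge0.
have mB := measurable_eball y0 r.
have ms tau : measurable_fun setT (fun x => (W \_ (S tau)) x).
  by apply/(measurable_restrictT _ (mS tau)); exact: measurable_funTS.
have mb : measurable_fun setT (fun x => (W \_ (eball y0 r)) x).
  by apply/(measurable_restrictT _ mB); exact: measurable_funTS.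
have s0 A x : 0 <= (W \_ A) x by rewrite patchE; case: ifP => // _; exact: w0.
have H : wmeas w [set x | eball y0 r x /\ lam%:E < G x] <=
  \sum_(tau : {ffun 'I_n -> bool}) wmeas w (S tau) + wmeas w (eball y0 r) * k.
  (* The superlevel set of [G] is not known to be measurable, so its indicator is dominated by a sum
     of measurable ones before integrating. *)
  rewrite {1}/wmeas integral_mkcond.
  apply: (@le_trans _ _ (\int[leb]_x (\sum_(tau : {ffun 'I_n -> bool}) (W \_ (S tau)) x +
      k * (W \_ (eball y0 r)) x))).
    apply: ge0_le_lower_integral => x _; first exact: s0.
    have t0 : 0 <= \sum_(tau : {ffun 'I_n -> bool}) (W \_ (S tau)) x.
      by apply: sume_ge0 => tau _; exact: s0.
    have t1 : 0 <= k * (W \_ (eball y0 r)) x by apply: mule_ge0.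
    rewrite {1}patchE; case: ifPn => [|_]; last exact: adde_ge0.
    rewrite inE => -[xB lG].
    have [[tau Qtau]|lP] := large_G lam0 xB lG.
      apply: le_trans (leeDl _ t1).
      apply: le_trans (term_le_sum (a := fun t => (W \_ (S t)) x) tau (fun t => s0 _ x)).
      by rewrite patchE ifT// inE.
    apply: le_trans (leeDr _ t0); rewrite /k lP /ind mul1e patchE ifT//.
    by rewrite inE.
  have ks0 x : setT x -> 0 <= k * (W \_ (eball y0 r)) x by move=> _; exact: mule_ge0.
  have ss0 x : setT x -> 0 <= \sum_(tau : {ffun 'I_n -> bool}) (W \_ (S tau)) x.
    by move=> _; apply: sume_ge0 => tau _; exact: s0.
  have ms1 : measurable_fun setT
      (fun x => \sum_(tau : {ffun 'I_n -> bool}) (W \_ (S tau)) x).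
    exact: emeasurable_sum.
  rewrite (ge0_integralD leb measurableT ss0 ms1 ks0 (measurable_funeM k mb)).
  rewrite (ge0_integral_sum leb measurableT ms); last by move=> tau x _; exact: s0.
  rewrite (ge0_integralZl _ measurableT mb _ k0); last by move=> x _; exact: s0.
  apply: leeD.
    by apply: lee_sum => tau _; rewrite -integral_mkcond.
  by rewrite -integral_mkcond muleC.
apply: (@le_trans _ _ (lam%:E * (\sum_(tau : {ffun 'I_n -> bool}) wmeas w (S tau) +
  wmeas w (eball y0 r) * k))).
  by apply: lee_wpmul2l => //; rewrite lee_fin ltW.
have wk0 : 0 <= wmeas w (eball y0 r) * k by apply: mule_ge0 => //; exact: wmeas_ge0.
have sw0 : 0 <= \sum_(tau : {ffun 'I_n -> bool}) wmeas w (S tau).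
  by apply: sume_ge0 => tau _; exact: wmeas_ge0.
rewrite (ge0_muleDr _ sw0 wk0); apply: leeD.
  rewrite ge0_sume_distrr; last by move=> tau _; exact: wmeas_ge0.
  apply: (@le_trans _ _ (\sum_(tau : {ffun 'I_n -> bool})
    ((c1 * weak_type_const (3 ^+ n) (C * (2 * n%:R) ^+ n) (root_ratio gamma))%:E *
      \int[leb]_(x in B 1) (F x * (w x)%:E)))).
    by apply: lee_sum => tau _; exact: weak_Q.
  rewrite -ge0_sume_distrl; last first.
    move=> tau _; have c10 : (0 < c1)%R by exact: lt_le_trans c1_ge1.
    by rewrite lee_fin ltW// mulr_gt0.
  by rewrite sumEFin sumr_const /T /grid_count -[X in X%:E * _ <= _]mulr_natl.
rewrite muleCA; apply: lee_wpmul2l; first exact: wmeas_ge0.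
rewrite /k; have [lP|_] := boolP (lam%:E < c2%:E * P).
  by rewrite /ind mule1 ltW.
by rewrite /ind mule0 mule_ge0// lee_fin ltW.
Qed.

Lemma weak_local (lam : R) : (0 < lam)%R ->
  lam%:E * wmeas w [set x | eball y0 r x /\
     lam%:E < l2_norm (fun j => square_function gamma (f j)) x] <=
  (near_const n gamma C)%:E *
    \int[leb]_(x in eball y0 (3 * r)) (l2sum (fun j => (f j x)%:E) * (w x)%:E) +
  wmeas w (eball y0 r) * ((far_const R n)%:E * \sum_(0 <= l <oo)
    (3 * (r * 3 ^+ l) ^- n)%:E *
      \int[leb]_(x in eball y0 (3 ^+ l.+2 * r)) l2sum (fun j => (f j x)%:E)).
Proof. exact: weak_local0. Qed.

End local_estimate.

(** * Summation over dilated balls *)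

Lemma le_poweR (R : realType) (x y : \bar R) (r : R) : (0 <= r)%R -> 0 <= x ->
  x <= y -> x `^ r <= y `^ r.
Proof.
move=> r0 x0 xy; apply: gt0_ler_poweR => //; rewrite in_itv/= leey andbT//.
exact: le_trans xy.
Qed.

Lemma poweRK (R : realType) (x : \bar R) (r : R) : (r != 0)%R -> 0 <= x ->
  (x `^ r) `^ r^-1 = x.
Proof. by move=> r0 x0; rewrite -poweRrM divff// poweRe1. Qed.

Lemma poweRVK (R : realType) (x : \bar R) (r : R) : (r != 0)%R -> 0 <= x ->
  (x `^ r^-1) `^ r = x.
Proof. by move=> r0 x0; rewrite -poweRrM mulVf// poweRe1. Qed.

Section geometric_majorant.
Context d (X : measurableType d) (R : realType) (mu : {measure set X -> \bar R}).
Variables (A eta : R) (h : X -> \bar R) (t : nat -> X -> \bar R) (M : \bar R).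
Hypothesis A0 : (0 <= A)%R.
Hypothesis eta0 : (0 < eta)%R.
Hypothesis eta1 : (eta < 1)%R.
Hypothesis h0 : forall x, 0 <= h x.
Hypothesis t0 : forall l x, 0 <= t l x.
Hypothesis ht : forall x, h x <= A%:E * \sum_(0 <= l <oo) ((eta ^+ 2) ^+ l)%:E * t l x.

Let et l x := (eta ^+ l)%:E * t l x.

Let etal l : 0 <= (eta ^+ l)%:E.
Proof. by rewrite lee_fin exprn_ge0// ltW. Qed.

Let et0 l x : 0 <= et l x.
Proof. exact: mule_ge0 (etal l) (t0 l x). Qed.

Let head : R := (A * (1 - eta)^-1)%R.

Let head0 : (0 <= head)%R.
Proof. by rewrite mulr_ge0// invr_ge0 subr_ge0 ltW. Qed.

(** The weight [eta ^+ 2] is split: one [eta ^+ l] sums the series, the other remains in [et l x],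
    whose supremum over [l] is what is estimated. *)
Let h_le x (m : \bar R) : 0 <= m -> (forall l, et l x <= m) -> h x <= head%:E * m.
Proof.
move=> m0 em; apply: le_trans (ht x) _; rewrite /head EFinM -muleA.
apply: lee_wpmul2l; first by rewrite lee_fin.
apply: le_trans (geometric_sum_le eta0 eta1 (fun l => et0 l x) m0 em).
rewrite le_eqVlt; apply/orP; left; apply/eqP; apply: eq_eseriesr => l _.
by rewrite /et muleA -EFinM -exprM mulnC exprM expr2.
Qed.

Lemma ess_sup_geometric : (forall l, ess_sup mu (t l) <= M) -> 0 <= M ->
  ess_sup mu h <= head%:E * M.
Proof.
move=> tM M0; apply/ess_supP.
have : \forall x \ae mu, forall l, t l x <= M.
  by apply: ae_foralln => l; apply/ess_supP; exact: tM.
apply: filterS => x tMx; apply: h_le => // l.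
apply: le_trans (tMx l); rewrite -[leRHS]mul1e; apply: lee_wpmul2r => //.
by rewrite lee_fin exprn_ile1// ltW.
Qed.

Variables (q : R) (m : X -> R).
Hypothesis q0 : (0 < q)%R.
Hypothesis m0 : forall x, (0 <= m x)%R.
Hypothesis mm : measurable_fun setT m.
Hypothesis mt : forall l, measurable_fun setT (t l).
Hypothesis tM : forall l, (\int[mu]_x (t l x `^ q * (m x)%:E)) `^ q^-1 <= M.

Let m0e x : 0 <= (m x)%:E. Proof. by rewrite lee_fin. Qed.

Let mme : measurable_fun setT (fun x => (m x)%:E).
Proof. exact/measurable_EFinP. Qed.

Let M0 : 0 <= M. Proof. exact: le_trans (poweR_ge0 _ _) (tM 0). Qed.

Let q_neq0 : q != 0%R. Proof. by rewrite gt_eqF. Qed.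

(** The supremum over [l] of [et l x] is at most the q-th root of this sum, whose integral is
    computed by Tonelli; this takes the place of the triangle inequality in L^q. *)
Let U x := \sum_(0 <= l <oo) et l x `^ q.

Let U0 x : 0 <= U x.
Proof. by apply: nneseries_ge0 => l _ _; exact: poweR_ge0. Qed.

Let powh_le x : h x `^ q <= (head `^ q)%:E * U x.
Proof.
have s0 : 0 <= U x `^ q^-1 by exact: poweR_ge0.
have hq : h x <= head%:E * U x `^ q^-1.
  apply: h_le => // l; rewrite -[leLHS](poweRK q_neq0)//.
  apply: le_poweR; rewrite ?poweR_ge0// ?invr_ge0 ?(ltW q0)//.
  exact: (term_le_nneseries (a := fun l => et l x `^ q) l (fun l => poweR_ge0 _ _)).
apply: le_trans (le_poweR (ltW q0) (h0 x) hq) _.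
by rewrite poweRM ?lee_fin// poweRVK.
Qed.

Let etaq : R := (eta `^ q)%R.

Let etaq0 : (0 < etaq)%R. Proof. exact: powR_gt0. Qed.

Let etaq1 : (etaq < 1)%R.
Proof.
have : (eta `^ q < 1 `^ q)%R.
  by apply: gt0_ltr_powR; rewrite ?nnegrE ?(ltW eta0)//.
by rewrite powR1.
Qed.

Let et_pow l x : et l x `^ q = (etaq ^+ l)%:E * t l x `^ q.
Proof.
rewrite /et poweRM//= /etaq; congr (_%:E * _).
rewrite -(powR_mulrn l (ltW eta0)) -(powR_mulrn l (powR_ge0 eta q)).
by rewrite -powRrM -[RHS]powRrM (mulrC q).
Qed.

Let integral_le :
  \int[mu]_x (h x `^ q * (m x)%:E) <= (head `^ q * (1 - etaq)^-1)%:E * M `^ q.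
Proof.
have mtq l : measurable_fun setT (fun x => t l x `^ q).
  exact: (measurableT_comp (measurable_poweR q) (mt l)).
have mtm l : measurable_fun setT (fun x => t l x `^ q * (m x)%:E).
  exact: emeasurable_funM (mtq l) mme.
have tm0 l x : 0 <= t l x `^ q * (m x)%:E by exact: mule_ge0 (poweR_ge0 _ _) (m0e x).
have eq0 l : 0 <= (etaq ^+ l)%:E by rewrite lee_fin exprn_ge0// ltW.
have hq0 : 0 <= (head `^ q)%:E by rewrite lee_fin powR_ge0.
have e0 l x : 0 <= (etaq ^+ l)%:E * (t l x `^ q * (m x)%:E) by exact: mule_ge0.
have me l : measurable_fun setT (fun x => (etaq ^+ l)%:E * (t l x `^ q * (m x)%:E)).
  exact: measurable_funeM.
have Um x : U x * (m x)%:E = \sum_(0 <= l <oo) (etaq ^+ l)%:E * (t l x `^ q * (m x)%:E).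
  rewrite muleC -nneseriesZl; last by move=> l _; exact: poweR_ge0.
  by apply: eq_eseriesr => l _; rewrite et_pow muleCA (muleC (m x)%:E).
apply: (@le_trans _ _ (\int[mu]_x ((head `^ q)%:E *
    \sum_(0 <= l <oo) (etaq ^+ l)%:E * (t l x `^ q * (m x)%:E)))).
  apply: ge0_le_lower_integral => x _; first exact: mule_ge0 (poweR_ge0 _ _) (m0e x).
  by rewrite -Um muleA; apply: lee_wpmul2r => //; exact: powh_le.
rewrite (ge0_integralZl _ measurableT _ _ hq0); first last.
- by move=> x _; exact: nneseries_ge0.
- by apply: ge0_emeasurable_sum => [l x _ _|l _]; [exact: e0|exact: me].
rewrite EFinM -muleA; apply: lee_wpmul2l => //.
rewrite integral_nneseries//.
under eq_eseriesr do rewrite (ge0_integralZl _ measurableT (mtm _) (fun x _ => tm0 _ x) (eq0 _)).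
apply: geometric_sum_le => //.
- by move=> l; exact: integral_ge0.
- exact: poweR_ge0.
move=> l; have i0 : 0 <= \int[mu]_x (t l x `^ q * (m x)%:E) by exact: integral_ge0.
by rewrite -(poweRVK q_neq0 i0); apply: le_poweR; rewrite ?(ltW q0)// poweR_ge0.
Qed.

Lemma Lq_geometric : (\int[mu]_x (h x `^ q * (m x)%:E)) `^ q^-1 <=
  (A * (1 - eta)^-1 * ((1 - eta `^ q)^-1) `^ q^-1)%:E * M.
Proof.
have i0 : 0 <= \int[mu]_x (h x `^ q * (m x)%:E).
  by apply: integral_ge0 => x _; exact: mule_ge0 (poweR_ge0 _ _) (m0e x).
have qi : (0 <= q^-1)%R by rewrite invr_ge0 ltW.
apply: le_trans (le_poweR qi i0 integral_le) _.
have c0 : (0 <= (1 - etaq)^-1)%R by rewrite invr_ge0 subr_ge0 ltW.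
rewrite poweRM ?poweR_ge0//; last by rewrite lee_fin mulr_ge0// powR_ge0.
rewrite poweRK// poweR_EFin powRM ?powR_ge0//.
by rewrite -powRrM divff// powRr1.
Qed.

End geometric_majorant.

Section local_constant.
Variables (R : realType) (n : nat).
Hypothesis n0 : (0 < n)%N.
Variables gamma C : R.
Hypothesis gamma_gt0 : (0 < gamma)%R.
Hypothesis C0 : (0 < C)%R.

Lemma far_const_ge0 : (0 <= far_const R n)%R.
Proof. by rewrite /far_const /cone_factor !mulr_ge0// exprn_ge0. Qed.

Lemma near_const_ge0 : (0 <= near_const n gamma C)%R.
Proof.
have nn : (0 < n%:R :> R)%R by rewrite ltr0n.
rewrite /near_const /near_level /cone_factor /oscillation_factor /grid_count.
rewrite !mulr_ge0// ?exprn_ge0// ?mulr_ge0// ?exprn_ge0//.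
apply: ltW; apply: weak_type_const_gt0; rewrite ?root_ratio_gt0 ?root_ratio_lt1// ?exprn_gt0//.
by rewrite mulr_gt0// exprn_gt0// mulr_gt0.
Qed.

(** Doubling absorbs the ball of radius [3 * r] into the term [l = 1]; in the far part, 9 is the
    ratio between the radius [3 ^+ l.+2 * r] of the ball and the scale [r * 3 ^+ l] of the
    kernel. *)
Definition local_const : R := (near_const n gamma C * (C * (3 * n%:R / 2) ^+ n) +
  far_const R n * (3 * 9 ^+ n * C))%R.

Lemma local_const_ge0 : (0 <= local_const)%R.
Proof.
rewrite /local_const addr_ge0// mulr_ge0 ?near_const_ge0 ?far_const_ge0//.
  by rewrite mulr_ge0 ?(ltW C0)// exprn_ge0// mulr_ge0.
by rewrite !mulr_ge0 ?exprn_ge0 ?(ltW C0).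
Qed.

Definition annulus_ratio (a : R) : R := ((1 - annulus_share n C) `^ a)%R.

End local_constant.

Lemma L1_norm_restrict (R : realType) (n : nat) (w : Rn R n -> R) (F : Rn R n -> \bar R)
    (B : set (Rn R n)) : (forall x, 0 <= F x) ->
  L1_norm w (F \_ B) = \int[leb]_(x in B) (F x * (w x)%:E).
Proof.
move=> F0; rewrite /L1_norm [RHS]integral_mkcond; apply: eq_integral => x _.
by rewrite !patchE; case: ifP => _; rewrite ?abse0 ?mul0e// gee0_abs.
Qed.

Section local_comparison.
Variables (R : realType) (n : nat).
Hypothesis n0 : (0 < n)%N.
Variables (gamma : R).
Hypothesis gamma_gt0 : (0 < gamma)%R.
Hypothesis gamma_le1 : (gamma <= 1)%R.
Variable w : Rn R n -> R.
Hypothesis ww : weight w.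
Variable C : R.
Hypothesis C0 : (0 < C)%R.
Hypothesis HC : A1_bound w C.
Variable f : nat -> Rn R n -> R.
Hypothesis fl : forall j, loc_integrable (f j).
Implicit Types x y z : Rn R n.

Let F := l2_norm (fun j x => (f j x)%:E).
Let G := l2_norm (fun j => square_function gamma (f j)).
Let J y r := \int[leb]_(x in eball y r) (F x * (w x)%:E).
Let W y r := ball_weight w y r.

Let F_ge0 x : 0 <= F x. Proof. exact: l2sum_ge0. Qed.

Let mF : measurable_fun setT F.
Proof.
apply: (measurable_l2sum (g := fun j x => (f j x)%:E)) => j.
by apply/measurable_EFinP; case: (fl j).
Qed.

Let G_ge0 x : 0 <= G x. Proof. exact: poweR_ge0. Qed.

Let J_ge0 y r : 0 <= J y r.
Proof.
apply: integral_ge0 => x _; exact: mule_ge0 (F_ge0 x) (weight_ge0 ww x).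
Qed.

Let superlevel_restrict y r (lam : R) : (0 < lam)%R ->
  [set x | lam%:E < `|(G \_ (eball y r)) x|] = [set x | eball y r x /\ lam%:E < G x].
Proof.
move=> lam0; apply/seteqP; split => x /=; rewrite patchE.
  case: ifPn => [|_]; first by rewrite inE gee0_abs.
  by rewrite abse0 lte_fin => /(lt_trans lam0); rewrite ltxx.
by move=> [xB lG]; rewrite ifT ?inE// gee0_abs.
Qed.

Let term y r l := (W y r / W y (3 ^+ l * r))%:E * J y (3 ^+ l * r).

Section one_ball.
Variables (y : Rn R n) (r : R).
Hypothesis r0 : (0 < r)%R.

Let rl l : (0 < 3 ^+ l * r)%R. Proof. by rewrite mulr_gt0// exprn_gt0. Qed.

Let W0 : (0 < W y r)%R. Proof. exact: ball_weight_gt0. Qed.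
Let Wl l : (0 < W y (3 ^+ l * r))%R. Proof. exact: ball_weight_gt0. Qed.

Let term_ge0 l : 0 <= term y r l.
Proof. by apply: mule_ge0 => //; rewrite lee_fin divr_ge0// ltW. Qed.

Let average_le l : \int[leb]_(x in eball y (3 ^+ l * r)) F x <=
  (C * (3 ^+ l * r) ^+ n / W y (3 ^+ l * r))%:E * J y (3 ^+ l * r).
Proof.
have := A1_average ww C0 HC (rl l) (measurable_eball y (3 ^+ l * r)%R)
  (fun x h => h) mF F_ge0.
rewrite -ball_weightE// -/(W _ _) -/(J _ _) -lee_pdivlMl//.
by rewrite muleA -EFinM (mulrC (W _ _)^-1%R).
Qed.

Let near_le : J y (3 * r) <=
  (C * (3 * n%:R / 2) ^+ n)%:E * \sum_(0 <= l <oo) term y r l.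
Proof.
have Cn0 : (0 <= C * (3 * n%:R / 2) ^+ n)%R.
  by rewrite mulr_ge0 ?(ltW C0)// exprn_ge0// mulr_ge0.
apply: le_trans (lee_wpmul2l _ (term_le_nneseries (a := term y r) 1 term_ge0)); last first.
  by rewrite lee_fin.
rewrite /term expr1 muleA -EFinM -[leLHS]mul1e; apply: lee_wpmul2r => //.
rewrite lee_fin mulrA ler_pdivlMr ?mul1r; first exact: ball_weight_doubling.
by have := Wl 1; rewrite expr1.
Qed.

(** A1 converts each Lebesgue average of [F] into its [w]-average over the same ball; the index
    shift by 2 only drops terms of the series. *)
Let far_le : wmeas w (eball y r) * ((far_const R n)%:E * \sum_(0 <= l <oo)
    (3 * (r * 3 ^+ l) ^- n)%:E *
      \int[leb]_(x in eball y (3 ^+ l.+2 * r)) F x) <=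
  (far_const R n * (3 * 9 ^+ n * C))%:E * \sum_(0 <= l <oo) term y r l.
Proof.
have fc := far_const_ge0 R n.
have p0 l : (0 <= 3 * (r * 3 ^+ l) ^- n :> R)%R.
  by rewrite mulr_ge0// invr_ge0 exprn_ge0// mulr_ge0 ?exprn_ge0// ltW.
have i0 l : 0 <= \int[leb]_(x in eball y (3 ^+ l.+2 * r)) F x.
  by apply: integral_ge0 => x _; exact: F_ge0.
have c0 : (0 <= 3 * 9 ^+ n * C)%R by rewrite !mulr_ge0 ?exprn_ge0// ltW.
rewrite muleCA (EFinM (far_const R n)) -[leRHS]muleA; apply: lee_wpmul2l; first by rewrite lee_fin.
have shift : \sum_(0 <= l <oo) term y r (l + 2) <= \sum_(0 <= l <oo) term y r l.
  exact: nneseries_shift_le.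
apply: le_trans (lee_wpmul2l _ shift); last by rewrite lee_fin.
rewrite -(ball_weightE ww) -nneseriesZl; last first.
  by move=> l _; apply: mule_ge0 (i0 l); rewrite lee_fin.
rewrite -nneseriesZl; last by move=> l _; exact: term_ge0.
apply: lee_nneseries => [l _ _|l _].
  apply: mule_ge0; first by rewrite lee_fin ltW.
  by apply: mule_ge0 (i0 l); rewrite lee_fin.
apply: (@le_trans _ _ ((W y r)%:E * ((3 * (r * 3 ^+ l) ^- n)%:E *
  ((C * (3 ^+ l.+2 * r) ^+ n / W y (3 ^+ l.+2 * r))%:E * J y (3 ^+ l.+2 * r))))).
  apply: lee_wpmul2l; first by rewrite lee_fin ltW.
  by apply: lee_wpmul2l; [rewrite lee_fin|exact: average_le].
rewrite /term addn2 !muleA -!EFinM; apply: lee_wpmul2r => //.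
rewrite lee_fin le_eqVlt; apply/orP; left; apply/eqP.
have q0 : (0 < (r * 3 ^+ l) ^+ n)%R by rewrite exprn_gt0// mulr_gt0// exprn_gt0.
move: (W y (3 ^+ l.+2 * r)%R) (Wl l.+2) => v v0.
have -> : (3 ^+ l.+2 * r = 9 * (r * 3 ^+ l) :> R)%R by rewrite !exprS; ring.
rewrite (exprMn _ 9%R); move: ((r * 3 ^+ l) ^+ n)%R q0 => b b0.
by field; rewrite !gt_eqF.
Qed.

Lemma local_weak_le : weakL1_norm w (G \_ (eball y r)) <=
  (local_const n gamma C)%:E * \sum_(0 <= l <oo) term y r l.
Proof.
have s0 : 0 <= \sum_(0 <= l <oo) term y r l by apply: nneseries_ge0 => l _ _.
have nc := near_const_ge0 n0 gamma_gt0 C0.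
apply: ge_ereal_sup => _ [lam /= lam0 <-].
rewrite superlevel_restrict//.
apply: le_trans (weak_local n0 gamma_gt0 gamma_le1 ww C0 HC fl y r0 lam0) _.
have d1 : 0 <= (near_const n gamma C * (C * (3 * n%:R / 2) ^+ n))%:E.
  by rewrite lee_fin mulr_ge0// mulr_ge0 ?(ltW C0)// exprn_ge0// mulr_ge0.
have d2 : 0 <= (far_const R n * (3 * 9 ^+ n * C))%:E.
  by rewrite lee_fin mulr_ge0 ?far_const_ge0// !mulr_ge0 ?exprn_ge0 ?(ltW C0).
rewrite /local_const EFinD (ge0_muleDl _ d1 d2).
apply: leeD; last exact: far_le.
rewrite (EFinM (near_const n gamma C)) -[leRHS]muleA.
apply: lee_wpmul2l; first by rewrite lee_fin.
exact: near_le.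
Qed.

Lemma local_comparison (a : R) : (0 < a + 1)%R ->
  wmeas w (eball y r) `^ a * weakL1_norm w (G \_ (eball y r)) <=
  (local_const n gamma C)%:E * \sum_(0 <= l <oo)
    ((annulus_ratio n C (a + 1)) ^+ l)%:E *
    (wmeas w (eball y (3 ^+ l * r)) `^ a * L1_norm w (F \_ (eball y (3 ^+ l * r)))).
Proof.
move=> a1; have lc := local_const_ge0 n0 gamma_gt0 C0.
have share1 : (0 < 1 - annulus_share n C)%R.
  by rewrite subr_gt0 (annulus_share_lt1 n0 ww C0 HC).
have Wa0 : 0 <= (W y r `^ a)%:E by rewrite lee_fin powR_ge0.
rewrite -!ball_weightE// -/(W y r).
apply: le_trans (lee_wpmul2l (poweR_ge0 _ _) local_weak_le) _.
rewrite muleCA; apply: lee_wpmul2l; first by rewrite lee_fin.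
rewrite poweR_EFin -nneseriesZl; last by move=> l _; exact: term_ge0.
apply: lee_nneseries => [l _ _|l _]; first exact: mule_ge0.
rewrite (L1_norm_restrict _ _ F_ge0) -ball_weightE// -/(W _ (3 ^+ l * r)%R) poweR_EFin /term.
rewrite !muleA -!EFinM; apply: lee_wpmul2r => //; rewrite lee_fin.
rewrite mulrA ler_pdivrMr// -mulrA.
have vE (v : R) : (0 < v)%R -> (v `^ a * v = v `^ (a + 1))%R.
  by move=> v0; rewrite powRD ?powRr1 ?(ltW v0)//; apply/implyP => _; rewrite gt_eqF.
rewrite !vE// /annulus_ratio.
have -> : (((1 - annulus_share n C) `^ (a + 1)) ^+ l =
    ((1 - annulus_share n C) ^+ l) `^ (a + 1))%R.
  rewrite -(powR_mulrn l (powR_ge0 _ _)) -(powR_mulrn l (ltW share1)).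
  by rewrite -powRrM -[RHS]powRrM mulrC.
rewrite -powRM ?exprn_ge0 ?(ltW share1) ?(ltW (Wl l))//.
apply: ge0_ler_powR; rewrite ?nnegrE ?(ltW W0) ?(ltW a1)//.
  by rewrite mulr_ge0 ?exprn_ge0 ?(ltW share1) ?(ltW (Wl l)).
exact: (ball_weight_pow n0 ww C0 HC y l r0).
Qed.

End one_ball.
End local_comparison.

(** * Passage to the amalgam norms *)

Section amalgam.
Variables (R : realType) (n : nat).
Variable w : Rn R n -> R.
Hypothesis ww : weight w.

Lemma weakL1_norm_ge0 (g : Rn R n -> \bar R) : 0 <= weakL1_norm w g.
Proof.
apply: le_trans (ereal_sup_ubound _); last by exists 1%R => //=.
by apply: mule_ge0; [rewrite lee_fin|exact: wmeas_ge0].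
Qed.

Lemma L1_norm_ge0 (g : Rn R n -> \bar R) : 0 <= L1_norm w g.
Proof.
by apply: integral_ge0 => x _; apply: mule_ge0 => //; exact: weight_ge0.
Qed.

Lemma measurable_local_L1 (g : Rn R n -> \bar R) (a r : R) :
  measurable_fun setT g -> (forall x, 0 <= g x) ->
  measurable_fun setT (fun y => wmeas w (eball y r) `^ a * L1_norm w (g \_ (eball y r))).
Proof.
move=> mg g0; have mw := measurable_weightE ww; have w0 := weight_ge0 ww.
have m1 : measurable_fun setT (fun y : Rn R n => wmeas w (eball y r) `^ a).
  exact: (measurableT_comp (measurable_poweR a) (measurable_ball_integral r mw w0)).
have m2 : measurable_fun setT (fun y : Rn R n => L1_norm w (g \_ (eball y r))).
  under eq_fun do rewrite L1_norm_restrict//.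
  apply: measurable_ball_integral; first exact: emeasurable_funM.
  by move=> x; exact: mule_ge0 (g0 x) (w0 x).
exact: emeasurable_funM m1 m2.
Qed.

Hypothesis n0 : (0 < n)%N.
Variable C : R.
Hypothesis C0 : (0 < C)%R.
Hypothesis HC : A1_bound w C.

Lemma annulus_ratio_gt0 a : (0 < annulus_ratio n C a)%R.
Proof.
by apply: powR_gt0; rewrite subr_gt0 (annulus_share_lt1 n0 ww C0 HC).
Qed.

Lemma annulus_ratio_lt1 a : (0 < a)%R -> (annulus_ratio n C a < 1)%R.
Proof.
move=> a0; have s0 := annulus_share_gt0 n0 C0.
have s1 : (0 <= 1 - annulus_share n C)%R.
  by rewrite subr_ge0 ltW// (annulus_share_lt1 n0 ww C0 HC).
have : ((1 - annulus_share n C) `^ a < 1 `^ a)%R.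
  by apply: gt0_ltr_powR; rewrite ?nnegrE// gtrBl.
by rewrite powR1.
Qed.

Variables (gamma : R).
Hypothesis gamma_gt0 : (0 < gamma)%R.
Hypothesis gamma_le1 : (gamma <= 1)%R.
Variables (alpha : R) (mu : Rn R n -> R).
Hypothesis alpha_ge1 : (1 <= alpha)%R.
Hypothesis wmu : weight mu.

Let alpha_gt0 : (0 < alpha)%R. Proof. exact: lt_le_trans alpha_ge1. Qed.

Let bounded_by q (K : R) := forall f : nat -> Rn R n -> R,
  (forall j, loc_integrable (f j)) ->
  amalgam_weakL1 alpha q w mu (l2_norm (fun j => square_function gamma (f j))) <=
  K%:E * amalgam_L1 alpha q w mu (l2_norm (fun j x => (f j x)%:E)).

(** A square root, because the geometric majorant takes its decay in the form [eta ^+ 2]; [s] stands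
    for 1/q, and the exponent is 1/alpha - 1/q. *)
Let eta (s : R) : R := Num.sqrt (annulus_ratio n C (alpha^-1 - 1 - s + 1)).

Let exponent_gt0 s : (s < alpha^-1)%R -> (0 < alpha^-1 - 1 - s + 1)%R.
Proof. move=> h; lra. Qed.

Let eta_gt0 s : (0 < eta s)%R.
Proof. by rewrite sqrtr_gt0 annulus_ratio_gt0. Qed.

Let eta_lt1 s : (s < alpha^-1)%R -> (eta s < 1)%R.
Proof.
move=> h; rewrite -[ltRHS]sqrtr1 ltr_sqrt// annulus_ratio_lt1//.
exact: exponent_gt0.
Qed.

Let eta_sqr s : (eta s ^+ 2 = annulus_ratio n C (alpha^-1 - 1 - s + 1))%R.
Proof. by rewrite sqr_sqrtr// ltW// annulus_ratio_gt0. Qed.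

Section one_sequence.
Variable f : nat -> Rn R n -> R.
Hypothesis fl : forall j, loc_integrable (f j).
Variables (s r : R).
Hypothesis s_lt : (s < alpha^-1)%R.
Hypothesis r0 : (0 < r)%R.

Let F := l2_norm (fun j x => (f j x)%:E).
Let G := l2_norm (fun j => square_function gamma (f j)).
Let a := (alpha^-1 - 1 - s)%R.

Let h y := wmeas w (eball y r) `^ a * weakL1_norm w (G \_ (eball y r)).
Let t l y := wmeas w (eball y (3 ^+ l * r)) `^ a *
  L1_norm w (F \_ (eball y (3 ^+ l * r))).

Lemma local_weak_nonneg y : 0 <= h y.
Proof. exact: mule_ge0 (poweR_ge0 _ _) (weakL1_norm_ge0 _). Qed.

Lemma local_L1_nonneg l y : 0 <= t l y.
Proof. exact: mule_ge0 (poweR_ge0 _ _) (L1_norm_ge0 _). Qed.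

Lemma local_L1_measurable l : measurable_fun setT (t l).
Proof.
apply: measurable_local_L1; last by move=> x; exact: l2sum_ge0.
apply: (measurable_l2sum (g := fun j x => (f j x)%:E)) => j.
by apply/measurable_EFinP; case: (fl j).
Qed.

Lemma local_weak_geometric y : h y <=
  (local_const n gamma C)%:E * \sum_(0 <= l <oo) ((eta s ^+ 2) ^+ l)%:E * t l y.
Proof.
rewrite eta_sqr.
exact: (local_comparison n0 gamma_gt0 gamma_le1 ww C0 HC fl y r0 (exponent_gt0 s_lt)).
Qed.

End one_sequence.

Lemma amalgam_bound_fin (q : R) : (alpha < q)%R ->
  exists2 K : R, (0 < K)%R & bounded_by q%:E K.
Proof.
move=> aq; have q0 : (0 < q)%R by exact: lt_trans aq.
have s_lt : (q^-1 < alpha^-1)%R by rewrite ltf_pV2.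
pose K := (local_const n gamma C * (1 - eta q^-1)^-1 *
  ((1 - eta q^-1 `^ q)^-1) `^ q^-1)%R.
have K0 : (0 <= K)%R.
  rewrite mulr_ge0 ?powR_ge0// mulr_ge0 ?local_const_ge0//.
  by rewrite invr_ge0 subr_ge0 ltW// eta_lt1.
exists (K + 1)%R => [|f fl]; first by rewrite ltr_wpDl.
set F := l2_norm (fun j x => (f j x)%:E).
have M_ub (r : R) : (0 < r)%R -> (\int[leb]_y ((wmeas w (eball y r) `^ (alpha^-1 - 1 - q^-1) *
    L1_norm w (F \_ (eball y r))) `^ q * (mu y)%:E)) `^ q^-1 <= amalgam_L1 alpha q%:E w mu F.
  by move=> r0; apply: ereal_sup_ubound; exists r.
have M0 : 0 <= amalgam_L1 alpha q%:E w mu F.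
  by apply: le_trans (M_ub 1%R ltr01); exact: poweR_ge0.
apply: ge_ereal_sup => _ [r /= r0 <-].
apply: (@le_trans _ _ (K%:E * amalgam_L1 alpha q%:E w mu F)); last first.
  by apply: lee_wpmul2r => //; rewrite lee_fin lerDl.
apply: (Lq_geometric (local_const_ge0 n0 gamma_gt0 C0) (eta_gt0 q^-1) (eta_lt1 s_lt)
  (fun y => local_weak_nonneg f q^-1 r y) (fun l y => local_L1_nonneg f q^-1 r l y)
  (fun y => local_weak_geometric fl s_lt r0 y) q0 (fun y => ltW (weight_gt0 wmu y))
  (measurable_weight wmu) (fun l => local_L1_measurable fl q^-1 r l)).
(* The radius [3 ^+ l * r] is one of those over which the amalgam norm takes its supremum, so all
   terms share one bound. *)
by move=> l; apply: M_ub; rewrite mulr_gt0// exprn_gt0.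
Qed.

Lemma amalgam_bound_pinfty : exists2 K : R, (0 < K)%R & bounded_by +oo K.
Proof.
have s_lt : (0 < alpha^-1)%R by rewrite invr_gt0.
pose K := (local_const n gamma C * (1 - eta 0)^-1)%R.
have K0 : (0 <= K)%R.
  by rewrite mulr_ge0 ?local_const_ge0// invr_ge0 subr_ge0 ltW// eta_lt1.
exists (K + 1)%R => [|f fl]; first by rewrite ltr_wpDl.
set F := l2_norm (fun j x => (f j x)%:E).
have M_ub (r : R) : (0 < r)%R -> ess_sup leb (fun y => wmeas w (eball y r) `^ (alpha^-1 - 1 - 0) *
    L1_norm w (F \_ (eball y r))) <= amalgam_L1 alpha +oo w mu F.
  by move=> r0; apply: ereal_sup_ubound; exists r.
have M0 : 0 <= amalgam_L1 alpha +oo w mu F.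
  apply: le_trans (M_ub 1%R ltr01); apply: ess_sup_gee.
    (* An essential supremum of nonnegative values is nonnegative only over a space of positive
       measure; the unit ball provides it. *)
    apply: lt_le_trans (leb_eball_gt0 0%R n0 ltr01) _.
    by apply: le_measure => //; rewrite inE//; exact: measurable_eball.
  by apply: nearW => y; exact: mule_ge0 (poweR_ge0 _ _) (L1_norm_ge0 _).
apply: ge_ereal_sup => _ [r /= r0 <-].
apply: (@le_trans _ _ (K%:E * amalgam_L1 alpha +oo w mu F)); last first.
  by apply: lee_wpmul2r => //; rewrite lee_fin lerDl.
apply: (ess_sup_geometric (local_const_ge0 n0 gamma_gt0 C0) (eta_gt0 0%R) (eta_lt1 s_lt)
  (fun l y => local_L1_nonneg f 0%R r l y)
  (fun y => local_weak_geometric fl s_lt r0 y)) => //.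
by move=> l; apply: M_ub; rewrite mulr_gt0// exprn_gt0.
Qed.

End amalgam.

Theorem theorem2p2 (R : realType) (n : nat) (gamma alpha : R) (q : \bar R)
    (w mu : Rn R n -> R) :
  (0 < n)%N ->
  (0 < gamma)%R -> (gamma <= 1)%R ->
  (1 <= alpha)%R -> alpha%:E < q ->
  A1 w -> Delta2 mu ->
  exists2 C : R, (0 < C)%R &
    forall f : nat -> Rn R n -> R, (forall j, loc_integrable (f j)) ->
      amalgam_weakL1 alpha q w mu
        (l2_norm (fun j => square_function gamma (f j))) <=
      C%:E * amalgam_L1 alpha q w mu (l2_norm (fun j x => (f j x)%:E)).
Proof.
move=> n0 g0 g1 a1 aq A1w [wmu _]; have ww := A1w.1.
have [C C0 HC] := A1_boundP n0 ww A1w.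
case: q aq => [q||] // aq.
- by apply: (amalgam_bound_fin ww n0 C0 HC g0 g1 a1 wmu); rewrite -lte_fin.
- exact (amalgam_bound_pinfty ww n0 C0 HC g0 g1 mu a1).
Qed.
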